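(* Let $\{(X(t),Y(t))\}_{t\ge 0}$ be a standard orthogonal planar random motion with speed $c>0$ whose changes of direction are governed by a non-homogeneous Poisson process with rate function $\lambda=\lambda(t)\in C^2\bigl((0,\infty),[0,\infty)\bigr)$. The absolutely continuous component $p=p(x,y,t)\in C^4\bigl(\mathbb{R}^2\times[0,\infty),[0,\infty)\bigr)$ of the distribution of $(X(t),Y(t))$ satisfies the fourth-order differential equation with time-varying coefficients $$\biggl(\frac{\partial^2}{\partial t^2}+2\lambda\frac{\partial}{\partial t}+\lambda^2+\lambda'\biggr)\biggl(\frac{\partial^2}{\partial t^2}+2\lambda\frac{\partial}{\partial t}-c^2\Bigl(\frac{\partial^2}{\partial x^2}+\frac{\partial^2}{\partial y^2}\Bigr)\biggr)p+c^4\frac{\partial^4 p}{\partial x^2\partial y^2}=\lambda'\frac{\partial^2 p}{\partial t^2}+(\lambda''+\lambda\lambda')\frac{\partial p}{\partial t}.$$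
   Context: Directions: $d_k=(\cos(k\pi/2),\sin(k\pi/2))$, $k=0,1,2,3$, with indices taken modulo 4. Let $\{N(t)\}_{t\ge0}$ be a non-homogeneous Poisson process with rate function $\lambda(t)$. The standard orthogonal planar random motion with speed $c$ and rate function $\lambda$ is the position $(X(t),Y(t))$ of a particle that starts at the origin at time $0$ with initial direction uniformly distributed on $\{d_0,d_1,d_2,d_3\}$, moves with velocity $c\,d_k$ as long as its current direction $D(t)$ is $d_k$, and at each event of $N$ switches from its current direction $d_k$ to $d_{k+1}$ or $d_{k-1}$, each with probability $1/2$ (independently of everything else). At time $t$ the particle lies in $S_{ct}=\{(x,y)\in\mathbb{R}^2: |x|+|y|\le ct\}$. The absolutely continuous component of the distribution is the density $p(x,y,t)\,dx\,dy=P\{X(t)\in dx,\,Y(t)\in dy\}$ of the part of the law of $(X(t),Y(t))$ that is absolutely continuous with respect to Lebesgue measure. Products of differential operators denote composition (the operators in $t$ act also on the coefficients $\lambda(t)$ to their right). *)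

(* Defs.v *)
From HB Require Import structures.
From mathcomp Require Export all_boot all_order all_algebra.
From mathcomp Require Export all_classical all_reals all_analysis.
Export Order.TTheory GRing.Theory Num.Theory numFieldNormedType.Exports.

Set Implicit Arguments.
Unset Strict Implicit.
Unset Printing Implicit Defensive.

Global Open Scope classical_set_scope.
Global Open Scope ring_scope.

(* f is C^k on the (open) set O with respect to the directions in B: every
   iterated directional derivative of f along elements of B, in any order and of
   length at most k, exists on O and is continuous at the points of O.  When B is
   a basis of V this is the usual class C^k(O) defined by partial derivatives. *)
Fixpoint Ck (R : realType) (V : normedModType R) (B : seq V) (k : nat)
    (O : set V) (f : V -> R) : Prop :=
  (forall z, O z -> {for z, continuous f}) /\
  (if k is k'.+1 then
     forall v, v \in B ->
       (forall z, O z -> derivable f z v) /\ Ck B k' O ('D_v f)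
   else True).

Section SpaceTime.
Context {R : realType}.

(* A point of space-time is z = ((x, y), t). *)
Definition ex : R * R * R := ((1, 0), 0).
Definition ey : R * R * R := ((0, 1), 0).
Definition et : R * R * R := ((0, 0), 1).

Definition px (f : R * R * R -> R) : R * R * R -> R := 'D_ex f.
Definition py (f : R * R * R -> R) : R * R * R -> R := 'D_ey f.
Definition pt (f : R * R * R -> R) : R * R * R -> R := 'D_et f.

Definition inner_operator (c : R) (lambda : R -> R) (f : R * R * R -> R) :
    R * R * R -> R := fun z =>
  pt (pt f) z + 2 * lambda z.2 * pt f z - c ^+ 2 * (px (px f) z + py (py f) z).

Definition outer_operator (lambda : R -> R) (f : R * R * R -> R) :
    R * R * R -> R := fun z =>
  pt (pt f) z + 2 * lambda z.2 * pt f z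
    + (lambda z.2 ^+ 2 + derive1 lambda z.2) * f z.

End SpaceTime.

Section Process.
Context {R : realType} {d : measure_display} {T : measurableType d}
  (P : probability T R).

Definition discrete_rv (S : Type) (X : T -> S) : Prop :=
  forall A : set S, measurable (X @^-1` A).

(* The sigma-algebra generated by a discrete random variable. *)
Definition sigma_rv (S : Type) (X : T -> S) : set (set T) :=
  [set X @^-1` A | A in [set: set S]].

Definition mutually_independent (I : choiceType) (F : I -> set (set T)) : Prop :=
  forall (s : seq I) (E : I -> set T), uniq s ->
    (forall i, i \in s -> F i (E i)) ->
    P (\bigcap_(i in [set` s]) E i) = (\prod_(i <- s) P (E i))%E.

Definition cumulative_rate (lambda : R -> R) (s t : R) : R :=
  \int[lebesgue_measure]_(u in `]s, t]) lambda u.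

(* Only times t >= 0 and values of lambda on ]0, +oo[ matter.  The integrability
   of lambda near 0 is what makes N t finite.  The truncated subtraction
   N t w - N s w is harmless since the paths are nondecreasing. *)
Definition poisson_process (lambda : R -> R) (N : R -> T -> nat) : Prop :=
  [/\ forall t, 0 <= t ->
        lebesgue_measure.-integrable `]0, t] (EFin \o lambda),
      forall t, 0 <= t -> discrete_rv (N t),
      forall w, [/\ N 0 w = 0%N,
        forall s t, 0 <= s -> s <= t -> (N s w <= N t w)%N &
        forall t, 0 <= t -> \forall s \near t^'+, N s w = N t w],
      forall t : nat -> R, 0 <= t 0%N -> (forall i, t i <= t i.+1) ->
        mutually_independent
          (fun i => sigma_rv (fun w => (N (t i.+1) w - N (t i) w)%N)) &
      forall s t k, 0 <= s -> s <= t ->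
        P [set w | (N t w - N s w)%N = k] =
        (expR (- cumulative_rate lambda s t)
          * cumulative_rate lambda s t ^+ k / k`!%:R)%:E].

Definition sigma_process (N : R -> T -> nat) : set (set T) :=
  <<s \bigcup_(t in [set t | 0 <= t]) sigma_rv (N t) >>.

Definition dirx (k : 'Z_4) : R := cos (k%:R * pi / 2).
Definition diry (k : 'Z_4) : R := sin (k%:R * pi / 2).

(* turn i w tells whether the (i+1)-st switch goes from d_k to d_(k+1) (true) or
   to d_(k-1) (false); N t w switches have occurred up to time t. *)
Definition direction (N : R -> T -> nat) (k0 : T -> 'Z_4) (turn : nat -> T -> bool)
    (t : R) (w : T) : 'Z_4 :=
  k0 w + \sum_(i < N t w) (if turn i w then 1 else -1).

Definition standard_orthogonal_motion (c : R) (lambda : R -> R)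
    (X Y : R -> T -> R) : Prop :=
  exists (N : R -> T -> nat) (k0 : T -> 'Z_4) (turn : nat -> T -> bool),
  [/\ poisson_process lambda N,
      discrete_rv k0 /\ (forall k, P [set w | k0 w = k] = (4^-1)%:E),
      forall i, discrete_rv (turn i) /\
        (forall b, P [set w | turn i w = b] = (2^-1)%:E),
      mutually_independent (fun j : option (option nat) =>
        match j with
        | None => sigma_process N
        | Some None => sigma_rv k0
        | Some (Some i) => sigma_rv (turn i)
        end) &
      forall t w, 0 <= t ->
        X t w = c * \int[lebesgue_measure]_(s in `[0, t])
                      dirx (direction N k0 turn s w) /\
        Y t w = c * \int[lebesgue_measure]_(s in `[0, t])
                      diry (direction N k0 turn s w)].

End Process.

Section AbsolutelyContinuousComponent.
Context {R : realType}.

Local Notation plane := (measurableTypeR R * measurableTypeR R)%type.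
Local Notation lebesgue2 :=
  ((@lebesgue_measure R) \x (@lebesgue_measure R))%E.

(* f is a density of the absolutely continuous part in the Lebesgue
   decomposition mu = f dxdy + sigma of mu. *)
Definition ac_component_density (mu : set plane -> \bar R) (f : plane -> R) : Prop :=
  [/\ measurable_fun [set: plane] f,
      forall z, 0 <= f z &
      exists sigma : {measure set plane -> \bar R},
        (exists A : set plane,
          [/\ measurable A, lebesgue2 A = 0%E & sigma (~` A) = 0%E]) /\
        (forall B : set plane, measurable B ->
          mu B = (\int[lebesgue2]_(z in B) (f z)%:E + sigma B)%E)].

End AbsolutelyContinuousComponent.

(* Main.v *)
From HB Require Import structures.
Require Import Defs.
From mathcomp Require Import measurable_realfun ring lra zify.

Set Implicit Arguments.
Unset Strict Implicit.
Unset Printing Implicit Defensive.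

(** The plan is to derive the equation first in an integrated form, by means of
the forward equation of the motion, and then to read it off pointwise from the
density.

The pair (position, direction) is Markov: over a short time the particle is
transported, and at the rate [lambda] it makes a switch to one of the two
neighbouring directions. Hence the mean of [f (X t) (Y t) (direction t)] satisfies
the forward equation ([mean_derive]); the probabilistic input is that the next
increment of the Poisson process and the next turn are independent of the past
([history_atom_indep], [mean_jump_turn]). Test functions [a(x) b(y)] weighted by
[1], [cos], [sin] and [cos^2 - sin^2] of the direction have means [A], [H], [V]
and [E] that form a closed linear system, because a switch acts diagonally on
these weights:
  [A' = c (H_x + V_y)],  [E' = c (H_x - V_y) - 2 lambda E],
  [H' = c/2 (A_x + E_x) - lambda H],  [V' = c/2 (A_y - E_y) - lambda V].
Eliminating [E], [H] and [V] leaves a relation of fourth order in time for [A]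
alone ([weak_fourth_order]): this is the equation, tested against [a(x) b(y)].

To replace means by integrals against [p], one needs that the singular part of the
law puts no mass near the point considered. It is concentrated on the boundary
[|x| + |y| = c t] of the square: outside there is no mass at all, and inside
[box_bound] shows that a square of side [delta] has mass [O(delta^2)], which rules
out a singular part ([singular_no_mass]) through the approximation of Borel sets by
dyadic figures. The bound uses that [x + y] and [x - y] both move with the speed
[c] and that a switch reverses exactly one of them. For one such coordinate,
[barrier] dominates the probability of ending in a given short interval; the
product of two barriers still decreases in mean along the motion.

Near a point off the boundary the weak equation therefore concerns the smooth
function [p]: differentiating under the integral sign ([tested_derive]) and
integrating by parts ([tested_px], [tested_py]) moves all derivatives to [p], and
since the test functions include bumps supported near the point, the equation holds
there ([equation_off_boundary]). A point on the boundary is the limit, in time, of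
points off the boundary, and the equation extends to it by continuity
([equation_holds]). *)

(** * Paths driven by a counting process *)

Lemma lebesgue_measure_itv_lty {R : realType} (b1 b2 : bool) (a b : R) :
  (lebesgue_measure [set` Interval (BSide b1 a) (BSide b2 b)] < +oo :> \bar R)%E.
Proof. by rewrite lebesgue_measure_itv/=; case: ifPn => // _; rewrite ltry. Qed.

Lemma fine_lebesgue_measure_oc {R : realType} (a b : R) : a <= b ->
  fine (lebesgue_measure `]a, b] : \bar R) = b - a.
Proof.
move=> ab; rewrite lebesgue_measure_itv/= lte_fin.
by case: ltgtP ab => //= -> _; rewrite subrr.
Qed.

Section CountingPath.
Context {R : realType}.
Variables (N : R -> nat) (G : nat -> R).
Hypothesis N_ndecr : forall s t, 0 <= s -> s <= t -> (N s <= N t)%N.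
Hypothesis G_le1 : forall n, `|G n| <= 1.
Local Notation mu := (@lebesgue_measure R).
Local Notation v := (fun s => G (N s)).
Local Notation F := (fun t => \int[mu]_(s in `[0, t]) v s).

(** The level sets of a nondecreasing process are intervals. *)
Lemma measurable_counting_path (t : R) : measurable_fun `[0, t] v.
Proof.
move=> _ B mB.
have -> : `[0, t] `&` v @^-1` B =
    \bigcup_(n in [set n | B (G n)]) [set s | s \in `[0, t] /\ N s = n].
  apply/seteqP; split=> s /=; first by move=> [st Bs]; exists (N s).
  by move=> [n /= Bn [st Nsn]]; split=> //; rewrite /v Nsn.
apply: bigcup_measurable => n _; apply: is_interval_measurable.
move=> x y /= [xt Nx] [yt Ny] z /andP[xz zy].
move: xt yt; rewrite !in_itv/= => /andP[x0 xt] /andP[y0 yt].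
split; first by rewrite (le_trans x0 xz) (le_trans zy yt).
apply/eqP; rewrite eqn_leq; apply/andP; split.
  by rewrite -Ny N_ndecr// (le_trans x0 xz).
by rewrite -Nx N_ndecr.
Qed.

Lemma integrable_counting_path (t : R) : mu.-integrable `[0, t] (EFin \o v).
Proof.
apply: measurable_bounded_integrable => //.
- exact: lebesgue_measure_itv_lty.
- exact: measurable_counting_path.
- exists 1; split=> // M M1 s _ /=; exact: le_trans (G_le1 _) (ltW M1).
Qed.

Lemma counting_path_incr (s t : R) : 0 <= s -> s <= t ->
  F t - F s = \int[mu]_(u in `]s, t]) v u.
Proof.
by move=> s0 st; apply: Rintegral_itvB; rewrite ?bnd_simp//;
  exact: integrable_counting_path.
Qed.

Lemma counting_path_const (s t : R) (k : R) : 0 <= s -> s <= t ->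
  (forall u, s < u -> u <= t -> v u = k) -> F t - F s = k * (t - s).
Proof.
move=> s0 st vk; rewrite counting_path_incr//.
rewrite (@eq_Rintegral _ _ _ _ _ (cst k)); last first.
  by move=> u; rewrite inE/= in_itv/= => /andP[su ut]; exact: vk.
by rewrite Rintegral_cst// fine_lebesgue_measure_oc.
Qed.

Lemma counting_path_lip (s t : R) : 0 <= s -> s <= t -> `|F t - F s| <= t - s.
Proof.
move=> s0 st; rewrite counting_path_incr//.
have sub : `]s, t] `<=` `[0, t].
  by apply: subset_itv => //; rewrite bnd_simp.
have iv : mu.-integrable `]s, t] (EFin \o v).
  by apply: integrableS (integrable_counting_path t).
apply: (le_trans (le_normr_Rintegral _ iv)) => //.
have -> : t - s = \int[mu]_(u in `]s, t]) (cst 1 u).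
  by rewrite Rintegral_cst// fine_lebesgue_measure_oc// mul1r.
apply: le_Rintegral => //.
- exact: integrable_norm.
- apply: measurable_bounded_integrable => //.
  + exact: lebesgue_measure_itv_lty.
  + by exists 1; split=> // M M1 u _ /=; rewrite normr1 ltW.
Qed.

(** Only the cells of the grid in which the path jumps contribute to the error,
and there are at most [N T] of them. *)
Lemma counting_path_riemann (T : R) (n : nat) : 0 <= T ->
  `|T / n.+1%:R * (\sum_(j < n.+1) v (j%:R * T / n.+1%:R)) - F T|
    <= 2 * T * (N T)%:R / n.+1%:R.
Proof.
move=> T0; pose t j : R := j%:R * T / n.+1%:R.
have n0 : (0 : R) < n.+1%:R by rewrite ltr0n.
have t_ge0 j : 0 <= t j by rewrite /t divr_ge0// mulr_ge0.
have tS j : t j.+1 - t j = T / n.+1%:R.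
  by rewrite /t -natr1; field; rewrite gt_eqF.
have tlt j : t j <= t j.+1.
  by rewrite -subr_ge0 tS divr_ge0.
have step j : `|T / n.+1%:R * v (t j) - (F (t j.+1) - F (t j))|
    <= 2 * T / n.+1%:R * (N (t j.+1) - N (t j))%:R.
  have [NE|NE] := eqVneq (N (t j.+1)) (N (t j)).
    rewrite (@counting_path_const _ _ (v (t j)))// ?tS ?NE ?subnn ?mulr0.
      by rewrite mulrC subrr normr0.
    move=> u ju uj; congr G; apply/eqP.
    have ju' := ltW ju; rewrite eqn_leq; apply/andP; split.
      by rewrite -NE N_ndecr// (le_trans (t_ge0 j)).
    exact: N_ndecr.
  have N1 : (1 : R) <= (N (t j.+1) - N (t j))%:R.
    by rewrite ler1n subn_gt0 ltn_neqAle eq_sym NE N_ndecr.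
  have b1 : `|T / n.+1%:R * v (t j)| <= T / n.+1%:R.
    rewrite normrM ger0_norm ?divr_ge0// ler_piMr ?divr_ge0//.
  have := @counting_path_lip _ _ (t_ge0 j) (tlt j); rewrite tS => b2.
  apply: (le_trans (ler_normB _ _)); apply: (le_trans (lerD b1 b2)).
  have -> : T / n.+1%:R + T / n.+1%:R = 2 * T / n.+1%:R by ring.
  by rewrite ler_peMr// divr_ge0// mulr_ge0.
have F0 : F (t 0%N) = 0.
  by rewrite /t !mul0r set_itv1 Rintegral_set1.
have -> : F T = \sum_(0 <= j < n.+1) (F (t j.+1) - F (t j)).
  rewrite telescope_sumr// F0 subr0 /t; congr (F _).
  by rewrite mulrC mulrA mulVf ?mul1r// gt_eqF.
rewrite big_mkord mulr_sumr -sumrB.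
apply: (le_trans (ler_norm_sum _ _ _)).
apply: (@le_trans _ _ (\sum_(0 <= j < n.+1)
    2 * T / n.+1%:R * ((N (t j.+1))%:R - (N (t j))%:R))).
  rewrite big_mkord; apply: ler_sum => j _.
  by rewrite -natrB ?N_ndecr//; exact: step.
rewrite -mulr_sumr telescope_sumr// mulrAC ler_pM2r ?invr_gt0//.
have -> : t n.+1 = T by rewrite /t mulrC mulrA mulVf ?mul1r// gt_eqF.
by rewrite ler_wpM2l ?mulr_ge0// gerBl.
Qed.

End CountingPath.

(** * Bounded and discrete random variables *)

Section BoundedExpectation.
Context {R : realType} {d : measure_display} {T : measurableType d}
  (P : probability T R).

Lemma bounded_prob_integrable (D : set T) (f : T -> R) (K : R) :
  measurable D -> measurable_fun setT f -> (forall w, `|f w| <= K) ->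
  P.-integrable D (EFin \o f).
Proof.
move=> mD mf fK; apply: measurable_bounded_integrable => //.
- by apply: (le_lt_trans (probability_le1 P mD)); rewrite ltry.
- exact: measurable_funTS.
- exists K; split=> [|M KM w _ /=]; first exact: num_real.
  exact: le_trans (fK w) (ltW KM).
Qed.

Lemma Rintegral_cst_prob (e : R) : \int[P]_w e = e.
Proof.
rewrite Rintegral_cst//; transitivity (e * fine (1%:E : \bar R)).
  by congr (_ * fine _); exact: probability_setT.
by rewrite mulr1.
Qed.

Lemma bounded_cvg_Rintegral (D : set T) (f_ : nat -> T -> R) (f : T -> R)
    (K : R) : measurable D ->
  (forall n, measurable_fun setT (f_ n)) -> (forall n w, `|f_ n w| <= K) ->
  (forall w, f_ n w @[n --> \oo] --> f w) ->
  \int[P]_(w in D) f_ n w @[n --> \oo] --> \int[P]_(w in D) f w.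
Proof.
move=> mD mf_ f_K f_f.
have mf : measurable_fun setT f.
  by apply: (measurable_fun_cvg (h := f_)) => // w _; exact: f_f.
have iK : P.-integrable D (EFin \o cst K).
  exact: (@bounded_prob_integrable _ _ `|K|).
have [|||||fi _] := @dominated_convergence _ T R P D mD (fun n w => (f_ n w)%:E)
    (fun w => (f w)%:E) (EFin \o cst K).
- by move=> n; exact/measurable_EFinP/measurable_funTS.
- exact/measurable_EFinP/measurable_funTS.
- by apply: aeW => w _; apply/fine_cvgP; split; [exact: nearW|exact: f_f].
- exact: iK.
- by apply: aeW => w n _; rewrite lee_fin.
by rewrite -[X in _ --> X]fineK; [exact: fine_cvg|exact: integrable_fin_num].
Qed.

End BoundedExpectation.

Section DiscreteRV.
Context {d : measure_display} {T : measurableType d}.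

Lemma discrete_rv_countable (S : countType) (X : T -> S) :
  (forall s, measurable (X @^-1` [set s])) -> discrete_rv X.
Proof.
move=> mX A.
have -> : X @^-1` A = \bigcup_(n in [set n | exists2 s, A s & pickle s = n])
    [set w | pickle (X w) = n].
  apply/seteqP; split=> w /=; first by move=> Aw; exists (pickle (X w)) => //; exists (X w).
  by move=> [n /= [s As <-]] /(pcan_inj pickleK) ->.
apply: bigcup_measurable => n [s As <-].
rewrite (_ : [set w | _] = X @^-1` [set s]); first exact: mX.
by apply/seteqP; split=> w /= => [/(pcan_inj pickleK)|->].
Qed.

Lemma discrete_rv_comp (S S' : Type) (X : T -> S) (f : S -> S') :
  discrete_rv X -> discrete_rv (f \o X).
Proof. by move=> mX A; exact: (mX (f @^-1` A)). Qed.

Lemma discrete_rv_pair (S S' : countType) (X : T -> S) (X' : T -> S') :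
  discrete_rv X -> discrete_rv X' -> discrete_rv (fun w => (X w, X' w)).
Proof.
move=> mX mX'; apply: discrete_rv_countable => -[s s'].
rewrite (_ : _ @^-1` _ = X @^-1` [set s] `&` X' @^-1` [set s']).
  exact: measurableI.
by apply/seteqP; split=> w /= => [[]|[-> ->]].
Qed.

Lemma discrete_rv_seq (I : Type) (S : countType) (X : I -> T -> S) (s : seq I) :
  (forall i, discrete_rv (X i)) -> discrete_rv (fun w => [seq X i w | i <- s]).
Proof.
move=> mX; elim: s => [|i s IH] /=.
  by move=> A; rewrite preimage_cst; case: ifP.
have := discrete_rv_pair (mX i) IH.
by move=> /(@discrete_rv_comp _ _ _ (fun p => p.1 :: p.2)).
Qed.

Lemma discrete_rv_measurable {R : realType} (S : Type) (X : T -> S) (f : S -> R) :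
  discrete_rv X -> measurable_fun setT (fun w => f (X w)).
Proof. by move=> mX _ B mB; rewrite setTI; exact: (mX (f @^-1` B)). Qed.

End DiscreteRV.

Section DiscreteIndependence.
Context {R : realType} {d : measure_display} {T : measurableType d}
  (P : probability T R).

(** Independence tested on the atoms of a discrete variable extends to bounded
functions of it by summing over its countably many values. *)
Lemma discrete_indep_Rintegral (S : countType) (W : T -> S) (E : set T) (q : R)
    (G : S -> R) (K : R) :
  discrete_rv W -> measurable E -> (forall s, `|G s| <= K) ->
  (forall s, P (W @^-1` [set s] `&` E) = (q%:E * P (W @^-1` [set s]))%E) ->
  \int[P]_(w in E) G (W w) = q * \int[P]_w G (W w).
Proof.
move=> mW mE GK PE.
pose F n := [set w | pickle (W w) = n].
have mF n : measurable (F n) by exact: (mW [set s | pickle s = n]).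
have tF : trivIset setT F.
  apply/trivIsetP => i j _ _ ij; apply/seteqP; split=> // w [].
  by rewrite /F/= => wi wj; move: ij; rewrite -wi -wj eqxx.
have UF : \bigcup_n F n = setT.
  by apply/seteqP; split=> // w _; exists (pickle (W w)).
have mG : measurable_fun setT (fun w => G (W w)) by exact: discrete_rv_measurable.
rewrite -RintegralZl//; last exact: (@bounded_prob_integrable _ _ _ P _ _ K).
have domE : E = \bigcup_n (F n `&` E) by rewrite -setI_bigcupl UF setTI.
congr fine; rewrite [X in integral _ X _ = _]domE integral_bigcup//; last first.
- by apply: (@bounded_prob_integrable _ _ _ P _ _ K) => //;
    apply: bigcup_measurable => n _; exact: measurableI.
- by move=> n; exact: measurableI.
- by apply: trivIset_setIr.
rewrite -[X in _ = integral _ X _]UF [RHS]integral_bigcup//; last first.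
  rewrite UF; apply: (@bounded_prob_integrable _ _ _ P _ _ (`|q| * K)) => //.
    exact: measurable_funM.
  by move=> w; rewrite normrM ler_wpM2l.
apply: eq_eseriesr => n _.
case En : (@unpickle S n) => [s|]; last first.
  have F0 : F n = set0.
    by rewrite -subset0 => w /= wn; move: En; rewrite -wn pickleK.
  by rewrite F0 set0I !integral_set0.
have [sn|sn] := eqVneq (pickle s) n; last first.
  have F0 : F n = set0.
    rewrite -subset0 => w /= wn; move: En sn.
    by rewrite -wn pickleK => -[->]; rewrite eqxx.
  by rewrite F0 set0I !integral_set0.
have FE : F n = W @^-1` [set s].
  apply/seteqP; split=> w; rewrite /F/= -sn; last by move=> ->.
  by move=> /(pcan_inj pickleK).
rewrite (@eq_integral _ _ _ _ _ (cst (G s)%:E)); last first.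
  by move=> w; rewrite FE inE => -[/= ->].
rewrite [RHS](@eq_integral _ _ _ _ _ (cst (q * G s)%:E)); last first.
  by move=> w; rewrite FE inE => /= ->.
rewrite !integral_cst//; last exact: measurableI.
rewrite FE; transitivity ((G s)%:E * (q%:E * P (W @^-1` [set s])))%E.
  by congr (_ * _)%E; exact: PE.
by rewrite EFinM muleCA muleA.
Qed.

End DiscreteIndependence.

(** * The past of the motion *)

(** The motion with its driving variables exposed: one choice of them serves all
the instants. *)
Definition driven_motion {R : realType} {d : measure_display}
    {T : measurableType d} (P : probability T R) (c : R) (lambda : R -> R)
    (N : R -> T -> nat) (k0 : T -> 'Z_4) (turn : nat -> T -> bool)
    (X Y : R -> T -> R) : Prop :=
  [/\ poisson_process P lambda N,
      discrete_rv k0 /\ (forall k, P [set w | k0 w = k] = (4^-1)%:E),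
      forall i, discrete_rv (turn i) /\
        (forall b, P [set w | turn i w = b] = (2^-1)%:E),
      mutually_independent P (fun j : option (option nat) =>
        match j with
        | None => sigma_process N
        | Some None => sigma_rv k0
        | Some (Some i) => sigma_rv (turn i)
        end) &
      forall t w, 0 <= t ->
        X t w = c * \int[lebesgue_measure]_(s in `[0, t])
                      dirx (direction N k0 turn s w) /\
        Y t w = c * \int[lebesgue_measure]_(s in `[0, t])
                      diry (direction N k0 turn s w)].

Section History.
Context {R : realType} {d : measure_display} {T : measurableType d}.
Context (P : probability T R) (c : R) (lambda : R -> R).
Context (N : R -> T -> nat) (k0 : T -> 'Z_4) (turn : nat -> T -> bool).
Context (X Y : R -> T -> R).
Hypothesis motion : driven_motion P c lambda N k0 turn X Y.

Lemma poissonN : poisson_process P lambda N. Proof. by case: motion. Qed.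

Lemma N_ndecr w (s t : R) : 0 <= s -> s <= t -> (N s w <= N t w)%N.
Proof. by case: poissonN => _ _ /(_ w)[_ + _] _ _; exact. Qed.

Lemma N0 w : N 0 w = 0%N.
Proof. by case: poissonN => _ _ /(_ w)[]. Qed.

Lemma discrete_N t : 0 <= t -> discrete_rv (N t).
Proof. by case: poissonN => _ + _ _ _; exact. Qed.

Lemma discrete_turn i : discrete_rv (turn i).
Proof. by case: motion => _ _ /(_ i)[]. Qed.

Lemma discrete_k0 : discrete_rv k0.
Proof. by case: motion => _ []. Qed.

(** Everything that determines the position and the direction at the instants
[tau 0 <= ... <= tau n]: the increments of the counting process, the initial
direction, and the outcomes of the switches that have already occurred. *)
Definition history (tau : nat -> R) (n : nat) (w : T) :
    seq nat * 'Z_4 * seq bool :=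
  ([seq (N (tau i.+1) w - N (tau i) w)%N | i <- iota 0 n], k0 w,
   [seq turn i w | i <- iota 0 (N (tau n) w)]).

(** The direction at the [j]-th instant, read back from a history: the increments
up to [j] tell how many of the recorded switches have occurred by then. *)
Definition history_direction (u : seq nat * 'Z_4 * seq bool) (j : nat) : 'Z_4 :=
  u.1.2 + \sum_(i < sumn (take j u.1.1)) (if nth true u.2 i then 1 else -1).

(** The turn concerned is the first one after [s], whether or not it occurs
before [t]. *)
Definition jump_turn (s t : R) (m : nat) (b : bool) : set T :=
  [set w | (N t w - N s w)%N = m /\ turn (N s w) w = b].

Lemma discrete_turn_next s : 0 <= s -> discrete_rv (fun w => turn (N s w) w).
Proof.
move=> s0; apply: discrete_rv_countable => b.
rewrite (_ : _ @^-1` _ = \bigcup_n (N s @^-1` [set n] `&` turn n @^-1` [set b])).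
  apply: bigcup_measurable => n _; apply: measurableI.
    exact: discrete_N.
  exact: discrete_turn.
by apply/seteqP; split=> w /= => [wb|[n _ [<-//]]]; exists (N s w).
Qed.

Lemma measurable_jump_turn s t m b : 0 <= s -> 0 <= t ->
  measurable (jump_turn s t m b).
Proof.
move=> s0 t0; apply: measurableI.
  exact: (discrete_rv_pair (discrete_N t0) (discrete_N s0)
    [set q | (q.1 - q.2)%N = m]).
exact: (discrete_turn_next s0 [set b]).
Qed.

Section Grid.
Variables (tau : nat -> R) (n : nat).
Hypothesis tau0 : tau 0%N = 0.
Hypothesis tauS : forall i, tau i <= tau i.+1.

Lemma tau_homo i j : (i <= j)%N -> tau i <= tau j.
Proof.
by move=> ij; apply: (homo_leq (r := fun x y : R => x <= y) (@lexx _ R)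
  (fun y x z => @le_trans _ R y x z) tauS ij).
Qed.

Lemma tau_ge0 i : 0 <= tau i.
Proof. by rewrite -tau0 tau_homo. Qed.

Lemma discrete_history : discrete_rv (history tau n).
Proof.
have m1 : discrete_rv (fun w => (history tau n w).1.1).
  apply: discrete_rv_seq => i.
  have := discrete_rv_pair (discrete_N (tau_ge0 i.+1)) (discrete_N (tau_ge0 i)).
  by move=> /(discrete_rv_comp (fun q => (q.1 - q.2)%N)).
have m2 : discrete_rv (fun w => (history tau n w).2).
  apply: discrete_rv_countable => s.
  rewrite (_ : _ @^-1` _ = N (tau n) @^-1` [set size s] `&`
      (fun w => [seq turn i w | i <- iota 0 (size s)]) @^-1` [set s]).
    apply: measurableI; first exact: (discrete_N (tau_ge0 n)).
    exact: (discrete_rv_seq (iota 0 (size s)) discrete_turn).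
  apply/seteqP; split=> w /=; last by move=> [-> ->].
  by move=> <-; rewrite size_map size_iota.
exact: (discrete_rv_pair (discrete_rv_pair m1 discrete_k0) m2).
Qed.

Lemma sumn_history w j : (j <= n)%N ->
  sumn (take j (history tau n w).1.1) = N (tau j) w.
Proof.
move=> jn; rewrite /= -map_take take_iota (minn_idPl jn).
elim: j {jn} => [|j IH]; first by rewrite tau0 N0.
rewrite -addn1 iotaD map_cat sumn_cat IH /= addn0 add0n addn1 subnKC//.
by rewrite N_ndecr// tau_ge0.
Qed.

Lemma history_directionE w j : (j <= n)%N ->
  history_direction (history tau n w) j = direction N k0 turn (tau j) w.
Proof.
move=> jn; rewrite /history_direction sumn_history// /direction /=.
congr (_ + _); apply: eq_bigr => i _.
rewrite (nth_map 0%N) ?size_iota ?nth_iota ?add0n//.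
  by rewrite (leq_trans (ltn_ord i))// N_ndecr ?tau_ge0// tau_homo.
by rewrite (leq_trans (ltn_ord i))// N_ndecr ?tau_ge0// tau_homo.
Qed.

Lemma sigma_process_incr s t (A : set nat) : 0 <= s -> 0 <= t ->
  sigma_process N [set w | A (N t w - N s w)%N].
Proof.
move=> s0 t0; rewrite /sigma_process.
have sub r B : 0 <= r ->
    measurable ((N r : g_sigma_algebraType
      (\bigcup_(t in [set t | 0 <= t]) sigma_rv (N t)) -> nat) @^-1` B).
  by move=> r0; apply: sub_sigma_algebra; exists r => //; exists B.
suff : measurable ([set w | A (N t w - N s w)%N] : set (g_sigma_algebraType
      (\bigcup_(t in [set t | 0 <= t]) sigma_rv (N t)))) by [].
rewrite (_ : [set w | _] = \bigcup_a (N s @^-1` [set a] `&`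
    N t @^-1` [set b | A (b - a)%N])).
  by apply: bigcup_measurable => a _; apply: measurableI; exact: sub.
by apply/seteqP; split=> w /= => [Aw|[a _ [<-//]]]; exists (N s w).
Qed.

Section Atom.
Variables (m : nat) (b : bool) (delta : seq nat) (k : 'Z_4) (s : seq bool).

Let incr i := [set w | (N (tau i.+1) w - N (tau i) w)%N = nth m delta i].
Let incrs l := \bigcap_(i in [set` iota 0 l]) incr i.
Let ev l (j : option (option nat)) : set T :=
  match j with
  | None => incrs l
  | Some None => [set w | k0 w = k]
  | Some (Some i) => [set w | turn i w = nth b s i]
  end.
Let idx l0 : seq (option (option nat)) :=
  [:: None, Some None & [seq Some (Some i) | i <- iota 0 l0]].

Let needed l0 (j : option (option nat)) : bool :=
  if j is Some (Some i) then (i < l0)%N else true.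

Let P_incrs l : P (incrs l) = (\prod_(i <- iota 0 l) P (incr i))%E.
Proof.
case: poissonN => _ _ _ + _ => /(_ tau); apply; rewrite ?tau0 ?iota_uniq//.
by move=> i _; exists [set nth m delta i].
Qed.

Let P_idx l l0 : P (\bigcap_(j in [set j | needed l0 j]) ev l j) =
  (P (incrs l) * (4^-1 * 2^-1 ^+ l0)%:E)%E.
Proof.
have -> : [set j | needed l0 j] = [set` idx l0].
  have mem_idx j : (j \in idx l0) = needed l0 j.
    case: j => [[i|]|]; rewrite !inE//=; apply/mapP/idP => [[j + [->]]|il].
      by rewrite mem_iota.
    by exists i; rewrite ?mem_iota.
  by apply/seteqP; split=> j /=; rewrite mem_idx.
case: motion => _ [_ Pk0] Pturn indep _.
rewrite indep.
- rewrite !big_cons big_map/= Pk0 EFinM; congr (_ * (_ * _))%E.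
  under eq_bigr do rewrite (Pturn _).2.
  by rewrite prodEFin big_const_seq count_predT size_iota iter_mulr_1.
- rewrite /= map_inj_uniq ?iota_uniq ?andbT/=; last by move=> i j [].
  by rewrite inE/=; apply/andP; split; apply/mapP => -[].
- move=> [[i|]|] _ /=; first by exists [set nth b s i].
    by exists [set k].
  apply: (@bigcap_measurableType _ (g_sigma_algebraType
    (\bigcup_(t in [set t | 0 <= t]) sigma_rv (N t)))) => i _.
  exact: (@sigma_process_incr _ _ [set nth m delta i] (tau_ge0 i) (tau_ge0 i.+1)).
Qed.

(** The next increment and the next turn are independent of the past. Turns are
indexed by the rank of the switch, and that rank is random; it becomes a constant
on an atom of the past, where independence turns into a product of
probabilities of the driving variables. *)
Lemma history_atom_indep (Lam := cumulative_rate lambda (tau n) (tau n.+1)) :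
  P (history tau n @^-1` [set (delta, k, s)] `&`
      jump_turn (tau n) (tau n.+1) m b) =
  ((expR (- Lam) * Lam ^+ m / m`!%:R / 2)%:E *
    P (history tau n @^-1` [set (delta, k, s)]))%E.
Proof.
have [/andP[/eqP sd /eqP ss]|inv] :=
    boolP ((size delta == n) && (size s == sumn delta)); last first.
  rewrite (_ : history tau n @^-1` _ = set0) ?set0I ?measure0 ?mule0//.
  rewrite -subset0 => w /= hw; move: inv (sumn_history w (leqnn n)).
  move: hw; rewrite /history => -[<- _ <-].
  by rewrite !size_map !size_iota eqxx/= -map_take take_iota minnn => + E;
    rewrite E eqxx.
have hist_n w : history tau n w = (delta, k, s) ->
    N (tau n) w = size s /\ (forall i, (i < n)%N -> incr i w) /\ k0 w = k /\
    (forall i, (i < size s)%N -> turn i w = nth b s i).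
  move=> hw; have Nn : N (tau n) w = size s.
    by rewrite -(sumn_history w (leqnn n)) hw/= -sd take_size.
  move: hw => -[hd hk hs]; split=> //; split; [|split=> //].
    move=> i lin; rewrite /incr/= -hd (nth_map 0%N) ?size_iota// nth_iota//.
  move=> i lis; rewrite -hs (nth_map 0%N) ?size_iota ?nth_iota ?Nn//.
have n_hist w : (forall i, (i < n)%N -> incr i w) -> k0 w = k ->
    (forall i, (i < size s)%N -> turn i w = nth b s i) ->
    history tau n w = (delta, k, s) /\ N (tau n) w = size s.
  move=> hd hk hs.
  have hd' : [seq (N (tau i.+1) w - N (tau i) w)%N | i <- iota 0 n] = delta.
    apply: (@eq_from_nth _ m); rewrite size_map size_iota// => i lin.
    by rewrite (nth_map 0%N) ?size_iota// nth_iota// hd.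
  have Nn : N (tau n) w = size s.
    by rewrite -(sumn_history w (leqnn n)) /= hd' -sd take_size ss.
  split=> //; rewrite /history hd' hk Nn; congr (_, _).
  apply: (@eq_from_nth _ b); rewrite size_map size_iota// => i lin.
  by rewrite (nth_map 0%N) ?size_iota// nth_iota// hs.
have in_iota i l : [set` iota 0 l] i -> (i < l)%N by rewrite /= mem_iota.
have E1 : history tau n @^-1` [set (delta, k, s)] =
    \bigcap_(j in [set j | needed (size s) j]) ev n j.
  apply/seteqP; split=> w.
    move=> /hist_n[_ [hd [hk hs]]] [[i|]|] //=; first exact: hs.
    by move=> _ i /=; rewrite mem_iota; exact: hd.
  move=> h; have [|||//] := n_hist w.
  - by move=> i lin; apply: (h None) => //=; rewrite mem_iota.
  - exact: (h (Some None)).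
  - by move=> i lis; apply: (h (Some (Some i))).
have E2 : history tau n @^-1` [set (delta, k, s)] `&`
      jump_turn (tau n) (tau n.+1) m b =
    \bigcap_(j in [set j | needed (size s).+1 j]) ev n.+1 j.
  apply/seteqP; split=> w.
    move=> [/hist_n[Nn [hd [hk hs]]] [jm jb]] [[i|]|] //=.
      rewrite ltnS leq_eqVlt => /orP[/eqP ->|]; last exact: hs.
      by rewrite -{1}Nn jb nth_default.
    move=> _ i /in_iota; rewrite ltnS leq_eqVlt.
    move=> /orP[/eqP ->|]; last exact: hd.
    by rewrite /incr/= jm nth_default// sd.
  move=> h.
  have hinc i : (i <= n)%N -> incr i w.
    by move=> lin; apply: (h None) => //; rewrite /mkset mem_iota add0n ltnS.
  have hturn i : (i <= size s)%N -> turn i w = nth b s i.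
    by move=> lis; apply: (h (Some (Some i))).
  have [|||hw Nn] := n_hist w.
  - by move=> i /ltnW; exact: hinc.
  - exact: (h (Some None)).
  - by move=> i /ltnW; exact: hturn.
  split=> //; split.
    by have := hinc n (leqnn n); rewrite /incr/= nth_default ?sd.
  by rewrite Nn hturn// nth_default.
have PIn : P (incr n) = (expR (- Lam) * Lam ^+ m / m`!%:R)%:E.
  rewrite /incr/= nth_default ?sd//.
  by case: poissonN => _ _ _ _; apply; rewrite ?tau_ge0.
rewrite E2 E1 !P_idx !P_incrs -[n.+1]addn1 iotaD big_cat big_seq1 PIn.
have [r ->] : exists r, (\prod_(i <- iota 0 n) P (incr i))%E = r%:E.
  have PI i : P (incr i) = (fine (P (incr i)))%:E.
    case: poissonN => _ _ _ _ /(_ (tau i) (tau i.+1) (nth m delta i)).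
    by rewrite /incr => ->//; rewrite ?tau_ge0.
  under eq_bigr do rewrite PI.
  by rewrite prodEFin; eexists.
rewrite -!EFinM; congr (_%:E); rewrite exprS; ring.
Qed.
End Atom.

End Grid.
End History.

(** * Means of functions of the state *)

Lemma cvg_le_harmonic {R : realType} (u : nat -> R) (l B : R) :
  (forall n, `|u n - l| <= B / n.+1%:R) -> u n @[n --> \oo] --> l.
Proof.
move=> uB; apply/subr_cvg0; apply: norm_cvg0.
apply: (@squeeze_cvgr _ _ _ _ (cst 0) (fun n => B * harmonic n)).
- by apply: nearW => n; rewrite normr_ge0 uB.
- exact: cvg_cst.
- by rewrite -[X in _ --> X](mulr0 B); apply: cvgMr; exact: cvg_harmonic.
Qed.

(** The regularity that lets a mean pass to the limit along approximations of the
position by Riemann sums. *)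
Definition lipb {R : realType} (K L : R) (f : R -> R -> 'Z_4 -> R) : Prop :=
  (forall x y k, `|f x y k| <= K) /\
  (forall x y x' y' k,
    `|f x y k - f x' y' k| <= L * (`|x - x'| + `|y - y'|)).

Lemma dirx_le1 {R : realType} (k : 'Z_4) : `|dirx k : R| <= 1.
Proof. exact: cos_max. Qed.

Lemma diry_le1 {R : realType} (k : 'Z_4) : `|diry k : R| <= 1.
Proof. exact: sin_max. Qed.

Section Markov.
Context {R : realType} {d : measure_display} {T : measurableType d}.
Context (P : probability T R) (c : R) (lambda : R -> R).
Context (N : R -> T -> nat) (k0 : T -> 'Z_4) (turn : nat -> T -> bool).
Context (X Y : R -> T -> R).
Hypothesis c_gt0 : 0 < c.
Hypothesis lambda_ge0 : forall t : R, 0 < t -> 0 <= lambda t.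
Hypothesis motion : driven_motion P c lambda N k0 turn X Y.
Local Notation D := (direction N k0 turn).

(** The functions may depend on the direction as well, since the position alone
is not Markov. *)
Definition mean (f : R -> R -> 'Z_4 -> R) (t : R) : R :=
  \int[P]_w f (X t w) (Y t w) (D t w).

Section Path.
Variables (v : 'Z_4 -> R) (w : T).
Hypothesis v_le1 : forall k, `|v k| <= 1.
Let G n := v (k0 w + \sum_(i < n) (if turn i w then 1 else -1)).
Local Notation path t := (\int[lebesgue_measure]_(s in `[0, t]) v (D s w)).

Lemma path_const s t k : 0 <= s -> s <= t ->
  (forall u, s < u -> u <= t -> v (D u w) = k) -> path t - path s = k * (t - s).
Proof.
exact: (@counting_path_const _ (N^~ w) G (N_ndecr motion w) (fun=> v_le1 _)).
Qed.

Lemma path_lip s t : 0 <= s -> s <= t -> `|path t - path s| <= t - s.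
Proof.
exact: (@counting_path_lip _ (N^~ w) G (N_ndecr motion w) (fun=> v_le1 _)).
Qed.

Lemma path_riemann t n : 0 <= t ->
  `|t / n.+1%:R * (\sum_(j < n.+1) v (D (j%:R * t / n.+1%:R) w)) - path t|
    <= 2 * t * (N t w)%:R / n.+1%:R.
Proof.
exact: (@counting_path_riemann _ (N^~ w) G (N_ndecr motion w) (fun=> v_le1 _)).
Qed.

End Path.

Lemma XE t w : 0 <= t ->
  X t w = c * \int[lebesgue_measure]_(s in `[0, t]) dirx (D s w).
Proof. by move=> t0; case: motion => _ _ _ _ /(_ t w t0)[]. Qed.

Lemma YE t w : 0 <= t ->
  Y t w = c * \int[lebesgue_measure]_(s in `[0, t]) diry (D s w).
Proof. by move=> t0; case: motion => _ _ _ _ /(_ t w t0)[]. Qed.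

Section Grid.
Variables (t h : R).
Hypotheses (t_ge0 : 0 <= t) (h_ge0 : 0 <= h).

(** The equal steps refine the past of [t]; the step that follows them is the
future increment to be decoupled from that past. *)
Definition grid (n i : nat) : R :=
  if (i <= n.+1)%N then i%:R * t / n.+1%:R else t + h.

Lemma grid0 n : grid n 0 = 0.
Proof. by rewrite /grid/= !mul0r. Qed.

Lemma grid_last n : grid n n.+1 = t.
Proof. by rewrite /grid leqnn mulrAC divff ?mul1r// pnatr_eq0. Qed.

Lemma grid_beyond n : grid n n.+2 = t + h.
Proof. by rewrite /grid ltnn. Qed.

Lemma gridS n i : grid n i <= grid n i.+1.
Proof.
rewrite /grid; case: ifPn => [iin|]; last first.
  by move=> ni; rewrite ifN//; apply: contra ni => /ltnW.
case: ifPn => _; first by rewrite ler_pM2r ?invr_gt0 ?ltr0n// ler_wpM2r// ler_nat.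
rewrite (@le_trans _ _ t)// ?lerDl// mulrAC ler_piMl//.
by rewrite ler_pdivrMr ?ltr0n// mul1r ler_nat.
Qed.

(** The Riemann sum of the velocity, as a function of the history. *)
Definition coded_position (v : 'Z_4 -> R) (n : nat) u :=
  c * (t / n.+1%:R * \sum_(j < n.+1) v (history_direction u j)).

Lemma coded_position_cvg v w n : (forall k, `|v k| <= 1) ->
  `|coded_position v n (history N k0 turn (grid n) n.+1 w)
    - c * \int[lebesgue_measure]_(s in `[0, t]) v (D s w)|
  <= 2 * c * t * (N t w)%:R / n.+1%:R.
Proof.
move=> v1; rewrite /coded_position -mulrBr normrM gtr0_norm//.
have -> : 2 * c * t * (N t w)%:R / n.+1%:R = c * (2 * t * (N t w)%:R / n.+1%:R).
  by ring.
rewrite ler_pM2l//.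
have -> : \sum_(j < n.+1) v (history_direction (history N k0 turn (grid n) n.+1 w) j)
    = \sum_(j < n.+1) v (D (j%:R * t / n.+1%:R) w).
  apply: eq_bigr => j _; rewrite (history_directionE motion (grid0 n) (@gridS n)).
    by rewrite /grid ltnW.
  by rewrite ltnW.
exact: path_riemann.
Qed.

Lemma measurable_coordinate v : (forall k, `|v k| <= 1) ->
  measurable_fun setT (fun w => c * \int[lebesgue_measure]_(s in `[0, t]) v (D s w)).
Proof.
move=> v1; apply: (measurable_fun_cvg (h := fun n w =>
  coded_position v n (history N k0 turn (grid n) n.+1 w))) => //.
  move=> n; apply: discrete_rv_measurable.
  exact: (discrete_history motion n.+1 (grid0 n) (@gridS n)).
by move=> w _; apply: (@cvg_le_harmonic _ _ _ (2 * c * t * (N t w)%:R)) => n;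
  exact: coded_position_cvg.
Qed.

Section Coded.
Variables (f : R -> R -> 'Z_4 -> R) (K L : R).
Hypothesis f_lipb : lipb K L f.

Definition coded n u :=
  f (coded_position dirx n u) (coded_position diry n u) (history_direction u n.+1).

Lemma coded_cvg w :
  coded n (history N k0 turn (grid n) n.+1 w) @[n --> \oo] -->
  f (X t w) (Y t w) (D t w).
Proof.
have L_ge0 : 0 <= L.
  have := f_lipb.2 1 0 0 0 0; rewrite !subr0 normr1 normr0 addr0 mulr1.
  exact: le_trans.
apply: (@cvg_le_harmonic _ _ _ (L * (4 * c * t * (N t w)%:R))) => n.
rewrite /coded (history_directionE motion (grid0 n) (@gridS n))// grid_last.
apply: (le_trans (f_lipb.2 _ _ _ _ _)); rewrite -mulrA ler_wpM2l//.
rewrite XE// YE//.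
have := coded_position_cvg w n (@dirx_le1 R).
have := coded_position_cvg w n (@diry_le1 R).
set a := `|_ - _|; set b := `|_ - _| => ha hb.
have -> : 4 * c * t * (N t w)%:R / n.+1%:R = 2 * c * t * (N t w)%:R / n.+1%:R +
  2 * c * t * (N t w)%:R / n.+1%:R by ring.
exact: lerD.
Qed.

Lemma measurable_coded n :
  measurable_fun setT (fun w => coded n (history N k0 turn (grid n) n.+1 w)).
Proof.
apply: discrete_rv_measurable.
exact: (discrete_history motion n.+1 (grid0 n) (@gridS n)).
Qed.

Lemma measurable_state_grid : measurable_fun setT (fun w => f (X t w) (Y t w) (D t w)).
Proof.
apply: (measurable_fun_cvg
  (h := fun n w => coded n (history N k0 turn (grid n) n.+1 w))) => //.
- by move=> n; exact: measurable_coded.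
- by move=> w _; exact: coded_cvg.
Qed.

(** The number of switches after [t] and the outcome of the first of them are
independent of the past; the past is approximated by histories along finer and
finer grids, because the position is the limit of Riemann sums. *)
Lemma mean_jump_turn m b (Lam := cumulative_rate lambda t (t + h)) :
  \int[P]_(w in jump_turn N turn t (t + h) m b) f (X t w) (Y t w) (D t w) =
  expR (- Lam) * Lam ^+ m / m`!%:R / 2 * mean f t.
Proof.
have mJ := measurable_jump_turn motion m b t_ge0 (addr_ge0 t_ge0 h_ge0).
have cJ := @bounded_cvg_Rintegral _ _ _ P _
  (fun n w => coded n (history N k0 turn (grid n) n.+1 w)) _ K mJ measurable_coded
  (fun n w => f_lipb.1 _ _ _) coded_cvg.
have cT := @bounded_cvg_Rintegral _ _ _ P _
  (fun n w => coded n (history N k0 turn (grid n) n.+1 w)) _ K measurableT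
  measurable_coded (fun n w => f_lipb.1 _ _ _) coded_cvg.
set q := (X in _ = X * _).
have E n : \int[P]_(w in jump_turn N turn t (t + h) m b)
      coded n (history N k0 turn (grid n) n.+1 w) =
    q * \int[P]_w coded n (history N k0 turn (grid n) n.+1 w).
  apply: (@discrete_indep_Rintegral _ _ _ P _ _ _ _ (coded n) K) => //.
  - exact: (discrete_history motion n.+1 (grid0 n) (@gridS n)).
  - by move=> u; exact: f_lipb.1.
  - move=> [[delta k] s].
    have := history_atom_indep motion n.+1 (grid0 n) (@gridS n) m b delta k s.
    by rewrite /= grid_last grid_beyond.
rewrite (funext E) in cJ.
by apply: (cvg_unique (@Rhausdorff R) cJ); exact: cvgMr.
Qed.

End Coded.
End Grid.

Lemma measurable_X t : 0 <= t -> measurable_fun setT (X t).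
Proof.
move=> t0; rewrite (_ : X t = fun w => c * \int[lebesgue_measure]_(s in `[0, t])
  dirx (D s w)); last by apply/funext => w; exact: XE.
exact: (measurable_coordinate t0 (lexx 0) dirx_le1).
Qed.

Lemma measurable_Y t : 0 <= t -> measurable_fun setT (Y t).
Proof.
move=> t0; rewrite (_ : Y t = fun w => c * \int[lebesgue_measure]_(s in `[0, t])
  diry (D s w)); last by apply/funext => w; exact: YE.
exact: (measurable_coordinate t0 (lexx 0) diry_le1).
Qed.

Lemma measurable_state f K L t : 0 <= t -> lipb K L f ->
  measurable_fun setT (fun w => f (X t w) (Y t w) (D t w)).
Proof. by move=> t0 fl; exact: (measurable_state_grid t0 (lexx 0) fl). Qed.

Lemma integrable_state f K L t (A : set T) : 0 <= t -> lipb K L f ->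
  measurable A ->
  P.-integrable A (EFin \o (fun w => f (X t w) (Y t w) (D t w))).
Proof.
move=> t0 fl mA; apply: (@bounded_prob_integrable _ _ _ P _ _ K) => //.
  exact: measurable_state fl.
by move=> w; exact: fl.1.
Qed.

End Markov.

(** * One small time step *)

Definition flow {R : realType} (c h : R) (f : R -> R -> 'Z_4 -> R) :
    R -> R -> 'Z_4 -> R :=
  fun x y k => f (x + c * h * dirx k) (y + c * h * diry k) k.

Definition turned {R : realType} (s : 'Z_4) (f : R -> R -> 'Z_4 -> R) :
    R -> R -> 'Z_4 -> R :=
  fun x y k => f x y (k + s).

Section LipbTheory.
Context {R : realType}.
Implicit Types (K L c h : R) (f : R -> R -> 'Z_4 -> R).

Lemma lipb_K_ge0 K L f : lipb K L f -> 0 <= K.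
Proof. by move=> [fK _]; exact: le_trans (fK 0 0 0). Qed.

Lemma lipb_L_ge0 K L f : lipb K L f -> 0 <= L.
Proof.
move=> [_ fL]; have := fL 1 0 0 0 0.
by rewrite !subr0 normr1 normr0 addr0 mulr1; exact: le_trans.
Qed.

Lemma lipbD K L K' L' f g : lipb K L f -> lipb K' L' g ->
  lipb (K + K') (L + L') (fun x y k => f x y k + g x y k).
Proof.
move=> fl gl; split=> [x y k|x y x' y' k].
  by apply: (le_trans (ler_normD _ _)); rewrite lerD ?fl.1 ?gl.1.
rewrite opprD addrACA; apply: (le_trans (ler_normD _ _)).
by rewrite mulrDl lerD ?fl.2 ?gl.2.
Qed.

Lemma lipbZ K L a f : lipb K L f ->
  lipb (`|a| * K) (`|a| * L) (fun x y k => a * f x y k).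
Proof.
move=> fl; split=> [x y k|x y x' y' k]; first by rewrite normrM ler_wpM2l// fl.1.
by rewrite -mulrBr normrM -mulrA ler_wpM2l// fl.2.
Qed.

Lemma lipb_cst (a : R) : lipb `|a| 0 (fun _ _ _ => a).
Proof. by split=> *; rewrite ?lexx// subrr normr0 mul0r. Qed.

Lemma lipb_flow K L c h f : lipb K L f -> lipb K L (flow c h f).
Proof.
move=> [fK fL]; split=> [x y k|x y x' y' k]; first exact: fK.
apply: (le_trans (fL _ _ _ _ _)).
by rewrite opprD addrACA subrr addr0 opprD addrACA subrr addr0.
Qed.

Lemma lipb_turned K L s f : lipb K L f -> lipb K L (turned s f).
Proof. by move=> [fK fL]; split=> *; [exact: fK|exact: fL]. Qed.

Lemma lipb_flow_le K L c h f x y k : 0 <= c * h -> lipb K L f ->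
  `|flow c h f x y k - f x y k| <= 2 * L * (c * h).
Proof.
move=> ch0 fl; have L0 := lipb_L_ge0 fl; apply: (le_trans (fl.2 _ _ _ _ _)).
have -> : x + c * h * dirx k - x = c * h * dirx k by ring.
have -> : y + c * h * diry k - y = c * h * diry k by ring.
rewrite [`|_ * dirx k|]normrM [`|_ * diry k|]normrM (ger0_norm ch0) -mulrDr.
have -> : 2 * L * (c * h) = L * (c * h * (1 + 1)) by ring.
apply: ler_wpM2l => //; apply: ler_wpM2l => //.
by apply: lerD; [exact: dirx_le1|exact: diry_le1].
Qed.

End LipbTheory.

Section Step.
Context {R : realType} {d : measure_display} {T : measurableType d}.
Context (P : probability T R) (c : R) (lambda : R -> R).
Context (N : R -> T -> nat) (k0 : T -> 'Z_4) (turn : nat -> T -> bool).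
Context (X Y : R -> T -> R).
Hypothesis c_gt0 : 0 < c.
Hypothesis lambda_ge0 : forall t : R, 0 < t -> 0 <= lambda t.
Hypothesis motion : driven_motion P c lambda N k0 turn X Y.
Local Notation D := (direction N k0 turn).
Local Notation mean := (mean P N k0 turn X Y).

Lemma mean_le K L f t : 0 <= t -> lipb K L f -> `|mean f t| <= K.
Proof.
move=> t0 fl; have K0 := lipb_K_ge0 fl.
apply: (le_trans (le_normr_Rintegral _ _)) => //.
  exact: (integrable_state c_gt0 motion t0 fl measurableT).
rewrite -[leRHS](Rintegral_cst_prob P).
apply: le_Rintegral => //.
- exact/integrable_norm/(integrable_state c_gt0 motion t0 fl measurableT).
- exact: (@bounded_prob_integrable _ _ _ P _ _ `|K|).
- by move=> w _; exact: fl.1.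
Qed.

Lemma meanD K L K' L' f g t : 0 <= t -> lipb K L f -> lipb K' L' g ->
  mean (fun x y k => f x y k + g x y k) t = mean f t + mean g t.
Proof.
move=> t0 fl gl; rewrite /mean RintegralD//.
  exact: (integrable_state c_gt0 motion t0 fl measurableT).
exact: (integrable_state c_gt0 motion t0 gl measurableT).
Qed.

Lemma meanZ K L f a t : 0 <= t -> lipb K L f ->
  mean (fun x y k => a * f x y k) t = a * mean f t.
Proof.
by move=> t0 fl; rewrite /mean RintegralZl//; exact: (integrable_state c_gt0 motion t0 fl measurableT).
Qed.

Lemma mean_monotone K L K' L' f g t : 0 <= t -> lipb K L f -> lipb K' L' g ->
  (forall w, f (X t w) (Y t w) (D t w) <= g (X t w) (Y t w) (D t w)) ->
  mean f t <= mean g t.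
Proof.
move=> t0 fl gl fg; apply: le_Rintegral => //.
  exact: (integrable_state c_gt0 motion t0 fl measurableT).
exact: (integrable_state c_gt0 motion t0 gl measurableT).
Qed.

Lemma mean_dist K L K' L' f g e t : 0 <= t -> lipb K L f -> lipb K' L' g ->
  (forall x y k, `|f x y k - g x y k| <= e) -> `|mean f t - mean g t| <= e.
Proof.
move=> t0 fl gl fg.
have fi := integrable_state c_gt0 motion t0 fl measurableT.
have gi := integrable_state c_gt0 motion t0 gl measurableT.
rewrite -RintegralB//.
apply: (le_trans (le_normr_Rintegral _ _)) => //.
  have := integrableB measurableT fi gi; exact.
rewrite -[leRHS](Rintegral_cst_prob P).
apply: le_Rintegral => //.
- apply: integrable_norm; have := integrableB measurableT fi gi; exact.
- exact: (@bounded_prob_integrable _ _ _ P _ _ `|e|).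
Qed.

Lemma position_lip t h w : 0 <= t -> 0 <= h ->
  `|X (t + h) w - X t w| <= c * h /\ `|Y (t + h) w - Y t w| <= c * h.
Proof.
move=> t0 h0; have tth : t <= t + h by rewrite lerDl.
have th0 := addr_ge0 t0 h0.
rewrite !(XE motion)// !(YE motion)// -!mulrBr !normrM gtr0_norm// !ler_pM2l//.
have hE : h = t + h - t by rewrite addrC addKr.
by split; rewrite [leRHS]hE; [exact: (path_lip motion w dirx_le1)|
  exact: (path_lip motion w diry_le1)].
Qed.

Lemma no_switch t h w : 0 <= t -> 0 <= h -> N (t + h) w = N t w ->
  [/\ X (t + h) w = X t w + c * h * dirx (D t w),
      Y (t + h) w = Y t w + c * h * diry (D t w) & D (t + h) w = D t w].
Proof.
move=> t0 h0 NE; have tth : t <= t + h by rewrite lerDl.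
have th0 := addr_ge0 t0 h0.
have DE u : t < u -> u <= t + h -> D u w = D t w.
  move=> /ltW tu uth; rewrite /direction; congr (_ + _).
  have -> // : N u w = N t w.
  apply/eqP; rewrite eqn_leq; apply/andP; split.
    by rewrite -NE (N_ndecr motion)// (le_trans t0).
  exact: (N_ndecr motion).
split; last by rewrite /direction NE.
  rewrite -[LHS](subrK (X t w)) addrC; congr (_ + _).
  rewrite !(XE motion)// -mulrBr.
  rewrite (@path_const _ _ _ _ _ _ _ _ _ _ _ motion dirx w dirx_le1 _ _ (dirx (D t w)))//.
    by rewrite (addrC t) addrK mulrA mulrAC.
  by move=> u tu ut; rewrite DE.
rewrite -[LHS](subrK (Y t w)) addrC; congr (_ + _).
rewrite !(YE motion)// -mulrBr.
rewrite (@path_const _ _ _ _ _ _ _ _ _ _ _ motion diry w diry_le1 _ _ (diry (D t w)))//.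
  by rewrite (addrC t) addrK mulrA mulrAC.
by move=> u tu ut; rewrite DE.
Qed.

Lemma one_switch t h w b : 0 <= t -> 0 <= h ->
  jump_turn N turn t (t + h) 1 b w ->
  D (t + h) w = D t w + (if b then 1 else -1).
Proof.
move=> t0 h0 [N1 tb]; have tth : t <= t + h by rewrite lerDl.
have -> : D (t + h) w = k0 w + \sum_(i < (N t w).+1) (if turn i w then 1 else -1).
  have -> // : (N t w).+1 = N (t + h) w.
  by have := N_ndecr motion w t0 tth; lia.
by rewrite big_ord_recr/= tb addrA.
Qed.

Lemma cumulative_rate_ge0 s t : 0 <= s -> 0 <= cumulative_rate lambda s t.
Proof.
move=> s0; apply: Rintegral_ge0 => u /=; rewrite in_itv/= => /andP[su _].
by rewrite lambda_ge0// (le_lt_trans s0).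
Qed.

Lemma fine_P_jump_turn t h m b (Lam := cumulative_rate lambda t (t + h)) :
  0 <= t -> 0 <= h ->
  fine (P (jump_turn N turn t (t + h) m b)) = expR (- Lam) * Lam ^+ m / m`!%:R / 2.
Proof.
move=> t0 h0.
have l1 : lipb 1 0 (fun (_ _ : R) (_ : 'Z_4) => 1 : R).
  by split=> *; rewrite ?normr1// subrr normr0 mul0r.
have := mean_jump_turn c_gt0 motion t0 h0 l1 m b.
rewrite Rintegral_cst; last first.
  exact: (measurable_jump_turn motion m b t0 (addr_ge0 t0 h0)).
by rewrite mul1r => ->; rewrite /mean Rintegral_cst_prob mulr1.
Qed.

(** One step of the motion: up to second order terms, either nothing happens
but transport, or exactly one switch, at a rate that is split evenly between
the two neighbouring directions. *)
Lemma mean_step K L f t h (Lam := cumulative_rate lambda t (t + h)) :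
  lipb K L f -> 0 <= t -> 0 <= h ->
  `|mean f (t + h) - mean (flow c h f) t
    - Lam * ((mean (turned 1 f) t + mean (turned (-1) f) t) / 2 - mean f t)|
  <= 3 * K * Lam ^+ 2 + 4 * L * (c * h) * Lam.
Proof.
move=> fl t0 h0; have th0 := addr_ge0 t0 h0.
have K0 := lipb_K_ge0 fl; have L0 := lipb_L_ge0 fl.
have ch0 : 0 <= c * h by rewrite mulr_ge0// ltW.
pose J m b := jump_turn N turn t (t + h) m b.
have mJ m b : measurable (J m b) by exact: (measurable_jump_turn motion).
pose B := ~` (J 0%N true `|` J 0%N false `|` (J 1%N true `|` J 1%N false)).
have mB : measurable B.
  by apply: measurableC; apply: measurableU; apply: measurableU; exact: mJ.
pose F w := f (X (t + h) w) (Y (t + h) w) (D (t + h) w).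
have iF A : measurable A -> P.-integrable A (EFin \o F).
  by move=> mA; exact: (integrable_state c_gt0 motion th0 fl).
have JJ m b m' b' : (m, b) != (m', b') -> [disjoint J m b & J m' b'].
  move=> mb; apply/disj_setPS => w [[hm hb] [hm' hb']]; move: mb.
  by rewrite -hm -hb -hm' -hb' eqxx.
have split_int (G : T -> R) : (forall A, measurable A -> P.-integrable A (EFin \o G)) ->
    \int[P]_w G w = (\int[P]_(w in J 0%N true) G w + \int[P]_(w in J 0%N false) G w)
      + (\int[P]_(w in J 1%N true) G w + \int[P]_(w in J 1%N false) G w)
      + \int[P]_(w in B) G w.
  move=> iG; rewrite -[X in Rintegral _ X _ = _](setUv
    (J 0%N true `|` J 0%N false `|` (J 1%N true `|` J 1%N false))).
  have mU1 := measurableU _ _ (mJ 0%N true) (mJ 0%N false).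
  have mU2 := measurableU _ _ (mJ 1%N true) (mJ 1%N false).
  have mU := measurableU _ _ mU1 mU2.
  rewrite Rintegral_setU//; last 2 first.
  - by apply: iG; rewrite setUv.
  - by apply/disj_setPS => w [].
  rewrite Rintegral_setU//; last 2 first.
  - exact: iG.
  - apply/disj_setPS => w [[]] [h1 _] [] [h2 _]; by rewrite h1 in h2.
  rewrite Rintegral_setU//; last 2 first.
  - exact: iG.
  - exact: JJ.
  rewrite Rintegral_setU//; last 2 first.
  - exact: iG.
  - exact: JJ.
set e := expR (- Lam).
have Lam0 : 0 <= Lam by exact: cumulative_rate_ge0.
have e_ge : 1 - Lam <= e by exact: expR_ge1Dx.
have e_le : e * (1 + Lam) <= 1.
  have := expR_ge1Dx Lam; rewrite -(ler_pM2l (expR_gt0 (- Lam))) -expRD.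
  by rewrite addNr expR0.
have e0 : 0 <= e by exact: expR_ge0.
have PJ0 b : fine (P (J 0%N b)) = e / 2.
  by rewrite fine_P_jump_turn// fact0 expr0 divr1 mulr1.
have PJ1 b : fine (P (J 1%N b)) = e * Lam / 2.
  by rewrite fine_P_jump_turn// expr1 divr1.
have PB : fine (P B) = 1 - e - e * Lam.
  have : forall A, measurable A -> P.-integrable A (EFin \o cst (1 : R)).
    by move=> A mA; apply: (@bounded_prob_integrable _ _ _ P _ _ 1) => // w /=;
      rewrite normr1.
  move=> /split_int.
  rewrite Rintegral_cst_prob !Rintegral_cst// !mul1r !PJ0 !PJ1 => E.
  lra.
have I0 b : \int[P]_(w in J 0%N b) F w = e / 2 * mean (flow c h f) t.
  rewrite -(PJ0 b) fine_P_jump_turn//.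
  rewrite -(mean_jump_turn c_gt0 motion t0 h0 (lipb_flow c h fl) 0 b).
  apply: eq_Rintegral => w; rewrite inE => -[NE _].
  have [|hX hY hD] := @no_switch t h w t0 h0.
    apply/eqP; rewrite eqn_leq -subn_eq0 NE eqxx /=.
    by apply: (N_ndecr motion) => //; rewrite lerDl.
  by rewrite /F hX hY hD.
have I1 b : `|\int[P]_(w in J 1%N b) F w -
    e * Lam / 2 * mean (turned (if b then 1 else -1) f) t|
    <= 2 * L * (c * h) * (e * Lam / 2).
  rewrite -(PJ1 b) fine_P_jump_turn//.
  rewrite -(mean_jump_turn c_gt0 motion t0 h0 (lipb_turned (if b then 1 else -1) fl) 1 b).
  have it := integrable_state c_gt0 motion t0 (lipb_turned (if b then 1 else -1) fl) (mJ 1%N b).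
  rewrite -RintegralB//; last exact: iF.
  apply: (le_trans (le_normr_Rintegral _ _)) => //.
    have := integrableB (mJ 1%N b) (iF _ (mJ 1%N b)) it; exact.
  rewrite -(@fine_P_jump_turn t h 1 b t0 h0) -Rintegral_cst//.
  apply: le_Rintegral => //.
  - apply: integrable_norm; have := integrableB (mJ 1%N b) (iF _ (mJ 1%N b)) it; exact.
  - apply: (@bounded_prob_integrable _ _ _ P _ _ `|2 * L * (c * h)|) => //.
  - move=> w Jw; rewrite /F (one_switch t0 h0 Jw) /turned.
    apply: (le_trans (fl.2 _ _ _ _ _)).
    have [hX hY] := position_lip w t0 h0.
    rewrite -mulrA mulrCA ler_wpM2l//.
    by rewrite [leRHS]mulr_natl mulr2n lerD.
have IB : `|\int[P]_(w in B) F w| <= K * (1 - e - e * Lam).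
  apply: (le_trans (le_normr_Rintegral _ _)) => //; first exact: iF.
  rewrite -PB -Rintegral_cst//; apply: le_Rintegral => //.
  - exact/integrable_norm/iF.
  - exact: (@bounded_prob_integrable _ _ _ P _ _ `|K|).
  - by move=> w _; exact: fl.1.
rewrite [X in `|X - _ - _|]split_int// !I0.
have := I1 true; have := I1 false.
have := mean_le t0 fl.
have := mean_le t0 (lipb_flow c h fl).
have := mean_le t0 (lipb_turned 1 fl).
have := mean_le t0 (lipb_turned (-1) fl).
have : `|mean (flow c h f) t - mean f t| <= 2 * L * (c * h).
  by apply: (mean_dist t0 (lipb_flow c h fl) fl) => x y k; apply: lipb_flow_le => //; exact: fl.
move: IB.
set a := mean (flow c h f) t; set m0 := mean f t.
set u := mean (turned 1 f) t; set v := mean (turned (-1) f) t.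
set i1 := Rintegral _ (J 1%N true) _; set i2 := Rintegral _ (J 1%N false) _.
set i3 := Rintegral _ B _.
move=> b3 d1 bv bu ba bm b2 b1.
have e_ub : e - 1 + Lam <= Lam ^+ 2 by nra.
have r1 : `|(e - 1 + Lam) * a| <= Lam ^+ 2 * K.
  by rewrite normrM ler_pM// ger0_norm// -addrA -lerBlDr; lra.
have r2 : `|Lam * (a - m0)| <= Lam * (2 * L * (c * h)).
  by rewrite normrM ger0_norm// ler_wpM2l.
have r3 : `|(e * Lam - Lam) * ((u + v) / 2)| <= Lam ^+ 2 * K.
  rewrite normrM ler_pM//.
    by rewrite ler0_norm; nra.
  by move: bu bv; rewrite !ler_norml => /andP[? ?] /andP[? ?]; lra.
have elam : e * Lam <= Lam by nra.
have r4 : K * (1 - e - e * Lam) <= K * Lam ^+ 2 by apply: ler_wpM2l => //; nra.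
have r5 : 2 * L * (c * h) * (e * Lam / 2) <= 2 * L * (c * h) * (Lam / 2).
  by apply: ler_wpM2l; [apply: mulr_ge0 => //; apply: mulr_ge0|lra].
move: r1 r2 r3 b1 b2 b3; rewrite !ler_norml => /andP[? ?] /andP[? ?] /andP[? ?].
by move=> /andP[? ?] /andP[? ?] /andP[? ?]; lra.
Qed.
End Step.

(** * The forward equation *)

(** Steps ending at [t] are handled apart from steps starting at [t], because the
estimates on the motion only look forward in time. *)
Lemma is_derive_increments {R : realType} (F : R -> R) (t G : R) :
  (forall e : R, 0 < e -> exists2 del : R, 0 < del & forall h : R, 0 < h -> h < del ->
    `|F (t + h) - F t - h * G| <= e * h /\
    `|F t - F (t - h) - h * G| <= e * h) ->
  is_derive t 1 F G.
Proof.
move=> FG.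
suff cF : h^-1 *: (F (h *: 1 + t) - F t) @[h --> 0^'] --> G.
  by apply: DeriveDef; [apply/cvg_ex; exists G|apply/cvg_lim].
apply/cvgrPdist_le => e e0; have [del del0 H] := FG e e0.
exists del => // h /=; rewrite sub0r normrN => hdel h0.
rewrite scaler1 -[_ *: _]/(_ * _).
have -> : G - h^-1 * (F (h + t) - F t) = - (h^-1 * (F (h + t) - F t - h * G)).
  by field.
rewrite normrN normrM normfV ler_pdivrMl ?normr_gt0// [leRHS]mulrC.
have [h_lt0|h_gt0|h00] := ltgtP h 0; last by rewrite h00 eqxx in h0.
- have h'0 : 0 < - h by rewrite oppr_gt0.
  have h'del : - h < del by rewrite -ltr0_norm.
  have [_] := H _ h'0 h'del; rewrite opprK (ltr0_norm h_lt0) => Hh.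
  rewrite -normrN [X in `|X|](_ : _ = F t - F (t + h) - - h * G)//.
  by rewrite (addrC h t); ring.
- rewrite (gtr0_norm h_gt0) in hdel *.
  by have [+ _] := H _ h_gt0 hdel; rewrite (addrC t).
Qed.

Section Generator.
Context {R : realType} {d : measure_display} {T : measurableType d}.
Context (P : probability T R) (c : R) (lambda : R -> R).
Context (N : R -> T -> nat) (k0 : T -> 'Z_4) (turn : nat -> T -> bool).
Context (X Y : R -> T -> R).
Hypothesis c_gt0 : 0 < c.
Hypothesis lambda_ge0 : forall t : R, 0 < t -> 0 <= lambda t.
Hypothesis motion : driven_motion P c lambda N k0 turn X Y.
Local Notation D := (direction N k0 turn).
Local Notation mean := (mean P N k0 turn X Y).
Local Notation mu := (@lebesgue_measure R).

Lemma integrable_rate (s t : R) : 0 <= s -> 0 <= t ->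
  mu.-integrable `]s, t] (EFin \o lambda).
Proof.
move=> s0 t0; have [+ _ _ _ _] := poissonN motion => /(_ t t0).
apply: integrableS => //.
by apply: subset_itvr; rewrite bnd_simp.
Qed.

Lemma cumulative_rate_le (s t M : R) : 0 <= s -> s <= t ->
  (forall u, s < u -> u <= t -> lambda u <= M) ->
  cumulative_rate lambda s t <= M * (t - s).
Proof.
move=> s0 st lM; rewrite -(fine_lebesgue_measure_oc st) -Rintegral_cst//.
apply: le_Rintegral => //.
- by apply: integrable_rate => //; exact: le_trans st.
- apply: measurable_bounded_integrable => //.
  + exact: lebesgue_measure_itv_lty.
  + by exists `|M|; split=> // K MK u _ /=; exact: ltW.
- by move=> u; rewrite /= in_itv/= => /andP[]; exact: lM.
Qed.

Lemma cumulative_rate_ge (s t M : R) : 0 <= s -> s <= t ->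
  (forall u, s < u -> u <= t -> M <= lambda u) ->
  M * (t - s) <= cumulative_rate lambda s t.
Proof.
move=> s0 st lM; rewrite -(fine_lebesgue_measure_oc st) -Rintegral_cst//.
apply: le_Rintegral => //.
- apply: measurable_bounded_integrable => //.
  + exact: lebesgue_measure_itv_lty.
  + by exists `|M|; split=> // K MK u _ /=; exact: ltW.
- by apply: integrable_rate => //; exact: le_trans st.
- by move=> u; rewrite /= in_itv/= => /andP[]; exact: lM.
Qed.

Lemma cumulative_rate_near (t e : R) : 0 < t -> {for t, continuous lambda} ->
  0 < e -> exists2 del, 0 < del & forall s s', t - del < s -> s <= s' ->
    s' < t + del ->
    0 < s /\ `|cumulative_rate lambda s s' - lambda t * (s' - s)| <= e * (s' - s).
Proof.
move=> t0 cl e0.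
have [del /= del0 Hdel] : exists2 del, 0 < del &
    forall u, `|t - u| < del -> `|lambda t - lambda u| <= e.
  move/cvgrPdist_le : cl => /(_ e e0)[del /= del0 H].
  by exists del => // u; exact: H.
exists (Num.min del t); first by rewrite lt_min del0.
move=> s s' ts ss' s't.
have s0 : 0 < s.
  by apply: le_lt_trans ts; rewrite subr_ge0 ge_min lexx orbT.
have lu u : s < u -> u <= s' -> `|lambda t - lambda u| <= e.
  move=> su us'; apply: Hdel; rewrite ltr_norml.
  move: ts s't; have : Num.min del t <= del by rewrite ge_min lexx.
  by move=> ? ? ?; apply/andP; split; lra.
split=> //; rewrite ler_norml.
have := @cumulative_rate_le s s' (lambda t + e) (ltW s0) ss'.
have := @cumulative_rate_ge s s' (lambda t - e) (ltW s0) ss'.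
move=> h1 h2; apply/andP; split.
  rewrite lerBrDr -mulNr -mulrDl addrC; apply: h1 => u su us.
  by have := lu u su us; rewrite ler_norml => /andP[]; lra.
rewrite lerBlDr -mulrDl addrC; apply: h2 => u su us.
by have := lu u su us; rewrite ler_norml => /andP[]; lra.
Qed.

Lemma mean_time_lip K L f s h (Lam := cumulative_rate lambda s (s + h)) :
  lipb K L f -> 0 <= s -> 0 <= h ->
  `|mean f (s + h) - mean f s|
    <= 2 * L * (c * h) + 2 * K * Lam + 3 * K * Lam ^+ 2 + 4 * L * (c * h) * Lam.
Proof.
move=> fl s0 h0; have ch0 : 0 <= c * h by rewrite mulr_ge0// ltW.
have := mean_step c_gt0 lambda_ge0 motion fl s0 h0; rewrite -/Lam.
have : `|mean (flow c h f) s - mean f s| <= 2 * L * (c * h).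
  apply: (mean_dist c_gt0 motion s0 (lipb_flow c h fl) fl) => x y k.
  by apply: lipb_flow_le => //; exact: fl.
have Lam0 : 0 <= Lam by exact: cumulative_rate_ge0.
have : `|Lam * ((mean (turned 1 f) s + mean (turned (-1) f) s) / 2 - mean f s)|
    <= Lam * (2 * K).
  rewrite normrM ger0_norm// ler_wpM2l//.
  have := mean_le c_gt0 motion s0 fl.
  have := mean_le c_gt0 motion s0 (lipb_turned 1 fl).
  have := mean_le c_gt0 motion s0 (lipb_turned (-1) fl).
  rewrite !ler_norml => /andP[? ?] /andP[? ?] /andP[? ?]; lra.
rewrite !ler_norml => /andP[? ?] /andP[? ?] /andP[? ?]; lra.
Qed.

(** Kolmogorov's forward equation, tested on functions [f] that are regular
enough for the transport part [g] of the generator to be meaningful. *)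
Lemma mean_derive t f g K L K' L' B :
  0 < t -> {for t, continuous lambda} -> lipb K L f -> lipb K' L' g ->
  (forall h x y k, 0 <= h ->
    `|flow c h f x y k - f x y k - h * g x y k| <= B * h ^+ 2) ->
  is_derive t 1 (mean f) (mean g t + lambda t *
    ((mean (turned 1 f) t + mean (turned (-1) f) t) / 2 - mean f t)).
Proof.
move=> t0 cl fl gl fg.
have K0 := lipb_K_ge0 fl; have L0 := lipb_L_ge0 fl.
have K'0 := lipb_K_ge0 gl; have L'0 := lipb_L_ge0 gl.
have B0 : 0 <= B.
  have := fg 1 0 0 0 ler01; rewrite expr1n mulr1; exact: le_trans.
have fl1 := lipb_turned 1 fl; have flm := lipb_turned (-1) fl.
pose J s := (mean (turned 1 f) s + mean (turned (-1) f) s) / 2 - mean f s.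
pose M := lambda t + 1.
have M1 : 1 <= M by rewrite lerDr lambda_ge0.
(* Lipschitz constants in time of a bounded Lipschitz mean, for steps h <= 1 *)
pose V k l := 2 * l * c + 2 * k * M + 3 * k * M ^+ 2 + 4 * l * c * M.
pose C := 3 * K * M ^+ 2 + 4 * L * c * M + B + V K' L' + M * (2 * V K L).
have c0 := ltW c_gt0.
have V0 k l : 0 <= k -> 0 <= l -> 0 <= V k l.
  move=> k_ge0 l_ge0; have M_ge0 : 0 <= M by exact: le_trans M1.
  by rewrite /V !addr_ge0// !mulr_ge0// exprn_ge0.
have C0 : 0 <= C.
  have M_ge0 : 0 <= M by exact: le_trans M1.
  by rewrite /C !addr_ge0// ?V0// !mulr_ge0// ?V0// exprn_ge0.
have second0 k l : 0 <= k -> 0 <= l -> 0 <= 3 * k * M ^+ 2 + 4 * l * c * M.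
  move=> k_ge0 l_ge0; have M_ge0 : 0 <= M by exact: le_trans M1.
  by rewrite addr_ge0// !mulr_ge0// exprn_ge0.
have second k l Lam h : 0 <= k -> 0 <= l -> 0 <= h -> 0 <= Lam -> Lam <= M * h ->
    3 * k * Lam ^+ 2 + 4 * l * (c * h) * Lam <=
    (3 * k * M ^+ 2 + 4 * l * c * M) * h ^+ 2.
  move=> k_ge0 l_ge0 h_ge0 Lam_ge0 LamM.
  have s1 : 3 * k * Lam ^+ 2 <= 3 * k * (M * h) ^+ 2.
    by apply: ler_wpM2l; [exact: mulr_ge0|rewrite lerXn2r ?nnegrE// mulr_ge0//; exact: le_trans M1].
  have s2 : 4 * l * (c * h) * Lam <= 4 * l * (c * h) * (M * h).
    by apply: ler_wpM2l => //; rewrite !mulr_ge0.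
  by lra.
(* one estimate for the steps on both sides of t: q is either end of the step *)
have increment s h r : 0 <= s -> 0 <= h -> h <= 1 -> r <= 1 ->
    `|cumulative_rate lambda s (s + h) - lambda t * h| <= r * h ->
    forall q, q = s \/ q = s + h ->
    `|mean f (s + h) - mean f s - h * (mean g q + lambda t * J q)|
      <= C * h ^+ 2 + 2 * K * r * h.
  move=> s0 h0 h1 r1; set Lam := cumulative_rate _ _ _ => Lr q qs.
  have Lam0 : 0 <= Lam by exact: cumulative_rate_ge0.
  have LamM : Lam <= M * h.
    have : r * h <= h by rewrite ler_piMl.
    by move: Lr; rewrite ler_norml /M => /andP[_]; lra.
  have tlip k l F : lipb k l F -> `|mean F q - mean F s| <= V k l * h.
    move=> Fl; have k0' := lipb_K_ge0 Fl; have l0' := lipb_L_ge0 Fl.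
    case: qs => ->; first by rewrite subrr normr0 mulr_ge0// V0.
    apply: (le_trans (mean_time_lip Fl s0 h0)); rewrite -/Lam /V.
    have h2 : h ^+ 2 <= h by rewrite expr2 ler_piMr.
    have p1 := second k l Lam h k0' l0' h0 Lam0 LamM.
    have p2 : (3 * k * M ^+ 2 + 4 * l * c * M) * h ^+ 2 <=
        (3 * k * M ^+ 2 + 4 * l * c * M) * h by rewrite ler_wpM2l// second0.
    have p3 : 2 * k * Lam <= 2 * k * (M * h) by rewrite ler_wpM2l// mulr_ge0.
    by lra.
  have dg := tlip _ _ _ gl.
  have dJ : `|J q - J s| <= 2 * V K L * h.
    have := tlip _ _ _ fl; have := tlip _ _ _ fl1; have := tlip _ _ _ flm.
    rewrite /J !ler_norml => /andP[? ?] /andP[? ?] /andP[? ?]; lra.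
  have JK : `|J q| <= 2 * K.
    have q0 : 0 <= q by case: qs => ->//; exact: addr_ge0.
    have := mean_le c_gt0 motion q0 fl.
    have := mean_le c_gt0 motion q0 fl1.
    have := mean_le c_gt0 motion q0 flm.
    rewrite /J !ler_norml => /andP[? ?] /andP[? ?] /andP[? ?]; lra.
  have step := mean_step c_gt0 lambda_ge0 motion fl s0 h0.
  rewrite -/Lam -/(J s) in step.
  have tr : `|mean (flow c h f) s - mean f s - h * mean g s| <= B * h ^+ 2.
    have hgl := lipbZ h gl.
    rewrite -(meanZ c_gt0 motion h s0 gl) -addrA -opprD.
    rewrite -(meanD c_gt0 motion s0 fl hgl).
    apply: (mean_dist c_gt0 motion s0 (lipb_flow c h fl) (lipbD fl hgl)) => x y k.
    by rewrite opprD addrA; exact: fg.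
  have e1 : `|h * (mean g q - mean g s)| <= V K' L' * h ^+ 2.
    by rewrite normrM ger0_norm// expr2 mulrCA ler_wpM2l.
  have e2 : `|Lam * (J q - J s)| <= M * (2 * V K L) * h ^+ 2.
    rewrite normrM (ger0_norm Lam0).
    have -> : M * (2 * V K L) * h ^+ 2 = (M * h) * (2 * V K L * h) by ring.
    exact: ler_pM.
  have e3 : `|(Lam - lambda t * h) * J q| <= r * h * (2 * K).
    by rewrite normrM ler_pM.
  have e4 : 3 * K * Lam ^+ 2 + 4 * L * (c * h) * Lam <=
      (3 * K * M ^+ 2 + 4 * L * c * M) * h ^+ 2.
    exact: second.
  move: step tr e1 e2 e3; rewrite /C !ler_norml.
  move=> /andP[? ?] /andP[? ?] /andP[? ?] /andP[? ?] /andP[? ?]; lra.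
apply: is_derive_increments => e e0.
pose r := Num.min 1 (e / (4 * K + 1)).
have K1 : 0 < 4 * K + 1 by rewrite ltr_wpDl// mulr_ge0.
have r0 : 0 < r by rewrite lt_min ltr01 divr_gt0.
have re : 2 * K * r <= e / 2.
  have : r <= e / (4 * K + 1) by rewrite ge_min lexx orbT.
  rewrite ler_pdivlMr// => re; rewrite ler_pdivlMr//.
  by apply: le_trans re; nra.
have [del del0 Hdel] := cumulative_rate_near t0 cl r0.
have C1 : 0 < 2 * C + 1 by rewrite ltr_wpDl// mulr_ge0.
exists (Num.min del (Num.min 1 (e / (2 * C + 1)))).
  by rewrite !lt_min del0 ltr01 divr_gt0.
move=> h h0; rewrite !lt_min => /and3P[hdel h1].
rewrite ltr_pdivlMr// => hC.
have h0' := ltW h0.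
have bound : C * h ^+ 2 + 2 * K * r * h <= e * h.
  have Ch : C * h <= e / 2 by nra.
  have -> : C * h ^+ 2 + 2 * K * r * h = (C * h + 2 * K * r) * h by ring.
  by rewrite ler_wpM2r//; lra.
have r1 : r <= 1 by rewrite ge_min lexx.
split.
  have [||| _] := Hdel t (t + h); rewrite ?lerDl ?ltrD2l ?ltrBlDr ?ltrDl//.
  rewrite (addrC t h) addrK (addrC h t) => /(increment _ _ _ (ltW t0) h0' (ltW h1) r1).
  by move=> /(_ t (or_introl erefl))/le_trans; apply.
have tE : t = t - h + h by rewrite subrK.
have [||| s0] := Hdel (t - h) t; rewrite ?gerBl ?ltrD2l ?ltrN2 ?ltrDl//.
rewrite opprB addrCA subrr addr0 => Hr.
have := increment (t - h) h r (ltW s0) h0' (ltW h1) r1.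
rewrite subrK => /(_ Hr t (or_intror erefl))/le_trans; apply.
exact: bound.
Qed.

End Generator.

(** * Velocities along the diagonals *)

Section Directions.
Context {R : realType}.

Definition sgn (b : bool) : R := if b then 1 else -1.

(** The signs of the velocities of [x + y] and of [x - y]. *)
Definition signu (k : 'Z_4) : bool := (k < 2)%N.
Definition signv (k : 'Z_4) : bool := (k == 0%N :> nat) || (k == 3%N :> nat).

Lemma Z4_ind (Q : 'Z_4 -> Prop) : Q 0 -> Q 1 -> Q 2%:R -> Q 3%:R -> forall k, Q k.
Proof.
move=> Q0 Q1 Q2 Q3 [[|[|[|[|//]]]] i].
- by rewrite (_ : Ordinal i = 0)//; exact: val_inj.
- by rewrite (_ : Ordinal i = 1)//; exact: val_inj.
- by rewrite (_ : Ordinal i = 2%:R)//; exact: val_inj.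
- by rewrite (_ : Ordinal i = 3%:R)//; exact: val_inj.
Qed.

Lemma dirx_values : [/\ dirx 0 = 1 :> R, dirx 1 = 0 :> R,
  dirx 2%:R = -1 :> R & dirx 3%:R = 0 :> R].
Proof.
rewrite /dirx; split.
- by rewrite mul0r mul0r cos0.
- by rewrite mul1r cos_pihalf.
- by rewrite (_ : nat_of_ord (2%:R : 'Z_4) = 2%N)// mulrAC divff// mul1r cospi.
- rewrite (_ : nat_of_ord (3%:R : 'Z_4) = 3%N)// (_ : _ / 2 = pi + pi / 2); last by field.
  by rewrite cosDpihalf sinpi oppr0.
Qed.

Lemma diry_values : [/\ diry 0 = 0 :> R, diry 1 = 1 :> R,
  diry 2%:R = 0 :> R & diry 3%:R = -1 :> R].
Proof.
rewrite /diry; split.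
- by rewrite mul0r mul0r sin0.
- by rewrite mul1r sin_pihalf.
- by rewrite (_ : nat_of_ord (2%:R : 'Z_4) = 2%N)// mulrAC divff// mul1r sinpi.
- rewrite (_ : nat_of_ord (3%:R : 'Z_4) = 3%N)// (_ : _ / 2 = pi + pi / 2); last by field.
  by rewrite sinDpihalf cospi.
Qed.

Lemma dir_u k : dirx k + diry k = sgn (signu k).
Proof.
have [x0 x1 x2 x3] := dirx_values; have [y0 y1 y2 y3] := diry_values.
by elim/Z4_ind: k; rewrite ?(x0, x1, x2, x3, y0, y1, y2, y3) ?addr0 ?add0r.
Qed.

Lemma dir_v k : dirx k - diry k = sgn (signv k).
Proof.
have [x0 x1 x2 x3] := dirx_values; have [y0 y1 y2 y3] := diry_values.
by elim/Z4_ind: k; rewrite ?(x0, x1, x2, x3, y0, y1, y2, y3) ?subr0 ?sub0r ?opprK.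
Qed.

(** A switch reverses exactly one of the two velocities, and the two possible
outcomes of the switch reverse different ones. *)
Lemma switch_signs (F : bool -> bool -> R) k :
  F (signu (k + 1)) (signv (k + 1)) + F (signu (k + -1)) (signv (k + -1)) =
  F (~~ signu k) (signv k) + F (signu k) (~~ signv k).
Proof.
have : (signu (k + 1), signv (k + 1), signu (k + -1), signv (k + -1)) =
    if signu k == signv k then (signu k, ~~ signv k, ~~ signu k, signv k)
    else (~~ signu k, signv k, signu k, ~~ signv k).
  by elim/Z4_ind: k; vm_compute.
by case: ifP => _ [-> -> -> ->]; rewrite // addrC.
Qed.

End Directions.

(** * The tent function and its primitive *)

(** A tent of half-width [2 del] and height two, written with positive parts so
that its primitive is explicit. *)
Definition tent {R : realType} (del x : R) : R :=
  (Num.max 0 (x + 2 * del) - 2 * Num.max 0 x + Num.max 0 (x - 2 * del)) / del.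

(** The primitive of the tent that vanishes at minus infinity. *)
Definition tent_int {R : realType} (del x : R) : R :=
  (Num.max 0 (x + 2 * del) ^+ 2 - 2 * Num.max 0 x ^+ 2
    + Num.max 0 (x - 2 * del) ^+ 2) / (2 * del).

Lemma max0_lip {R : realType} (x y : R) : `|Num.max 0 x - Num.max 0 y| <= `|x - y|.
Proof.
by case: (lerP 0 x); case: (lerP 0 y) => *; rewrite ?subrr ?normr0//;
  rewrite ler_norml; have := ler_norm (x - y); have := ler_norm (y - x);
  rewrite distrC => *; apply/andP; split; lra.
Qed.

Lemma max0_sqr_taylor {R : realType} (x h : R) :
  `|Num.max 0 (x + h) ^+ 2 - Num.max 0 x ^+ 2 - 2 * h * Num.max 0 x| <= h ^+ 2.
Proof.
rewrite ler_norml.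
by case: (lerP 0 x); case: (lerP 0 (x + h)) => *; apply/andP; split; nra.
Qed.

Section Tent.
Context {R : realType}.
Variable del : R.
Hypothesis del0 : 0 < del.

Lemma tent_bounds x : 0 <= tent del x <= 2.
Proof.
have d0 := del0.
rewrite /tent ler_pdivlMr// mul0r ler_pdivrMr//.
by case: (lerP 0 (x + 2 * del)); case: (lerP 0 x); case: (lerP 0 (x - 2 * del));
  move=> *; apply/andP; split; lra.
Qed.

Lemma tent_ge1 x : `|x| <= del -> 1 <= tent del x.
Proof.
have d0 := del0.
rewrite ler_norml => /andP[? ?]; rewrite /tent ler_pdivlMr// mul1r.
case: (lerP 0 (x + 2 * del)); case: (lerP 0 x); case: (lerP 0 (x - 2 * del)) => *; lra.
Qed.

Lemma tent_eq0 x : 2 * del <= `|x| -> tent del x = 0.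
Proof.
have d0 := del0.
move=> h; rewrite /tent; apply/eqP; rewrite mulf_eq0; apply/orP; left; apply/eqP.
move: h; case: (lerP 0 x) => x0; [rewrite ger0_norm//|rewrite ltr0_norm//];
case: (lerP 0 (x + 2 * del)); case: (lerP 0 (x - 2 * del)) => *; lra.
Qed.

Lemma tent_lip x y : `|tent del x - tent del y| <= 4 / del * `|x - y|.
Proof.
have d0 := del0.
rewrite /tent -mulrBl normrM normfV (gtr0_norm del0) ler_pdivrMr//.
rewrite mulrAC divfK ?gt_eqF//.
have := max0_lip (x + 2 * del) (y + 2 * del).
have := max0_lip x y; have := max0_lip (x - 2 * del) (y - 2 * del).
have -> : x - 2 * del - (y - 2 * del) = x - y by ring.
have -> : x + 2 * del - (y + 2 * del) = x - y by ring.
by rewrite !ler_norml => /andP[? ?] /andP[? ?] /andP[? ?]; apply/andP; split; lra.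
Qed.

Lemma tent_int_bounds x : 0 <= tent_int del x <= 4 * del.
Proof.
have d0 := del0.
have d2 : 0 < 2 * del by lra.
by rewrite /tent_int ler_pdivlMr// mul0r ler_pdivrMr//;
  case: (lerP 0 (x + 2 * del)); case: (lerP 0 x); case: (lerP 0 (x - 2 * del));
  move=> *; apply/andP; split; nra.
Qed.

Lemma tent_int_taylor x h :
  `|tent_int del (x + h) - tent_int del x - h * tent del x| <= 2 / del * h ^+ 2.
Proof.
have d0 := del0.
have -> : tent_int del (x + h) - tent_int del x - h * tent del x =
  (Num.max 0 (x + h + 2 * del) ^+ 2 - 2 * Num.max 0 (x + h) ^+ 2
    + Num.max 0 (x + h - 2 * del) ^+ 2 - (Num.max 0 (x + 2 * del) ^+ 2
    - 2 * Num.max 0 x ^+ 2 + Num.max 0 (x - 2 * del) ^+ 2)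
    - 2 * h * (Num.max 0 (x + 2 * del) - 2 * Num.max 0 x
    + Num.max 0 (x - 2 * del))) / (2 * del).
  by rewrite /tent_int /tent; field; rewrite gt_eqF.
have d2 : 0 < 2 * del by lra.
rewrite normrM normfV (gtr0_norm d2) ler_pdivrMr//.
have -> : 2 / del * h ^+ 2 * (2 * del) = 4 * h ^+ 2.
  by field; rewrite gt_eqF.
have := max0_sqr_taylor (x + 2 * del) h.
have := max0_sqr_taylor (x - 2 * del) h.
have := max0_sqr_taylor x h.
rewrite (addrAC x _ h) (addrAC x _ h).
by rewrite !ler_norml => /andP[? ?] /andP[? ?] /andP[? ?]; apply/andP; split; lra.
Qed.

Lemma tent_int_lip x y : `|tent_int del x - tent_int del y| <= 4 * `|x - y|.
Proof.
have d0 := del0.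
have [xy|xy] := lerP `|x - y| del; last first.
  have := tent_int_bounds x; have := tent_int_bounds y.
  move=> /andP[? ?] /andP[? ?]; rewrite ler_norml; apply/andP; split; lra.
have := tent_int_taylor y (x - y); rewrite (addrC y) subrK.
have : 2 / del * (x - y) ^+ 2 <= 2 * `|x - y|.
  rewrite -real_normK ?num_real// expr2 mulrA ler_wpM2r// mulrAC ler_pdivrMr//.
  by rewrite ler_pM2l.
have : `|(x - y) * tent del y| <= 2 * `|x - y|.
  have /andP[t0 t2] := tent_bounds y.
  by rewrite normrM mulrC ler_wpM2r// ger0_norm.
rewrite !ler_norml => /andP[? ?] ? /andP[? ?]; apply/andP; split; lra.
Qed.

End Tent.

(** * A barrier in one dimension *)

(** A one-dimensional supersolution: [g a u r] bounds the mean, [r] units of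
time ahead, of a function of the coordinate [u] of a particle that moves with
the signed speed [sgn a * c] and reverses at a rate at most [M].  [A] is the
decrease along the flow that pays for the reversals. *)
Record supersolution {R : realType} (c M rm K L C : R)
    (g A : bool -> R -> R -> R) : Prop := Supersolution {
  super_ge0 : forall a u r, 0 <= r -> r <= rm -> 0 <= g a u r;
  super_le : forall a u r, 0 <= r -> r <= rm -> g a u r <= K;
  super_lip : forall a u u' r, `|g a u r - g a u' r| <= L * `|u - u'|;
  super_time : forall a u r h, 0 <= h -> g a u (r - h) <= g a u r + L * h;
  cost_ge0 : forall a u r, 0 <= A a u r;
  cost_le : forall a u r, A a u r <= K;
  super_flow : forall a u r h, 0 <= h ->
    g a (u + sgn a * c * h) (r - h) <= g a u r - h * A a u r + C * h ^+ 2;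
  super_switch : forall a u r h, 0 <= h ->
    M * (g (~~ a) u (r - h) - g a u (r - h)) <= A a u r + C * h
}.

Section Barrier.
Context {R : realType}.
Variables (c M del u0 : R).
Hypotheses (c0 : 0 < c) (M0 : 0 <= M) (del0 : 0 < del).

Definition barrier (a : bool) (u r : R) : R :=
  tent del (u - u0 + sgn a * c * r) +
  M / (2 * c) * (if a then 4 * del - tent_int del (u - u0 - c * r)
                 else tent_int del (u - u0 + c * r))
  + M ^+ 2 / (2 * c) * (4 * del) * r.

Definition barrier_cost (a : bool) (u r : R) : R :=
  M * tent del (u - u0 - sgn a * c * r) + M ^+ 2 / (2 * c) * (4 * del).

(** The tent is transported towards its target; whatever it feeds into the
opposite direction along the way is collected by its primitive, and what this
feeds back is dominated by a constant growing linearly in time. *)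
Lemma barrier_super rm : 0 <= rm -> exists K L C,
  supersolution c M rm K L C barrier barrier_cost.
Proof.
move=> rm0; have c00 := c0; have M00 := M0; have d0 := del0.
pose m := M / (2 * c); pose q := M ^+ 2 / (2 * c) * (4 * del).
have m0 : 0 <= m by rewrite divr_ge0//; lra.
have q0 : 0 <= q.
  by rewrite mulr_ge0//; [rewrite divr_ge0 ?sqr_ge0//; lra|lra].
have mM : m * (2 * c) = M by rewrite /m divfK// gt_eqF//; lra.
have qM : M * (m * (4 * del)) = q by rewrite /q /m; field; rewrite gt_eqF.
have Lt0 : 0 <= 4 / del by rewrite divr_ge0//; lra.
have Bt0 : 0 <= 2 / del by rewrite divr_ge0//; lra.
have tb x := tent_bounds d0 x; have ib x := tent_int_bounds d0 x.
exists (2 + m * (4 * del) + q * rm + M * 2 + q).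
exists (4 / del * (1 + c) + m * (4 * (1 + c)) + q).
exists (m * (2 / del * (2 * c) ^+ 2) + M * (4 / del * c)).
have pos1 : 0 <= m * (4 * del) by rewrite mulr_ge0//; lra.
have pos2 : 0 <= q * rm by rewrite mulr_ge0.
split.
- move=> a u r r0 rrm; rewrite /barrier -/m -/q.
  have := tb (u - u0 + sgn a * c * r) => /andP[? ?].
  have qr : 0 <= q * r by rewrite mulr_ge0.
  have : 0 <= m * (if a then 4 * del - tent_int del (u - u0 - c * r)
                 else tent_int del (u - u0 + c * r)).
    rewrite mulr_ge0//; case: (a).
      by have := ib (u - u0 - c * r) => /andP[? ?]; lra.
    by have := ib (u - u0 + c * r) => /andP[].
  lra.
- move=> a u r r0 rrm; rewrite /barrier -/m -/q.
  have := tb (u - u0 + sgn a * c * r) => /andP[? ?].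
  have qr : q * r <= q * rm by rewrite ler_wpM2l.
  have : m * (if a then 4 * del - tent_int del (u - u0 - c * r)
                 else tent_int del (u - u0 + c * r)) <= m * (4 * del).
    rewrite ler_wpM2l//; case: (a).
      by have := ib (u - u0 - c * r) => /andP[? ?]; lra.
    by have := ib (u - u0 + c * r) => /andP[].
  lra.
- move=> a u u' r; rewrite /barrier -/m -/q.
  have e1 := tent_lip d0 (u - u0 + sgn a * c * r) (u' - u0 + sgn a * c * r).
  have e2 : `|(if a then 4 * del - tent_int del (u - u0 - c * r)
                 else tent_int del (u - u0 + c * r)) -
      (if a then 4 * del - tent_int del (u' - u0 - c * r)
                 else tent_int del (u' - u0 + c * r))| <= 4 * `|u - u'|.
    case: (a).
      have := tent_int_lip d0 (u - u0 - c * r) (u' - u0 - c * r).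
      have -> : u - u0 - c * r - (u' - u0 - c * r) = u - u' by ring.
      by rewrite distrC; have -> : forall y z w : R, y - z - (y - w) = w - z
        by move=> *; ring.
    have := tent_int_lip d0 (u - u0 + c * r) (u' - u0 + c * r).
    by have -> : u - u0 + c * r - (u' - u0 + c * r) = u - u' by ring.
  move: e1; have -> : u - u0 + sgn a * c * r - (u' - u0 + sgn a * c * r) = u - u' by ring.
  move=> e1; have := ler_wpM2l m0 e2.
  rewrite -{1}(ger0_norm m0) -normrM => e3.
  have p1 : 0 <= 4 / del * c * `|u - u'|.
    by apply: mulr_ge0 => //; apply: mulr_ge0 => //; lra.
  have p2 : 0 <= m * (4 * c) * `|u - u'|.
    by apply: mulr_ge0 => //; apply: mulr_ge0 => //; lra.
  have p3 : 0 <= q * `|u - u'| by rewrite mulr_ge0.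
  by move: e1 e3; rewrite !ler_norml => /andP[? ?] /andP[? ?]; apply/andP; split; lra.
- move=> a u r h h0; rewrite /barrier -/m -/q.
  have ch0 : 0 <= c * h by rewrite mulr_ge0// ltW.
  have e1 := tent_lip d0 (u - u0 + sgn a * c * (r - h)) (u - u0 + sgn a * c * r).
  have e1' : `|u - u0 + sgn a * c * (r - h) - (u - u0 + sgn a * c * r)| <= c * h.
    have -> : u - u0 + sgn a * c * (r - h) - (u - u0 + sgn a * c * r) = - (sgn a * (c * h)) by ring.
    by rewrite normrN normrM (ger0_norm ch0) /sgn; case: (a); rewrite ?normrN1 ?normr1 mul1r.
  have e2 : (if a then 4 * del - tent_int del (u - u0 - c * (r - h))
                 else tent_int del (u - u0 + c * (r - h))) <=
      (if a then 4 * del - tent_int del (u - u0 - c * r)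
                 else tent_int del (u - u0 + c * r)) + 4 * (c * h).
    case: (a).
      have := tent_int_lip d0 (u - u0 - c * (r - h)) (u - u0 - c * r).
      have -> : u - u0 - c * (r - h) - (u - u0 - c * r) = c * h by ring.
      by rewrite (ger0_norm ch0) ler_norml => /andP[? ?]; lra.
    have := tent_int_lip d0 (u - u0 + c * (r - h)) (u - u0 + c * r).
    have -> : u - u0 + c * (r - h) - (u - u0 + c * r) = - (c * h) by ring.
    by rewrite normrN (ger0_norm ch0) ler_norml => /andP[? ?]; lra.
  have e3 : 4 / del * `|u - u0 + sgn a * c * (r - h) - (u - u0 + sgn a * c * r)| <=
     4 / del * (c * h) by rewrite ler_wpM2l.
  have := ler_wpM2l m0 e2.
  set J := (if a then _ else _); set J' := (if a then _ else _) => e4.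
  have p1 : 0 <= 4 / del * h by rewrite mulr_ge0.
  have p2 : 0 <= m * h by rewrite mulr_ge0.
  have p3 : 0 <= q * h by rewrite mulr_ge0.
  by move: e1; rewrite ler_norml => /andP[? ?]; lra.
- move=> a u r; rewrite /barrier_cost -/q addr_ge0// mulr_ge0//.
  by have /andP[] := tb (u - u0 - sgn a * c * r).
- move=> a u r; rewrite /barrier_cost -/q.
  have /andP[_ t2] := tb (u - u0 - sgn a * c * r).
  have := ler_wpM2l M00 t2; lra.
- move=> a u r h h0; rewrite /barrier /barrier_cost -/m -/q.
  have -> : u + sgn a * c * h - u0 + sgn a * c * (r - h) = u - u0 + sgn a * c * r by ring.
  have p : 0 <= M * (4 / del * c) * h ^+ 2.
    by apply: mulr_ge0; [apply: mulr_ge0 => //; apply: mulr_ge0 => //; lra|exact: sqr_ge0].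
  have e : (if a then 4 * del - tent_int del (u + sgn a * c * h - u0 - c * (r - h))
                 else tent_int del (u + sgn a * c * h - u0 + c * (r - h))) <=
      (if a then 4 * del - tent_int del (u - u0 - c * r)
                 else tent_int del (u - u0 + c * r))
      - 2 * c * h * tent del (u - u0 - sgn a * c * r) + 2 / del * (2 * c) ^+ 2 * h ^+ 2.
    case: (a); rewrite /sgn.
      have := tent_int_taylor d0 (u - u0 - c * r) (2 * c * h).
      rewrite mul1r; have -> : u + c * h - u0 - c * (r - h) = u - u0 - c * r + 2 * c * h by ring.
      by rewrite ler_norml => /andP[? ?]; lra.
    have := tent_int_taylor d0 (u - u0 + c * r) (- (2 * c * h)).
    have -> : u + -1 * c * h - u0 + c * (r - h) = u - u0 + c * r - (2 * c * h) by ring.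
    have -> : u - u0 - -1 * c * r = u - u0 + c * r by ring.
    by rewrite ler_norml => /andP[? ?]; lra.
  have := ler_wpM2l m0 e.
  set J := (if a then _ else _); set J' := (if a then _ else _).
  set G := tent _ (_ - _) => e4.
  have mE : m * (2 * c * h * G) = M * G * h by rewrite -mM; ring.
  by lra.
- move=> a u r h h0; rewrite /barrier /barrier_cost -/m -/q.
  have ch0 : 0 <= c * h by rewrite mulr_ge0// ltW.
  have e1 := tent_lip d0 (u - u0 + sgn (~~ a) * c * (r - h)) (u - u0 - sgn a * c * r).
  have e1' : `|u - u0 + sgn (~~ a) * c * (r - h) - (u - u0 - sgn a * c * r)| <= c * h.
    have -> : sgn (~~ a) = - sgn a :> R by rewrite /sgn; case: (a); rewrite ?opprK.
    have -> : u - u0 + - sgn a * c * (r - h) - (u - u0 - sgn a * c * r) = sgn a * (c * h) by ring.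
    by rewrite normrM (ger0_norm ch0) /sgn; case: (a); rewrite ?normrN1 ?normr1 mul1r.
  have e3 : 4 / del * `|u - u0 + sgn (~~ a) * c * (r - h) - (u - u0 - sgn a * c * r)| <=
     4 / del * (c * h) by rewrite ler_wpM2l.
  have /andP[t0 _] := tb (u - u0 + sgn a * c * (r - h)).
  set J := (if ~~ a then _ else _); set J' := (if a then _ else _).
  have JJ : J - J' <= 4 * del.
    rewrite /J /J'; have /andP[? ?] := ib (u - u0 - c * (r - h)).
    by have /andP[? ?] := ib (u - u0 + c * (r - h)); case: (a) => /=; lra.
  have e4 := ler_wpM2l m0 JJ.
  have e5 : tent del (u - u0 + sgn (~~ a) * c * (r - h)) <=
     tent del (u - u0 - sgn a * c * r) + 4 / del * (c * h).
    by move: e1; rewrite ler_norml => /andP[? ?]; lra.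
  have p : 0 <= m * (2 / del * (2 * c) ^+ 2) * h.
    by apply: mulr_ge0 => //; apply: mulr_ge0 => //; apply: mulr_ge0 => //; exact: sqr_ge0.
  have e6 : tent del (u - u0 + sgn (~~ a) * c * (r - h)) + m * J + q * (r - h)
      - (tent del (u - u0 + sgn a * c * (r - h)) + m * J' + q * (r - h))
    <= tent del (u - u0 - sgn a * c * r) + 4 / del * (c * h) + m * (4 * del) by lra.
  have := ler_wpM2l M00 e6; lra.
Qed.

End Barrier.

(** * Products of barriers *)

(** Errors of second order over [n] equal steps add up to [O(1 / n)]. *)
Lemma nonincreasing_by_steps {R : realType} (phi : R -> R) (tau t C : R) :
  0 <= C -> tau <= t ->
  (forall s h, tau <= s -> 0 <= h -> h <= 1 -> s + h <= t ->
    phi (s + h) <= phi s + C * h ^+ 2) ->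
  phi t <= phi tau.
Proof.
move=> C0 taut step; apply/ler_addgt0Pr => e e0.
pose l := t - tau; have l0 : 0 <= l by rewrite subr_ge0.
pose B := l + C * l ^+ 2 / e; pose n := (Num.truncn B).+1.
have Bn : B < n%:R by exact: truncnS_gt.
have Cle : 0 <= C * l ^+ 2 / e by rewrite divr_ge0// ?mulr_ge0 ?sqr_ge0// ltW.
have n0 : 0 < n%:R :> R by rewrite ltr0n.
pose h := l / n%:R; have h0 : 0 <= h by rewrite divr_ge0.
have h1 : h <= 1 by rewrite ler_pdivrMr// mul1r; rewrite /B in Bn; lra.
have nh : n%:R * h = l by rewrite /h mulrCA divff ?mulr1// gt_eqF.
have iter i : (i <= n)%N -> phi (tau + i%:R * h) <= phi tau + i%:R * (C * h ^+ 2).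
  elim: i => [|i IH] ilen; first by rewrite !mul0r !addr0.
  have ih := IH (ltnW ilen).
  have -> : tau + i.+1%:R * h = tau + i%:R * h + h by rewrite -natr1; ring.
  have := step (tau + i%:R * h) h; rewrite lerDl mulr_ge0// => /(_ isT h0 h1).
  have il : tau + i%:R * h + h <= t.
    have -> : tau + i%:R * h + h = tau + i.+1%:R * h by rewrite -natr1; ring.
    rewrite addrC -lerBrDr -/l -nh ler_wpM2r// ler_nat//.
  by move=> /(_ il) st; rewrite -natr1; lra.
have := iter n (leqnn n); rewrite nh {1}/l addrC subrK => /le_trans; apply.
rewrite lerD2l.
have -> : n%:R * (C * h ^+ 2) = C * l ^+ 2 / n%:R.
  by rewrite /h; field; rewrite gt_eqF.
rewrite ler_pdivrMr//.
have : C * l ^+ 2 / e <= n%:R by rewrite /B in Bn; lra.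
by rewrite ler_pdivrMr// [n%:R * e]mulrC.
Qed.

Lemma supersolution_weaken {R : realType} (c M rm K L C K' L' C' : R) g A :
  K <= K' -> L <= L' -> C <= C' ->
  supersolution c M rm K L C g A -> supersolution c M rm K' L' C' g A.
Proof.
move=> KK LL CC [g0 gK gl gt A0 AK gf gs]; split=> //.
- by move=> a u r r0 rm0; exact: le_trans (gK _ _ _ _ _) KK.
- move=> a u u' r; apply: (le_trans (gl a u u' r)); exact: ler_wpM2r.
- move=> a u r h h0; apply: (le_trans (gt a u r h h0)).
  by rewrite lerD2l ler_wpM2r.
- by move=> a u r; exact: le_trans (AK _ _ _) KK.
- move=> a u r h h0; apply: (le_trans (gf a u r h h0)).
  by rewrite lerD2l ler_wpM2r// sqr_ge0.
- move=> a u r h h0; apply: (le_trans (gs a u r h h0)).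
  by rewrite lerD2l ler_wpM2r.
Qed.

Section ProductSupersolution.
Context {R : realType}.
Variables (c M rm K L C : R) (g1 A1 g2 A2 : bool -> R -> R -> R).
Hypotheses (M0 : 0 <= M) (rm0 : 0 <= rm) (C0 : 0 <= C).
Hypothesis S1 : supersolution c M rm K L C g1 A1.
Hypothesis S2 : supersolution c M rm K L C g2 A2.

(** The coordinates [x + y] and [x - y] both move at the speed [c], and a switch
reverses exactly one of them: each factor is a barrier for its coordinate. *)
Definition product_super (r x y : R) (k : 'Z_4) : R :=
  g1 (signu k) (x + y) r * g2 (signv k) (x - y) r.

Let K0 : 0 <= K.
Proof. exact: le_trans (super_ge0 S1 true 0 (lexx 0) rm0) (super_le S1 true 0 (lexx 0) rm0). Qed.

Let L0 : 0 <= L.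
Proof.
have := super_lip S1 true 1 0 0; rewrite subr0 normr1 mulr1.
exact: le_trans.
Qed.

Lemma lipb_product_super r : 0 <= r -> r <= rm ->
  lipb (K * K) (2 * K * L) (product_super r).
Proof.
move=> r0 rrm; have K00 := K0; have L00 := L0; split=> [x y k|x y x' y' k].
  have := super_ge0 S1 (signu k) (x + y) r0 rrm.
  have := super_ge0 S2 (signv k) (x - y) r0 rrm.
  have := super_le S1 (signu k) (x + y) r0 rrm.
  have := super_le S2 (signv k) (x - y) r0 rrm.
  by rewrite /product_super => *; rewrite ger0_norm ?mulr_ge0// ler_pM.
rewrite /product_super.
set a := g1 _ _ _; set b := g2 _ _ _; set a' := g1 _ _ _; set b' := g2 _ _ _.
have -> : a * b - a' * b' = a * (b - b') + b' * (a - a') by ring.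
have aK : `|a| <= K.
  by rewrite ger0_norm; [exact: (super_le S1 _ _ r0 rrm)|exact: (super_ge0 S1 _ _ r0 rrm)].
have bK : `|b'| <= K.
  by rewrite ger0_norm; [exact: (super_le S2 _ _ r0 rrm)|exact: (super_ge0 S2 _ _ r0 rrm)].
have du : `|a - a'| <= L * (`|x - x'| + `|y - y'|).
  apply: (le_trans (super_lip S1 _ _ _ _)); rewrite ler_wpM2l//.
  have -> : x + y - (x' + y') = (x - x') + (y - y') by ring.
  exact: ler_normD.
have dv : `|b - b'| <= L * (`|x - x'| + `|y - y'|).
  apply: (le_trans (super_lip S2 _ _ _ _)); rewrite ler_wpM2l//.
  have -> : x - y - (x' - y') = (x - x') - (y - y') by ring.
  exact: ler_normB.
apply: (le_trans (ler_normD _ _)); rewrite !normrM.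
have -> : 2 * K * L * (`|x - x'| + `|y - y'|) =
  K * (L * (`|x - x'| + `|y - y'|)) + K * (L * (`|x - x'| + `|y - y'|)) by ring.
by apply: lerD; apply: ler_pM.
Qed.

Let switch_term (Lam h j g A' g' G' : R) : 0 <= Lam -> Lam <= 2 * M * h -> 0 <= h ->
  M * (j - g) <= A' + C * h -> 0 <= A' -> 0 <= g' -> g' <= G' + L * h ->
  Lam / 2 * (j - g) * g' <= h * (A' + C * h) * (G' + L * h).
Proof.
move=> Lam0 LamM h0 jg A0 g0 gG; have C00 := C0.
have Ch : 0 <= C * h by rewrite mulr_ge0.
have X0 : 0 <= h * (A' + C * h) by rewrite mulr_ge0// addr_ge0.
apply: (@le_trans _ _ (h * (A' + C * h) * g')); last exact: ler_wpM2l.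
rewrite ler_wpM2r//; have [jg0|jg0] := lerP (j - g) 0.
  by apply: le_trans X0; rewrite mulr_ge0_le0// divr_ge0.
apply: (@le_trans _ _ (M * h * (j - g))).
  by rewrite ler_wpM2r ?(ltW jg0)//; lra.
by rewrite mulrAC mulrC ler_wpM2l.
Qed.

Definition step_error := K ^+ 2 + 4 * C * K + C ^+ 2 + 2 * K * L + 2 * C * L.

(** A switch affects one factor at a time, so its expected gain splits into the
gains of the two factors, each paid for by the decrease of that factor along
the flow. *)
Lemma product_super_step r h Lam x y k :
  0 <= h -> h <= 1 -> h <= r -> r <= rm -> 0 <= Lam -> Lam <= 2 * M * h ->
  flow c h (product_super (r - h)) x y k +
  Lam * ((turned 1 (product_super (r - h)) x y k +
          turned (-1) (product_super (r - h)) x y k) / 2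
         - product_super (r - h) x y k)
  <= product_super r x y k + step_error * h ^+ 2.
Proof.
move=> h0 h1 hr rrm Lam0 LamM; have K00 := K0; have L00 := L0; have C00 := C0.
have r0 : 0 <= r by exact: le_trans hr.
have rh0 : 0 <= r - h by rewrite subr_ge0.
have rhm : r - h <= rm by rewrite (le_trans _ rrm)// gerBl.
set u := x + y; set v := x - y; set a := signu k; set b := signv k.
rewrite /flow /turned /product_super.
rewrite (switch_signs (fun a b => g1 a (x + y) (r - h) * g2 b (x - y) (r - h))).
have -> : x + c * h * dirx k + (y + c * h * diry k) = u + sgn a * c * h.
  by rewrite -(dir_u k) /u; ring.
have -> : x + c * h * dirx k - (y + c * h * diry k) = v + sgn b * c * h.
  by rewrite -(dir_v k) /v; ring.
rewrite -/u -/v -/a -/b.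
have f1 := super_flow S1 a u r h0; have f2 := super_flow S2 b v r h0.
have s1 := super_switch S1 a u r h0; have s2 := super_switch S2 b v r h0.
have t1 := super_time S1 a u r h0; have t2 := super_time S2 b v r h0.
have n1 := super_ge0 S1 a (u + sgn a * c * h) rh0 rhm.
have n2 := super_ge0 S2 b (v + sgn b * c * h) rh0 rhm.
have p1 := super_ge0 S1 a u rh0 rhm; have p2 := super_ge0 S2 b v rh0 rhm.
have k1 := super_le S1 a u r0 rrm; have k2 := super_le S2 b v r0 rrm.
have z1 := super_ge0 S1 a u r0 rrm; have z2 := super_ge0 S2 b v r0 rrm.
have c1 := cost_ge0 S1 a u r; have c2 := cost_ge0 S2 b v r.
have d1 := cost_le S1 a u r; have d2 := cost_le S2 b v r.
move: f1 f2 s1 s2 t1 t2 n1 n2 p1 p2 k1 k2 z1 z2 c1 c2 d1 d2.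
set P1 := g1 a (u + _) _; set P2 := g2 b (v + _) _.
set G1 := g1 a u r; set G2 := g2 b v r; set B1 := A1 a u r; set B2 := A2 b v r.
set q1 := g1 a u (r - h); set q2 := g2 b v (r - h).
set j1 := g1 (~~ a) u _; set j2 := g2 (~~ b) v _.
move=> f1 f2 s1 s2 t1 t2 n1 n2 p1 p2 k1 k2 z1 z2 c1 c2 d1 d2.
have e1 := switch_term Lam0 LamM h0 s1 c1 p2 t2.
have e2 := switch_term Lam0 LamM h0 s2 c2 p1 t1.
have e0 : P1 * P2 <= (G1 - h * B1 + C * h ^+ 2) * (G2 - h * B2 + C * h ^+ 2).
  exact: ler_pM.
have hh : 0 <= h ^+ 2 by exact: sqr_ge0.
have b1 : h ^+ 2 * (B1 * B2) <= h ^+ 2 * K ^+ 2.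
  by rewrite ler_wpM2l// expr2 ler_pM.
have b2 : h ^+ 2 * (C * (G1 + G2)) <= h ^+ 2 * (C * (2 * K)).
  by rewrite ler_wpM2l// ler_wpM2l//; lra.
have b3 : 0 <= C * h ^+ 2 * h * (B1 + B2) by rewrite !mulr_ge0// addr_ge0.
have h4 : h ^+ 2 * h ^+ 2 <= h ^+ 2 by rewrite ler_piMr// exprn_ile1.
have b4 : C ^+ 2 * (h ^+ 2 * h ^+ 2) <= C ^+ 2 * h ^+ 2.
  by rewrite ler_wpM2l// sqr_ge0.
have b5 : h ^+ 2 * (L * (B1 + B2)) <= h ^+ 2 * (L * (2 * K)).
  by rewrite ler_wpM2l// ler_wpM2l//; lra.
have b6 : C * L * (h ^+ 2 * h) <= C * L * h ^+ 2.
  by rewrite ler_wpM2l ?mulr_ge0// ler_piMr.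
rewrite /step_error; lra.
Qed.

End ProductSupersolution.

(** * Bounded density inside the square *)

Section BoxBound.
Context {R : realType} {d : measure_display} {T : measurableType d}.
Context (P : probability T R) (c : R) (lambda : R -> R).
Context (N : R -> T -> nat) (k0 : T -> 'Z_4) (turn : nat -> T -> bool).
Context (X Y : R -> T -> R).
Hypothesis c_gt0 : 0 < c.
Hypothesis lambda_ge0 : forall t : R, 0 < t -> 0 <= lambda t.
Hypothesis lambda_cont : forall t : R, 0 < t -> {for t, continuous lambda}.
Hypothesis motion : driven_motion P c lambda N k0 turn X Y.
Local Notation D := (direction N k0 turn).
Local Notation mean := (mean P N k0 turn X Y).

Lemma position_le t w : 0 <= t -> `|X t w| <= c * t /\ `|Y t w| <= c * t.
Proof.
move=> t0; rewrite (XE motion)// (YE motion)// !normrM gtr0_norm// !ler_pM2l//.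
have px := path_lip motion w (v := dirx) dirx_le1 (lexx 0) t0.
have py := path_lip motion w (v := diry) diry_le1 (lexx 0) t0.
by move: px py; rewrite set_itv1 !Rintegral_set1 !subr0.
Qed.

Section Decrease.
Variables (M rm K L C : R) (g1 A1 g2 A2 : bool -> R -> R -> R).
Hypotheses (M0 : 0 <= M) (rm0 : 0 <= rm) (C0 : 0 <= C).
Hypothesis S1 : supersolution c M rm K L C g1 A1.
Hypothesis S2 : supersolution c M rm K L C g2 A2.
Local Notation F := (product_super g1 g2).

Lemma mean_product_super_step s h r :
  0 < s -> 0 <= h -> h <= 1 -> h <= r -> r <= rm ->
  (forall u, s < u -> u <= s + h -> lambda u <= 2 * M) ->
  mean (F (r - h)) (s + h) <= mean (F r) s +
    (step_error K L C + 12 * K ^+ 2 * M ^+ 2 + 16 * K * L * c * M) * h ^+ 2.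
Proof.
move=> s_gt0 h0 h1 hr rrm lM; have s0 := ltW s_gt0.
have r0 : 0 <= r by exact: le_trans hr.
have rh0 : 0 <= r - h by rewrite subr_ge0.
have rhm : r - h <= rm by rewrite (le_trans _ rrm)// gerBl.
have fl := lipb_product_super rm0 S1 S2 rh0 rhm.
have rl := lipb_product_super rm0 S1 S2 r0 rrm.
pose Lam := cumulative_rate lambda s (s + h).
have Lam0 : 0 <= Lam by exact: cumulative_rate_ge0.
have LamM : Lam <= 2 * M * h.
  have -> : 2 * M * h = 2 * M * (s + h - s) by ring.
  by apply: (cumulative_rate_le motion) => //; rewrite lerDl.
pose E := step_error K L C * h ^+ 2.
pose comb x y k := flow c h (F (r - h)) x y k +
  (Lam / 2 * turned 1 (F (r - h)) x y k + (Lam / 2 * turned (-1) (F (r - h)) x y k +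
   - Lam * F (r - h) x y k)).
have l1 := lipbZ (Lam / 2) (lipb_turned 1 fl).
have l2 := lipbZ (Lam / 2) (lipb_turned (-1) fl).
have l3 := lipbZ (- Lam) fl.
have l23 := lipbD l2 l3; have l123 := lipbD l1 l23.
have lc := lipbD (lipb_flow c h fl) l123.
have lE := lipbD rl (lipb_cst E).
have combE : mean comb s = mean (flow c h (F (r - h))) s + Lam *
    ((mean (turned 1 (F (r - h))) s + mean (turned (-1) (F (r - h))) s) / 2
     - mean (F (r - h)) s).
  rewrite (meanD c_gt0 motion s0 (lipb_flow c h fl) l123).
  rewrite (meanD c_gt0 motion s0 l1 l23) (meanD c_gt0 motion s0 l2 l3).
  rewrite (meanZ c_gt0 motion _ s0 (lipb_turned 1 fl)).
  rewrite (meanZ c_gt0 motion _ s0 (lipb_turned (-1) fl)).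
  by rewrite (meanZ c_gt0 motion _ s0 fl); field.
have combF : mean comb s <= mean (F r) s + E.
  have <- : mean (fun x y k => F r x y k + E) s = mean (F r) s + E.
    rewrite (meanD c_gt0 motion s0 rl (lipb_cst E)); congr (_ + _).
    exact: Rintegral_cst_prob.
  apply: (mean_monotone c_gt0 motion s0 lc lE) => w.
  have := product_super_step rm0 C0 S1 S2 (X s w) (Y s w) (D s w) h0 h1 hr rrm Lam0 LamM.
  by rewrite /comb /E; lra.
have := mean_step c_gt0 lambda_ge0 motion fl s0 h0; rewrite -/Lam.
have K0 : 0 <= K.
  exact: le_trans (super_ge0 S1 true 0 (lexx 0) rm0) (super_le S1 true 0 (lexx 0) rm0).
have L0 : 0 <= L.
  by have := super_lip S1 true 1 0 0; rewrite subr0 normr1 mulr1; exact: le_trans.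
have c0 := ltW c_gt0; have M00 := M0.
have b1 : Lam ^+ 2 <= (2 * M * h) ^+ 2 by rewrite lerXn2r// nnegrE// !mulr_ge0.
have b2 : 3 * (K * K) * Lam ^+ 2 <= 3 * (K * K) * (2 * M * h) ^+ 2.
  by rewrite ler_wpM2l// !mulr_ge0.
have b3 : 4 * (2 * K * L) * (c * h) * Lam <= 4 * (2 * K * L) * (c * h) * (2 * M * h).
  by rewrite ler_wpM2l// !mulr_ge0.
rewrite ler_norml => /andP[_ step].
move: step combE combF; rewrite /E => step combE combF.
lra.
Qed.

Lemma mean_product_super_decr tau t : 0 < tau -> tau <= t -> t - tau <= rm ->
  (forall u, tau < u -> u <= t -> lambda u <= 2 * M) ->
  mean (F 0) t <= mean (F (t - tau)) tau.
Proof.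
move=> tau0 taut trm lM.
have K0 : 0 <= K.
  exact: le_trans (super_ge0 S1 true 0 (lexx 0) rm0) (super_le S1 true 0 (lexx 0) rm0).
have L0 : 0 <= L.
  by have := super_lip S1 true 1 0 0; rewrite subr0 normr1 mulr1; exact: le_trans.
have c0 := ltW c_gt0; have M00 := M0; have C00 := C0.
have := @nonincreasing_by_steps R (fun s => mean (F (t - s)) s) tau t
  (step_error K L C + 12 * K ^+ 2 * M ^+ 2 + 16 * K * L * c * M).
rewrite subrr; apply=> //.
  by rewrite /step_error !addr_ge0// ?sqr_ge0// ?mulr_ge0// ?sqr_ge0// ?mulr_ge0.
move=> s h taus h0 h1 sht; rewrite opprD addrA.
apply: mean_product_super_step => //.
- exact: lt_le_trans taus.
- by rewrite lerBrDl.
- by rewrite (le_trans _ trm)// lerD2l lerN2.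
- move=> u su ush; apply: lM; first exact: le_lt_trans su.
  exact: le_trans sht.
Qed.

End Decrease.

(** The barriers decrease in mean from the small time [tau] to [t]. At the time
[tau] the particle is still too close to the origin for the transported tents to
see it, so only the diffuse part of each barrier remains, which is of order
[del]. *)
Lemma box_bound (t b : R) : 0 < t -> 0 <= b -> b < c * t ->
  exists kappa : R, forall u0 v0 del : R, `|u0| <= b -> `|v0| <= b ->
    0 < del -> del <= (c * t - b) / 4 ->
    (P [set w | (`|X t w + Y t w - u0| <= del /\ `|X t w - Y t w - v0| <= del)%R]
      <= (kappa * del ^+ 2)%:E)%E.
Proof.
move=> t_gt0 b0 bct; have t0 := ltW t_gt0; have c00 := c_gt0.
pose tau := (c * t - b) / (6 * c).
have tau0 : 0 < tau by rewrite divr_gt0//; lra.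
have ctau : c * tau = (c * t - b) / 6 by rewrite /tau; field; rewrite gt_eqF.
have taut : tau <= t by rewrite -(ler_pM2l c00) ctau; lra.
have [M M0 lM] : exists2 M, 0 <= M & forall u, tau < u -> u <= t -> lambda u <= 2 * M.
  have [|x _ Hx] := @EVT_max R lambda tau t taut.
    apply: continuous_in_subspaceT => x; rewrite inE/= in_itv/= => /andP[tx _].
    by apply: lambda_cont; exact: lt_le_trans tx.
  exists `|lambda x| => // u tu ut.
  have := Hx u; rewrite in_itv/= (ltW tu) ut => /(_ isT).
  have := ler_norm (lambda x); have := normr_ge0 (lambda x); lra.
pose rm := t - tau; have rm0 : 0 <= rm by rewrite subr_ge0.
pose kap := M / (2 * c) * 4 + M ^+ 2 / (2 * c) * 4 * rm.
exists (kap ^+ 2) => u0 v0 del ub vb del0 del1.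
have [Ka [La [Ca Sa]]] := barrier_super u0 c00 M0 del0 rm0.
have [Kb [Lb [Cb Sb]]] := barrier_super v0 c00 M0 del0 rm0.
pose K := Num.max Ka Kb; pose L := Num.max La Lb; pose C := Num.max (Num.max Ca Cb) 0.
have S1 : supersolution c M rm K L C (barrier c M del u0) (barrier_cost c M del u0).
  by apply: supersolution_weaken Sa; rewrite !le_max lexx.
have S2 : supersolution c M rm K L C (barrier c M del v0) (barrier_cost c M del v0).
  by apply: supersolution_weaken Sb; rewrite !le_max lexx ?orbT.
have C0 : 0 <= C by rewrite le_max lexx orbT.
have decr := mean_product_super_decr M0 rm0 C0 S1 S2 tau0 taut (lexx _) lM.
have l0 := lipb_product_super rm0 S1 S2 (lexx 0) rm0.
have lt := lipb_product_super rm0 S1 S2 rm0 (lexx rm).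
set A := [set w | _].
have mA : measurable A.
  have mX := measurable_X c_gt0 motion t0; have mY := measurable_Y c_gt0 motion t0.
  rewrite (_ : A = (fun w => `|X t w + Y t w - u0|) @^-1` `]-oo, del] `&`
      (fun w => `|X t w - Y t w - v0|) @^-1` `]-oo, del]); last first.
    by apply/seteqP; split=> w /=; rewrite !in_itv.
  apply: measurableI; rewrite -[X in measurable X]setTI.
    have mf : measurable_fun setT (fun w => `|X t w + Y t w - u0|).
      apply: measurableT_comp => //; apply: measurable_funB => //.
      exact: measurable_funD.
    exact: mf.
  have mf : measurable_fun setT (fun w => `|X t w - Y t w - v0|).
    apply: measurableT_comp => //; apply: measurable_funB => //.
    exact: measurable_funB.
  exact: mf.
have barrier_ge a u x : 0 <= barrier c M del u a x 0.
  have [? [? [? S]]] := barrier_super u c00 M0 del0 rm0.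
  exact: (super_ge0 S).
have fA : fine (P A) <= mean (product_super (barrier c M del u0) (barrier c M del v0) 0) t.
  rewrite -[leLHS]mul1r -Rintegral_cst// Rintegral_mkcond.
  apply: le_Rintegral => //.
  - apply: (@bounded_prob_integrable _ _ _ P _ _ 1) => //.
      by apply/measurable_restrict => //; rewrite setTI; exact: measurable_cst.
    by move=> w; rewrite patchE; case: ifP; rewrite ?normr1 ?normr0.
  - exact: (integrable_state c_gt0 motion t0 l0 measurableT).
  - move=> w _; rewrite patchE; case: ifPn => [|_]; last by rewrite mulr_ge0.
    rewrite inE => -[hu hv].
    have ge1 a u x : `|x - u| <= del -> 1 <= barrier c M del u a x 0.
      move=> xu; rewrite /barrier !mulr0 !addr0 subr0.
      have := tent_ge1 del0 xu; have /andP[i0 i1] := tent_int_bounds del0 (x - u).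
      have : 0 <= M / (2 * c) * (if a then 4 * del - tent_int del (x - u)
          else tent_int del (x - u)).
        apply: mulr_ge0; first by apply: divr_ge0 => //; lra.
        by case: (a) => //; lra.
      by move=> p q; rewrite -[leLHS]addr0 lerD.
    by rewrite -[leLHS]mulr1; apply: ler_pM => //; exact: ge1.
have ft : mean (product_super (barrier c M del u0) (barrier c M del v0) rm) tau
    <= kap ^+ 2 * del ^+ 2.
  rewrite -[leRHS](Rintegral_cst_prob P); apply: le_Rintegral => //.
  - exact: (integrable_state c_gt0 motion (ltW tau0) lt measurableT).
  - exact: (@bounded_prob_integrable _ _ _ P _ _ `|kap ^+ 2 * del ^+ 2|).
  - move=> w _; have [hX hY] := position_le w (ltW tau0).
    have far a u x : `|u| <= b -> `|x| <= 2 * (c * tau) -> barrier c M del u a x rm <= kap * del.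
      move=> ub' xt; rewrite /barrier tent_eq0//; last first.
        have crm : c * rm = c * t - c * tau by rewrite /rm; ring.
        move: ub' xt; rewrite !ler_norml => /andP[? ?] /andP[? ?].
        rewrite ler_normr /sgn -mulrA crm; case: (a); apply/orP; [left|right]; lra.
      have : (if a then 4 * del - tent_int del (x - u - c * rm)
          else tent_int del (x - u + c * rm)) <= 4 * del.
        have /andP[? ?] := tent_int_bounds del0 (x - u - c * rm).
        have /andP[? ?] := tent_int_bounds del0 (x - u + c * rm).
        by case: (a) => //; lra.
      have m0 : 0 <= M / (2 * c) by apply: divr_ge0 => //; lra.
      set J := (if a then _ else _) => hJ; have := ler_wpM2l m0 hJ; rewrite /kap; lra.
    rewrite -exprMn expr2 ler_pM//.
    + exact: (super_ge0 S1).
    + exact: (super_ge0 S2).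
    + apply: far => //; apply: (le_trans (ler_normD _ _)); lra.
    + apply: far => //; apply: (le_trans (ler_normB _ _)); lra.
rewrite -[P A]fineK ?fin_num_measure// lee_fin.
exact: le_trans fA (le_trans decr ft).
Qed.

End BoxBound.

(** * Dyadic approximation of measurable sets *)

Section Dyadic.
Context {R : realType}.
Local Notation plane := (measurableTypeR R * measurableTypeR R)%type.
Local Notation lebesgue2 := ((@lebesgue_measure R) \x (@lebesgue_measure R))%E.

Definition scale (n : nat) (x : R) : int := Num.floor (2 ^+ n * x).

Definition cell (n : nat) (z : plane) : int * int := (scale n z.1, scale n z.2).

(** A union of cells of the dyadic grid of mesh [2 ^- n]. *)
Definition saturated (n : nat) (E : set plane) : Prop :=
  forall z z', cell n z = cell n z' -> E z -> E z'.

Lemma scale_bounds n x : (scale n x)%:~R <= 2 ^+ n * x < (scale n x)%:~R + 1.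
Proof.
by have := floor_itv (2 ^+ n * x); rewrite intrD.
Qed.

Lemma scaleS n x x' : scale n.+1 x = scale n.+1 x' -> scale n x = scale n x'.
Proof.
have half y y' : scale n.+1 y = scale n.+1 y' -> scale n y <= scale n y'.
  move=> yy'; rewrite /scale floor_ge_int.
  have : 2 * scale n y <= scale n.+1 y.
    rewrite {2}/scale floor_ge_int exprS -mulrA intrM ler_pM2l//.
    by have /andP[] := scale_bounds n y.
  rewrite yy' /scale floor_ge_int exprS -mulrA intrM ler_pM2l//.
by move=> e; apply/le_anti/andP; split; exact: half.
Qed.

Lemma cell_mono n m z z' : (n <= m)%N -> cell m z = cell m z' -> cell n z = cell n z'.
Proof.
move=> /subnK <-; elim: (m - n)%N => [|k IH]//; rewrite addSn => -[e1 e2].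
by apply: IH; congr (_, _); exact: scaleS.
Qed.

Lemma saturated_mono n m E : (n <= m)%N -> saturated n E -> saturated m E.
Proof. by move=> nm sE z z' zz'; apply: sE; exact: cell_mono zz'. Qed.

Lemma scale_dist n x x' : scale n x = scale n x' -> `|x - x'| <= 2 ^- n.
Proof.
move=> e; have := scale_bounds n x; have := scale_bounds n x'; rewrite e.
have n0 : 0 < 2 ^+ n :> R by rewrite exprn_gt0.
move=> /andP[? ?] /andP[? ?]; rewrite -(ler_pM2l n0) divff ?gt_eqF//.
have <- : `|2 ^+ n * (x - x')| = 2 ^+ n * `|x - x'| by rewrite normrM gtr0_norm.
rewrite mulrBr ler_norml; apply/andP; split; lra.
Qed.

Lemma measurable_scale n k : measurable [set x : R | scale n x = k].
Proof.
apply: is_interval_measurable => x y /= xk yk z /andP[xz zy].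
have n0 : 0 <= 2 ^+ n :> R by rewrite exprn_ge0.
have homo a b : a <= b -> scale n a <= scale n b.
  move=> ab; rewrite /scale floor_ge_int.
  have /andP[+ _] := scale_bounds n a; move=> /le_trans; apply.
  exact: ler_wpM2l.
by apply/le_anti/andP; split; [rewrite -yk|rewrite -xk]; exact: homo.
Qed.

Lemma measurable_cell n k : measurable [set z : plane | cell n z = k].
Proof.
case: k => k l; rewrite (_ : [set z | _] =
  [set x | scale n x = k] `*` [set y | scale n y = l]).
  by apply: measurableX; exact: measurable_scale.
by apply/seteqP; split=> -[x y]; rewrite /cell/=; [case=> -> ->|move=> [-> ->]].
Qed.

Lemma lebesgue2_cell n k : lebesgue2 [set z : plane | cell n z = k] = ((2 ^- n) ^+ 2)%:E.
Proof.
case: k => k l.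
have n0 : 0 < 2 ^+ n :> R by rewrite exprn_gt0.
have itv j : [set x | scale n x = j] = `[j%:~R / 2 ^+ n, (j%:~R + 1) / 2 ^+ n[%classic.
  apply/seteqP; split=> x /=; rewrite in_itv/=.
    move=> <-; rewrite ler_pdivrMr// ltr_pdivlMr// mulrC; exact: scale_bounds.
  rewrite ler_pdivrMr// ltr_pdivlMr// mulrC => /andP[h1 h2].
  by apply/eqP; rewrite /scale floor_eq h1 intrD h2.
rewrite (_ : [set z | _] = [set x | scale n x = k] `*` [set y | scale n y = l]); last first.
  by apply/seteqP; split=> -[x y]; rewrite /cell/=; [case=> -> ->|move=> [-> ->]].
rewrite product_measure1E; [|exact: measurable_scale..].
have len j : (lebesgue_measure [set x | scale n x = j] = (2 ^- n)%:E :> \bar R)%E.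
  rewrite itv lebesgue_measure_itv/= lte_fin ltr_pM2r ?invr_gt0// ltrDl ltr01.
  by rewrite -EFinD -mulrBl addrAC subrr add0r mul1r.
by rewrite expr2 EFinM; congr (_ * _)%E; exact: len.
Qed.

Lemma saturated_bigcup n E : saturated n E ->
  E = \bigcup_i [set z | E z /\ pickle (cell n z) = i].
Proof. by move=> _; apply/seteqP; split=> z /=; [exists (pickle (cell n z))|case=> i _ []]. Qed.

Lemma saturated_piece n E i : saturated n E ->
  [set z | E z /\ pickle (cell n z) = i] = set0 \/
  exists2 z0, E z0 & [set z | E z /\ pickle (cell n z) = i] =
    [set z | cell n z = cell n z0].
Proof.
move=> sE; have [->|/set0P[z0 [/= Ez0 z0i]]] := eqVneq [set z | E z /\ pickle (cell n z) = i] set0.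
  by left.
right; exists z0 => //; apply/seteqP; split=> z /=.
  by move=> [_]; rewrite -z0i => /(pcan_inj pickleK).
move=> zz0; rewrite zz0; split=> //; exact: sE Ez0.
Qed.

Lemma measurable_piece n E i : saturated n E ->
  measurable [set z : plane | E z /\ pickle (cell n z) = i].
Proof.
move=> /(saturated_piece i)[->//|[z0 _ ->]]; exact: measurable_cell.
Qed.

Lemma saturated_measurable n E : saturated n E -> measurable E.
Proof.
move=> sE; rewrite (saturated_bigcup sE).
by apply: bigcupT_measurable => i; exact: measurable_piece.
Qed.

Lemma saturated_le n E (sigma : {measure set plane -> \bar R}) (kappa : R) :
  0 <= kappa -> saturated n E ->
  (forall z0, E z0 -> (sigma [set z | cell n z = cell n z0] <= (kappa * (2 ^- n) ^+ 2)%:E)%E) ->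
  (sigma E <= kappa%:E * lebesgue2 E)%E.
Proof.
move=> kap0 sE le_cell; rewrite (saturated_bigcup sE).
have mp i := measurable_piece i sE.
have tp : trivIset setT (fun i => [set z | E z /\ pickle (cell n z) = i]).
  apply/trivIsetP => i j _ _ ij; rewrite -subset0 => z [[_ zi] [_ zj]].
  by move: ij; rewrite -zi -zj eqxx.
rewrite !measure_bigcup//; [|by move=> i _; exact: mp..].
rewrite -nneseriesZl; last by move=> i _; exact: measure_ge0.
apply: lee_nneseries => // i _.
have [->|[z0 Ez0 ->]] := saturated_piece i sE.
  by rewrite !measure0 mule0.
apply: (le_trans (le_cell _ Ez0)).
by rewrite EFinM -(lebesgue2_cell n (cell n z0)).
Qed.

Local Notation sdiff A B := ((A `\` B) `|` (B `\` A)).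

Definition approximable (tau : {measure set plane -> \bar R}) (B : set plane) :=
  measurable B /\ forall e : R, 0 < e -> exists n E,
    saturated n E /\ (tau (sdiff B E) <= e%:E)%E.

Section Approximation.
Variable tau : {measure set plane -> \bar R}.
Hypothesis tau_fin : (tau setT < +oo)%E.

Lemma approximable_saturated n E : saturated n E -> approximable tau E.
Proof.
move=> sE; split; first exact: saturated_measurable sE.
move=> e e0; exists n, E; split=> //.
by rewrite setDv setU0 measure0 lee_fin ltW.
Qed.

Lemma approximableC B : approximable tau B -> approximable tau (~` B).
Proof.
move=> [mB HB]; split=> [|e e0]; first exact: measurableC.
have [n [E [sE BE]]] := HB e e0; exists n, (~` E); split.
  by move=> z z' zz' nEz Ez'; apply: nEz; apply: sE Ez'.
rewrite (_ : sdiff _ _ = sdiff B E)//.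
by rewrite !setDE !setCK setUC; congr (_ `|` _); rewrite setIC.
Qed.

Lemma approximableU A B : approximable tau A -> approximable tau B ->
  approximable tau (A `|` B).
Proof.
move=> [mA HA] [mB HB]; split=> [|e e0]; first exact: measurableU.
have e20 : 0 < e / 2 by rewrite divr_gt0.
have [n [E [sE AE]]] := HA _ e20; have [m [F [sF BF]]] := HB _ e20.
have sE' := saturated_mono (leq_maxl n m) sE.
have sF' := saturated_mono (leq_maxr n m) sF.
have mE := saturated_measurable sE; have mF := saturated_measurable sF.
exists (maxn n m), (E `|` F); split.
  by move=> z z' zz' [Ez|Fz]; [left; exact: sE' Ez|right; exact: sF' Fz].
have msd C D : measurable C -> measurable D -> measurable (sdiff C D : set plane).
  by move=> mC mD; apply: measurableU; exact: measurableD.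
apply: (@le_trans _ _ (tau (sdiff A E `|` sdiff B F))).
  apply: le_measure; rewrite ?inE.
  - by apply: msd; exact: measurableU.
  - by apply: measurableU; exact: msd.
  - by move=> z; rewrite /setU /setD /=; tauto.
apply: (le_trans (measureU2 tau (msd _ _ mA mE) (msd _ _ mB mF))).
by rewrite [e]splitr EFinD; apply: leeD.
Qed.

Lemma approximable_bigcup (B : nat -> set plane) :
  (forall i, approximable tau (B i)) -> approximable tau (\bigcup_i B i).
Proof.
move=> HB; have mB i := (HB i).1.
have mUB : measurable (\bigcup_i B i) by exact: bigcupT_measurable.
split=> // e e0; have e20 : 0 < e / 2 by rewrite divr_gt0.
pose U n := \big[setU/set0]_(i < n) B i.
have aU n : approximable tau (U n).
  elim: n => [|n IH]; rewrite /U ?big_ord0 ?big_ord_recr/=.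
    by apply: (@approximable_saturated 0) => z z' _ [].
  exact: approximableU.
have mU n := (aU n).1.
pose F n := (\bigcup_i B i) `\` U n.
have mF n : measurable (F n) by exact: measurableD.
have finF n : (tau (F n) < +oo)%E.
  by apply: le_lt_trans tau_fin; apply: le_measure; rewrite ?inE.
have capF : \bigcap_n F n = set0.
  rewrite -subset0 => z capz; have [[i _ Biz] _] := capz 0%N I.
  have [_] := capz i.+1 I; apply; rewrite /U big_ord_recr/=; by right.
have niF : nonincreasing_seq F.
  apply/nonincreasing_seqP => n; rewrite subsetEset /F /U big_ord_recr/=.
  by apply: setDS => z; left.
have cF : tau \o F @ \oo --> (0 : \bar R)%E.
  rewrite -(measure0 tau) -capF; apply: nonincreasing_cvg_mu => //.
  by rewrite capF.
have [n Fn] : exists n, (tau (F n) <= (e / 2)%:E)%E.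
  have cF' : fine \o (tau \o F) @ \oo --> (0 : R) by exact: fine_cvg.
  move/cvgrPdist_le : cF' => /(_ _ e20)[n _ Hn].
  exists n; have := Hn n (leqnn n); rewrite /= sub0r normrN => h.
  rewrite -[tau (F n)]fineK ?ge0_fin_numE// lee_fin.
  exact: le_trans (ler_norm _) h.
have [_ /(_ _ e20)[m [E [sE UE]]]] := aU n.
have mE := saturated_measurable sE.
exists m, E; split=> //.
have mS : measurable (sdiff (U n) E) by apply: measurableU; exact: measurableD.
apply: (@le_trans _ _ (tau (F n `|` sdiff (U n) E))).
  apply: le_measure; rewrite ?inE.
  - by apply: measurableU; exact: measurableD.
  - exact: measurableU.
  - move=> z [[Bz nEz]|[Ez nBz]].
      by have [Uz|Uz] := pselect (U n z); [right; left|left; split].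
    right; right; split=> // Uz; apply: nBz; move: Uz; rewrite /U.
    by rewrite -bigcup_mkord => -[i _ Bi]; exists i.
apply: (le_trans (measureU2 tau (mF n) mS)).
by rewrite [e]splitr EFinD; apply: leeD.
Qed.

Lemma approximable_sigma_algebra : sigma_algebra setT (approximable tau).
Proof.
split.
- by apply: (@approximable_saturated 0) => z z' _ [].
- by move=> A aA; rewrite setTD; exact: approximableC.
- by move=> A aA; exact: approximable_bigcup.
Qed.

Lemma approximable_preimage (pr : plane -> R) :
  (forall n z z', cell n z = cell n z' -> scale n (pr z) = scale n (pr z')) ->
  measurable_fun setT pr ->
  forall A : set R, measurable A -> approximable tau (pr @^-1` A).
Proof.
move=> pr_cell mpr A mA0.
have mA : (@RGenOInfty.G R).-sigma.-measurable A by rewrite -RGenOInfty.measurableE; exact: mA0.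
pose Q := [set A | approximable tau (pr @^-1` A)].
suff : Q A by [].
move: A mA {mA0}; apply: smallest_sub.
  have [a0 aC aU] := approximable_sigma_algebra; split.
  - by rewrite /Q/= preimage_set0.
  - move=> A /aC; rewrite /Q/= !setTD; exact.
  - by move=> A /aU; rewrite /Q/= preimage_bigcup.
move=> _ [x ->]; rewrite /Q/=.
rewrite (_ : pr @^-1` _ = \bigcup_n [set z | scale n x < scale n (pr z)]).
  apply: approximable_bigcup => n; apply: (@approximable_saturated n) => z z' zz' /=.
  by rewrite (pr_cell n z z').
apply/seteqP; split=> z /=; rewrite in_itv/= andbT; last first.
  move=> [n _ /= xn]; rewrite ltNge; apply/negP => zx.
  move: xn; rewrite ltNge; apply/negP/negPn.
  rewrite /scale floor_ge_int; have /andP[+ _] := scale_bounds n (pr z).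
  by move=> /le_trans; apply; rewrite ler_wpM2l// exprn_ge0.
move=> xz; pose del := pr z - x; have del0 : 0 < del by rewrite subr_gt0.
pose n := (Num.truncn (del^-1)).+1.
exists n => //=; rewrite -lezD1 /scale floor_ge_int intrD.
have nd : 1 <= 2 ^+ n * del.
  rewrite -ler_pdivrMr// mul1r; apply: (@le_trans _ _ n%:R).
    exact/ltW/truncnS_gt.
  by rewrite -natrX ler_nat ltnW// ltn_expl.
have /andP[+ _] := scale_bounds n x.
by rewrite /del mulrBr in nd; rewrite /scale; lra.
Qed.

(** Dyadic figures generate the Borel sets, and being approximated in mass by
them is stable under complements and countable unions. *)
Lemma measurable_approximable (B : set plane) : measurable B -> approximable tau B.
Proof.
move: B; apply: smallest_sub; first exact: approximable_sigma_algebra.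
move=> B [[A mA <-]|[A mA <-]]; rewrite setTI.
  by apply: approximable_preimage => // n z z' [].
by apply: approximable_preimage => // n z z' [].
Qed.

End Approximation.

End Dyadic.

(** * Absence of a singular part *)

Section Singular.
Context {R : realType}.
Local Notation plane := (measurableTypeR R * measurableTypeR R)%type.
Local Notation lebesgue2 := ((@lebesgue_measure R) \x (@lebesgue_measure R))%E.

Definition diamond (z0 : plane) (del : R) : set plane :=
  [set z | `|z.1 + z.2 - (z0.1 + z0.2)| <= del /\ `|z.1 - z.2 - (z0.1 - z0.2)| <= del].

Lemma diagonal_dist (x y x' y' e : R) : `|x - x'| <= e -> `|y - y'| <= e ->
  `|x + y - (x' + y')| <= 2 * e /\ `|x - y - (x' - y')| <= 2 * e.
Proof.
move=> hx hy; have -> : x + y - (x' + y') = (x - x') + (y - y') by ring.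
have -> : x - y - (x' - y') = (x - x') - (y - y') by ring.
rewrite mulr_natl mulr2n.
by split; [apply: (le_trans (ler_normD _ _))|apply: (le_trans (ler_normB _ _))];
  exact: lerD.
Qed.

Lemma measurable_diamond z0 del : measurable (diamond z0 del).
Proof.
have m1 : measurable_fun setT (fun z : plane => `|z.1 + z.2 - (z0.1 + z0.2)|).
  apply: measurableT_comp => //; apply: measurable_funB => //.
  exact: measurable_funD.
have m2 : measurable_fun setT (fun z : plane => `|z.1 - z.2 - (z0.1 - z0.2)|).
  apply: measurableT_comp => //; apply: measurable_funB => //.
  exact: measurable_funB.
rewrite (_ : diamond z0 del =
  (setT `&` (fun z : plane => `|z.1 + z.2 - (z0.1 + z0.2)|) @^-1` `]-oo, del]) `&`
  (setT `&` (fun z : plane => `|z.1 - z.2 - (z0.1 - z0.2)|) @^-1` `]-oo, del])); last first.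
  by rewrite !setTI; apply/seteqP; split=> z; rewrite /diamond /= !in_itv.
by apply: measurableI; [apply: m1|apply: m2].
Qed.

(** A measure that gives small squares a mass comparable to their area has no
singular part: the null set carrying the singular part is approximated by
dyadic figures of small area. *)
Lemma singular_no_mass (sigma : {measure set plane -> \bar R}) (A Q : set plane)
    (r kappa del1 : R) :
  (sigma setT < +oo)%E -> measurable A -> lebesgue2 A = 0%E ->
  sigma (~` A) = 0%E -> measurable Q ->
  (forall z, Q z -> `|z.1| <= r /\ `|z.2| <= r) ->
  0 < del1 -> 0 <= kappa ->
  (forall z0 del, Q z0 -> 0 < del -> del <= del1 ->
    (sigma (diamond z0 del) <= (kappa * del ^+ 2)%:E)%E) ->
  sigma Q = 0%E.
Proof.
move=> sfin mA A0 sA0 mQ Qr del10 kap0 sdiam.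
pose I1 : set R := `[-(r + 1), r + 1]%classic.
have mI1 : measurable I1 by exact: measurable_itv.
pose B1 : set plane := I1 `*` I1.
have mB1 : measurable B1 by exact: measurableX.
have fB1 : (lebesgue2 B1 < +oo)%E.
  rewrite product_measure1E//; apply: lte_mul_pinfty => //.
    by rewrite ge0_fin_numE//; exact: lebesgue_measure_itv_lty.
  exact: lebesgue_measure_itv_lty.
pose tau := measure_add sigma (mrestr lebesgue2 mB1).
have tauE S : tau S = (sigma S + lebesgue2 (S `&` B1))%E by exact: measure_addE.
have tfin : (tau setT < +oo)%E.
  by rewrite tauE setTI; apply: lte_add_pinfty.
apply/eqP; rewrite eq_le measure_ge0 andbT; apply/lee_addgt0Pr => e e0.
rewrite add0e.
pose e' := e / (1 + 4 * kappa).
have k1 : 0 < 1 + 4 * kappa by rewrite ltr_pwDl// mulr_ge0.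
have e'0 : 0 < e' by rewrite divr_gt0.
have mAQ : measurable (A `&` Q) by exact: measurableI.
have [_ /(_ e' e'0)[n0 [E [sE AE]]]] := measurable_approximable tfin mAQ.
pose S : set plane := A `&` Q `\` E `|` E `\` A `&` Q.
have {}AE : (sigma S + lebesgue2 (S `&` B1) <= e'%:E)%E by rewrite -(tauE S).
pose n := maxn n0 (Num.truncn (2 / del1)).+1.
have {}sE : saturated n E by apply: saturated_mono sE; exact: leq_maxl.
have n2 : 0 < 2 ^+ n :> R by rewrite exprn_gt0.
have nd : 2 * 2 ^- n <= del1.
  rewrite ler_pdivrMr// mulrC -ler_pdivrMr//.
  apply: (@le_trans _ _ n%:R); last by rewrite -natrX ler_nat ltnW// ltn_expl.
  apply: ltW; apply: (lt_le_trans (truncnS_gt _)).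
  by rewrite ler_nat leq_maxr.
have nd1 : 2 ^- n <= 1 :> R by rewrite invf_le1// exprn_ege1// ler1n.
pose E' := [set z | E z /\ exists2 z', Q z' & cell n z = cell n z'].
have sE' : saturated n E'.
  move=> z z' zz' [Ez [q Qq zq]]; split; first exact: sE Ez.
  by exists q => //; rewrite -zz'.
have mE := saturated_measurable sE; have mE' := saturated_measurable sE'.
have E'B1 : E' `<=` B1.
  move=> z [_ [q /Qr[q1 q2] [c1 c2]]].
  have near1 (a b : R) : `|b| <= r -> `|a - b| <= 2 ^- n -> `|a| <= r + 1.
    move=> br ab; rewrite -(subrK b a) addrC; apply: le_trans (ler_normD _ _) _.
    by apply: lerD => //; exact: le_trans nd1.
  rewrite /B1/I1 /= !in_itv/= -!ler_norml.
  by split; [apply: near1 q1 _|apply: near1 q2 _]; rewrite scale_dist.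
have le_sE' : (sigma E' <= (4 * kappa)%:E * lebesgue2 E')%E.
  apply: saturated_le sE' _ => [|z0 [_ [q Qq zq]]]; first exact: mulr_ge0.
  have -> : 4 * kappa * (2 ^- n) ^+ 2 = kappa * (2 * 2 ^- n) ^+ 2 by ring.
  apply: le_trans (sdiam q _ Qq _ nd); last by rewrite mulr_gt0// invr_gt0.
  apply: le_measure; rewrite ?inE.
  - exact: measurable_cell.
  - exact: measurable_diamond.
  - by move=> z /=; rewrite zq => -[/scale_dist c1 /scale_dist c2]; exact: diagonal_dist.
have le_area : (lebesgue2 E' <= e'%:E)%E.
  apply: (@le_trans _ _ (lebesgue2 ((E `\` (A `&` Q)) `&` B1 `|` A))).
    apply: le_measure; rewrite ?inE => //.
      by apply: measurableU => //; apply: measurableI => //; exact: measurableD.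
    move=> z E'z; have [Az|nAz] := pselect (A z); first by right.
    left; split; last exact: E'B1.
    by split; [exact: E'z.1|case].
  apply: (le_trans (measureU2 lebesgue2 _ mA)).
    by apply: measurableI => //; exact: measurableD.
  rewrite [X in (_ + X)%E](_ : _ = 0%E); last exact: A0.
  rewrite adde0; apply: le_trans AE.
  apply: (@le_trans _ _ (0 + lebesgue2 (S `&` B1))%E).
    rewrite add0e; apply: le_measure; rewrite ?inE.
    - by apply: measurableI => //; exact: measurableD.
    - by apply: measurableI => //; apply: measurableU; exact: measurableD.
    - by apply: setSI; right.
  by apply: leeD => //; exact: measure_ge0.
apply: (@le_trans _ _ (sigma (~` A `|` ((A `&` Q `\` E) `|` E')))).
  apply: le_measure; rewrite ?inE => //.
    apply: measurableU; first exact: measurableC.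
    by apply: measurableU => //; exact: measurableD.
  move=> z Qz; have [Az|nAz] := pselect (A z); last by left.
  have [Ez|nEz] := pselect (E z); last by right; left.
  by right; right; split=> //; exists z.
have mD : measurable (A `&` Q `\` E : set plane) by exact: measurableD.
apply: (le_trans (measureU2 sigma (measurableC mA) (measurableU _ _ mD mE'))).
rewrite [X in (X + _)%E](_ : _ = 0%E); last exact: sA0.
rewrite add0e; apply: (le_trans (measureU2 sigma mD mE')).
have -> : e%:E = (e'%:E + (4 * kappa)%:E * e'%:E)%E.
  rewrite -EFinM -EFinD; congr EFin.
  by rewrite /e'; field; rewrite gt_eqF.
apply: leeD.
  apply: le_trans AE.
  apply: (@le_trans _ _ (sigma S)); last by rewrite leeDl// measure_ge0.
  apply: le_measure; rewrite ?inE => //; last by move=> z; left.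
  by apply: measurableU => //; exact: measurableD.
apply: (le_trans le_sE'); apply: lee_wpmul2l => //.
by rewrite lee_fin mulr_ge0.
Qed.

End Singular.

(** * Integration against a density *)

Section Density.
Context {d : measure_display} {T : measurableType d} {R : realType}.
Variables (m mu : {measure set T -> \bar R}) (f : T -> R) (Q : set T).
Hypotheses (mQ : measurable Q) (mf : measurable_fun Q f).
Hypothesis f_ge0 : forall x, 0 <= f x.
Hypothesis densE : forall B, measurable B -> B `<=` Q ->
  m B = (\int[mu]_(x in B) (f x)%:E)%E.

Import HBNNSimple.

Let density_nnsfun (h : {nnsfun T >-> R}) :
  (\int[m]_(x in Q) (h x)%:E = \int[mu]_(x in Q) ((h x)%:E * (f x)%:E))%E.
Proof.
have mind r : measurable_fun Q (\1_(h @^-1` [set r]) : T -> R).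
  by apply: measurable_funTS; exact: measurable_indic.
under [LHS]eq_integral do rewrite fimfunE -fsumEFin//.
rewrite [LHS]ge0_integral_fsum//; last 2 first.
  - move=> r; apply/measurable_EFinP; exact: measurable_funM.
  - by move=> n x _; rewrite EFinM nnfun_muleindic_ge0.
under [RHS]eq_integral.
  move=> x xD; rewrite fimfunE -fsumEFin// muleC ge0_mule_fsumr; last first.
    by move=> r; rewrite EFinM nnfun_muleindic_ge0.
  over.
rewrite [RHS]ge0_integral_fsum//; last 2 first.
  - move=> r; apply/measurable_EFinP; apply: measurable_funM => //.
    exact: measurable_funM.
  - move=> n x _; apply: mule_ge0; first by rewrite lee_fin.
    by rewrite EFinM nnfun_muleindic_ge0.
apply: eq_fsbigr => r _.
pose A := h @^-1` [set r].
have mA : measurable A by exact: measurable_funPTI.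
have mAQ : measurable (A `&` Q) by exact: measurableI.
under eq_integral do rewrite EFinM.
rewrite integralZl_indic_nnsfun//= integral_indic//= densE//.
have [r0|r0] := ltP r 0.
  rewrite (_ : h @^-1` [set r] = set0); last first.
    rewrite -subset0 => x /= hxr; move: r0; rewrite -hxr ltNge.
    by rewrite fun_ge0.
  rewrite set0I integral_set0 mule0 integral0_eq// => x _.
  by rewrite indic0 mulr0 mule0.
rewrite -ge0_integralZl//; last 2 first.
- by apply/measurable_EFinP; apply: measurable_funS mf => //; exact: subIsetr.
- by move=> x _; rewrite lee_fin.
rewrite setIC integral_mkcondr; apply: eq_integral => x xQ.
rewrite patchE /indic; case: ifPn => [|] xA.
  by rewrite mulr1 -!EFinM mulrC.
by rewrite mulr0 mule0.
Qed.

(** The density is only known inside [Q], where the measure may be a part of a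
law with a singular component elsewhere. *)
Lemma integral_density (phi : T -> \bar R) : measurable_fun Q phi ->
  (forall x, Q x -> 0 <= phi x)%E ->
  (\int[m]_(x in Q) phi x = \int[mu]_(x in Q) (phi x * (f x)%:E))%E.
Proof.
move=> mphi phi0.
pose h := nnsfun_approx mQ mphi.
transitivity (lim (\int[m]_(x in Q) (h n x)%:E @[n --> \oo])%E).
  rewrite -monotone_convergence//=.
  - apply: eq_integral => x /[!inE] xQ; apply/esym/cvg_lim => //=.
    exact: cvg_nnsfun_approx.
  - by move=> n; exact/measurable_EFinP/measurable_funTS.
  - by move=> n x _; rewrite lee_fin.
  - by move=> x _ a b ab; rewrite lee_fin; exact/lefP/nd_nnsfun_approx.
transitivity (lim (\int[mu]_(x in Q) ((h n x)%:E * (f x)%:E) @[n --> \oo])%E).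
  by apply: congr_lim; apply/funext => n; exact: density_nnsfun.
rewrite -monotone_convergence//=.
- apply: eq_integral => x /[!inE] xQ; apply/cvg_lim => //=.
  have hphi : (h n x)%:E @[n --> \oo] --> phi x by exact: cvg_nnsfun_approx.
  by apply: cvgeZr.
- move=> n; apply/measurable_EFinP; apply: measurable_funM => //.
  exact/measurable_funTS.
- by move=> n x _; rewrite mule_ge0 ?lee_fin.
- move=> x _ a b ab; apply: lee_wpmul2r; first by rewrite lee_fin.
  by rewrite lee_fin; exact/lefP/nd_nnsfun_approx.
Qed.

End Density.

(** * The law of the position near a point *)

Definition box {R : realType} (x y e : R) :
    set (measurableTypeR R * measurableTypeR R) :=
  [set z | `|z.1 - x| <= e /\ `|z.2 - y| <= e].

Lemma boxE {R : realType} (x y e : R) :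
  box x y e = `[x - e, x + e]%classic `*` `[y - e, y + e]%classic.
Proof. by apply/seteqP; split=> z; rewrite /box /= !in_itv/= !ler_distl. Qed.

Lemma measurable_box {R : realType} (x y e : R) : measurable (box x y e).
Proof. by rewrite boxE; apply: measurableX; exact: measurable_itv. Qed.

Section LocalDensity.
Context {R : realType} {d : measure_display} {T : measurableType d}.
Context (P : probability T R) (c : R) (lambda : R -> R).
Context (N : R -> T -> nat) (k0 : T -> 'Z_4) (turn : nat -> T -> bool).
Context (X Y : R -> T -> R) (p : R * R * R -> R).
Hypothesis c_gt0 : 0 < c.
Hypothesis lambda_ge0 : forall t : R, 0 < t -> 0 <= lambda t.
Hypothesis lambda_cont : forall t : R, 0 < t -> {for t, continuous lambda}.
Hypothesis motion : driven_motion P c lambda N k0 turn X Y.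
Hypothesis density : forall t : R, 0 <= t ->
  ac_component_density (fun B => P [set w | B (X t w, Y t w)])
    (fun xy => p (xy, t)).
Local Notation D := (direction N k0 turn).
Local Notation plane := (measurableTypeR R * measurableTypeR R)%type.
Local Notation lebesgue2 := ((@lebesgue_measure R) \x (@lebesgue_measure R))%E.

Lemma position_in_square t w : 0 <= t ->
  `|X t w + Y t w| <= c * t /\ `|X t w - Y t w| <= c * t.
Proof.
move=> t0; rewrite (XE motion)// (YE motion)// -mulrDr -mulrBr.
rewrite !normrM gtr0_norm// !ler_pM2l//.
have int v : (forall k, `|v k| <= 1) ->
    lebesgue_measure.-integrable `[0, t] (EFin \o (fun s => v (D s w) : R)).
  move=> v1; exact: (@integrable_counting_path R (N^~ w)
    (fun n => v (k0 w + \sum_(i < n) (if turn i w then 1 else -1)))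
    (N_ndecr motion w) (fun=> v1 _)).
rewrite -(RintegralD _ (int _ dirx_le1) (int _ diry_le1))//.
rewrite -(RintegralB _ (int _ dirx_le1) (int _ diry_le1))//.
have sgn1 b : `|sgn b : R| <= 1 by rewrite /sgn; case: b; rewrite ?normrN1 ?normr1.
have u1 k : `|dirx k + diry k : R| <= 1 by rewrite dir_u.
have v1 k : `|dirx k - diry k : R| <= 1 by rewrite dir_v.
have := path_lip motion w u1 (lexx 0) t0; have := path_lip motion w v1 (lexx 0) t0.
by rewrite set_itv1 !Rintegral_set1 !subr0.
Qed.

Lemma measurable_position t : 0 <= t ->
  measurable_fun setT (fun w => (X t w, Y t w) : plane).
Proof.
move=> t0; apply: measurable_fun_pair.
  exact: (measurable_X c_gt0 motion t0).
exact: (measurable_Y c_gt0 motion t0).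
Qed.

(** Off the boundary of the square [|x| + |y| <= c t] the law of the position
has no singular part: inside by the bound on the mass of small squares, outside
because there is no mass at all. *)
Lemma law_near (x y t : R) : 0 < t -> Num.max `|x + y| `|x - y| != c * t ->
  exists e : R, [/\ 0 < e, e < t &
    forall t' : R, `|t' - t| <= e -> forall B, measurable B -> B `<=` box x y e ->
    P [set w | B (X t' w, Y t' w)] = (\int[lebesgue2]_(z in B) (p (z, t'))%:E)%E].
Proof.
move=> t0 mt; have c00 := c_gt0.
pose m := Num.max `|x + y| `|x - y|.
have m0 : 0 <= m by rewrite le_max normr_ge0.
have um : `|x + y| <= m by rewrite le_max lexx.
have vm : `|x - y| <= m by rewrite le_max lexx orbT.
pose e := Num.min (t / 2) (`|c * t - m| / (2 * (2 + c))).
have c2 : 0 < 2 * (2 + c) by lra.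
have e0 : 0 < e.
  rewrite lt_min divr_gt0// divr_gt0//.
  by rewrite normr_gt0 subr_eq0 eq_sym.
have et : e <= t / 2 by rewrite ge_min lexx.
have ed : 2 * (2 + c) * e <= `|c * t - m|.
  have : e <= `|c * t - m| / (2 * (2 + c)) by rewrite ge_min lexx orbT.
  by rewrite ler_pdivlMr// mulrC.
exists e; split=> //; first by lra.
move=> t' tt' B mB Be.
have t'0 : 0 < t' by move: tt'; rewrite ler_distl => /andP[? ?]; lra.
have ct' : `|c * t' - c * t| <= c * e by rewrite -mulrBr normrM gtr0_norm// ler_pM2l.
have [mf f0 [sigma [[A [mA A0 sA]] law]]] := density (ltW t'0).
have le_law S : measurable S -> (sigma S <= P [set w | S (X t' w, Y t' w)])%E.
  move=> mS; rewrite law// leeDr// integral_ge0// => z _.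
  by rewrite lee_fin.
have mpos S : measurable S -> measurable [set w | S (X t' w, Y t' w)].
  by move=> mS; rewrite -[X in measurable X]setTI; exact: measurable_position (ltW t'0) _ S mS.
suff sB : sigma (box x y e) = 0%E.
  rewrite law// [X in (_ + X)%E](_ : _ = 0%E) ?adde0//.
  apply/eqP; rewrite eq_le measure_ge0 andbT -sB; apply: le_measure => //.
    by rewrite inE.
  by rewrite inE; exact: measurable_box.
have cases z : box x y e z -> [/\ `|z.1 + z.2 - (x + y)| <= 2 * e,
    `|z.1 - z.2 - (x - y)| <= 2 * e, `|z.1| <= `|x| + e & `|z.2| <= `|y| + e].
  rewrite /box/= => -[hx hy].
  have near_le (u v : R) : `|u - v| <= e -> `|u| <= `|v| + e.
    move=> uv; rewrite -{1}(subrK v u) addrC.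
    by apply: le_trans (ler_normD _ _) _; rewrite lerD2l.
  by have [h1 h2] := diagonal_dist hx hy; split=> //; exact: near_le.
have [mc|mc] := ltP m (c * t).
  have bct : m + 2 * e < c * t'.
    have dE : `|c * t - m| = c * t - m by rewrite ger0_norm// subr_ge0 ltW.
    rewrite dE in ed; move: ct'; rewrite ler_norml => /andP[? ?]; lra.
  have b0 : 0 <= m + 2 * e by rewrite addr_ge0// mulr_ge0// ltW.
  have [kappa Hk] := box_bound c_gt0 lambda_ge0 lambda_cont motion t'0 b0 bct.
  apply: (@singular_no_mass R sigma A (box x y e) (Num.max (`|x| + e) (`|y| + e))
    (Num.max kappa 0) ((c * t' - (m + 2 * e)) / 4)) => //.
  - apply: (le_lt_trans (le_law _ measurableT)).
    by apply: le_lt_trans (probability_le1 P _) _; [exact: mpos|rewrite ltry].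
  - exact: measurable_box.
  - by move=> z /cases[_ _ h1 h2]; rewrite !le_max h1 h2 orbT.
  - by rewrite divr_gt0// subr_gt0.
  - by rewrite le_max lexx orbT.
  - move=> z0 del /cases[h1 h2 _ _] del0 del1.
    apply: (le_trans (le_law _ (measurable_diamond _ _))).
    apply: (@le_trans _ _ (kappa * del ^+ 2)%:E); last first.
      by rewrite lee_fin ler_wpM2r ?sqr_ge0// le_max lexx.
    apply: Hk => //.
      have := ler_normD (z0.1 + z0.2 - (x + y)) (x + y); rewrite subrK; lra.
    have := ler_normD (z0.1 - z0.2 - (x - y)) (x - y); rewrite subrK; lra.
apply/eqP; rewrite eq_le measure_ge0 andbT.
apply: (le_trans (le_law _ (measurable_box _ _ _))).
rewrite (_ : [set w | _] = set0) ?measure0//.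
rewrite -subset0 => w /cases/= [h1 h2 _ _].
have [q1 q2] := position_in_square w (ltW t'0).
have dE : `|c * t - m| = m - c * t by rewrite ler0_norm ?opprB// subr_le0.
rewrite dE in ed.
have : m <= c * t' + 2 * e.
  rewrite ge_max; apply/andP; split.
    have := ler_normD (x + y - (X t' w + Y t' w)) (X t' w + Y t' w).
    by rewrite subrK; rewrite distrC in h1; lra.
  have := ler_normD (x - y - (X t' w - Y t' w)) (X t' w - Y t' w).
  by rewrite subrK; rewrite distrC in h2; lra.
by move: ct'; rewrite ler_norml => /andP[? ?] ?; lra.
Qed.

(** Bounded test functions supported in the box only see the density. *)
Lemma mean_local (x y e t : R) (K : R) (phi : R -> R -> R) : 0 <= t ->
  (forall B, measurable B -> B `<=` box x y e ->
    P [set w | B (X t w, Y t w)] = (\int[lebesgue2]_(z in B) (p (z, t))%:E)%E) ->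
  measurable_fun setT (fun z : plane => phi z.1 z.2) ->
  (forall a b, `|phi a b| <= K) ->
  (forall z, ~ box x y e z -> phi z.1 z.2 = 0) ->
  lebesgue2.-integrable (box x y e) (fun z => (p (z, t))%:E) /\
  mean P N k0 turn X Y (fun a b _ => phi a b) t =
  \int[lebesgue2]_(z in box x y e) (phi z.1 z.2 * p (z, t)).
Proof.
move=> t0 law mphi phiK phi0.
have [mf f0 _] := density t0.
have mpos := measurable_position t0.
have mQ := measurable_box x y e.
pose Q := (fun w => (X t w, Y t w)) @^-1` box x y e.
have mQ' : measurable Q by rewrite -[Q]setTI; exact: mpos.
have K0 : 0 <= K by exact: le_trans (phiK 0 0).
pose Zmixin := isMeasurableFun.Build _ _ _ _ _ mpos.
pose Z : {mfun T >-> plane} := HB.pack (fun w => (X t w, Y t w) : plane) Zmixin.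
have transfer (psi : plane -> R) : measurable_fun setT psi -> (forall z : plane, 0 <= psi z) ->
    (\int[P]_(w in Q) (psi (X t w, Y t w))%:E =
     \int[lebesgue2]_(z in box x y e) (psi z * p (z, t))%:E)%E.
  move=> mpsi psi0.
  have mpsi' : measurable_fun (box x y e) (fun z => (psi z)%:E).
    exact/measurable_EFinP/measurable_funTS.
  have psi0' : {in box x y e, forall z, (0 <= (psi z)%:E)%E}.
    by move=> z _; rewrite lee_fin.
  have := @integral_density _ _ R (pushforward P Z) lebesgue2
    (fun z => p (z, t)) (box x y e) mQ (measurable_funTS mf) f0 law
    (fun z => (psi z)%:E) mpsi' (fun z _ => ltac:(by rewrite lee_fin)).
  have := ge0_integral_pushforward mpos P mQ mpsi' psi0' => /= -> ->//.
have ip : lebesgue2.-integrable (box x y e) (fun z => (p (z, t))%:E).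
  apply/integrableP; split; first exact/measurable_EFinP/measurable_funTS.
  under eq_integral do rewrite gee0_abs ?lee_fin//.
  rewrite -law//; apply: (le_lt_trans (probability_le1 P _)); last by rewrite ltry.
  exact: mQ'.
split=> //.
have iphi (psi : plane -> R) (C : R) : measurable_fun setT psi -> (forall z : plane, `|psi z| <= C) ->
    lebesgue2.-integrable (box x y e) (EFin \o (fun z => psi z * p (z, t))).
  move=> mpsi psiC.
  have C0 : 0 <= C by exact: le_trans (psiC (0, 0)).
  apply: (le_integrable _ _ _ (integrableZl _ C ip)) => //.
    by apply/measurable_EFinP/measurable_funM; exact/measurable_funTS.
  move=> z _; rewrite /= lee_fin !normrM (ger0_norm C0).
  by rewrite ler_wpM2r.
have mphiX : measurable_fun setT (fun w => phi (X t w) (Y t w)).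
  exact: (measurableT_comp mphi mpos).
rewrite /mean.
rewrite (_ : (fun w => phi (X t w) (Y t w)) = (fun w => phi (X t w) (Y t w)) \_ Q); last first.
  apply/funext => w; rewrite patchE; case: ifPn => // /negP wQ.
  by apply: (phi0 (X t w, Y t w)) => wb; apply: wQ; rewrite inE.
rewrite -Rintegral_mkcond.
have iP (f : T -> R) (C : R) : measurable_fun setT f -> (forall w, `|f w| <= C) -> P.-integrable Q (EFin \o f).
  by move=> mf' fC; exact: (bounded_prob_integrable P mQ' mf' fC).
transitivity (\int[P]_(w in Q) (phi (X t w) (Y t w) + K) - \int[P]_(w in Q) K).
  rewrite -RintegralB//; first by apply: eq_Rintegral => w _; rewrite addrK.
    apply: (iP (fun w => phi (X t w) (Y t w) + K) (K + K)).
      exact: measurable_funD.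
    by move=> w; apply: (le_trans (ler_normD _ _)); rewrite lerD// ger0_norm.
  by apply: (iP (cst K) K) => // w; rewrite /= ger0_norm.
have h1 := transfer (fun z => phi z.1 z.2 + K).
have h2 := transfer (cst K).
rewrite /Rintegral h1//; first last.
- by move=> z; have := phiK z.1 z.2; rewrite ler_norml => /andP[? _]; lra.
- exact: measurable_funD.
rewrite h2//.
rewrite -[RHS]/(Rintegral _ _ _).
transitivity (\int[lebesgue2]_(z in box x y e) ((phi z.1 z.2 + K) * p (z, t)) -
  \int[lebesgue2]_(z in box x y e) (cst K z * p (z, t))); first by [].
rewrite -RintegralB//.
- by apply: eq_Rintegral => z _ /=; ring.
- apply: (iphi (fun z => phi z.1 z.2 + K) (K + K)); first exact: measurable_funD.
  by move=> z; apply: (le_trans (ler_normD _ _)); rewrite lerD// ger0_norm.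
- by apply: (iphi (cst K) K) => // z; rewrite /= ger0_norm.
Qed.

End LocalDensity.

(** * The system of the directional means *)

(** The elimination uses means of derivatives up to the fourth order, which must
be Lipschitz: hence a bound on the fifth derivative. *)
Definition derivative_chain {R : realType} (a : nat -> R -> R) (K : R) : Prop :=
  (forall i x, (i <= 5)%N -> `|a i x| <= K) /\
  (forall i (x : R), (i <= 4)%N -> is_derive x 1 (a i) (a i.+1 x)).

Section DerivativeChain.
Context {R : realType} (a : nat -> R -> R) (K : R).
Hypothesis chain : derivative_chain a K.

Lemma chain_mvt i x y : (i <= 4)%N ->
  exists2 z, `|z - x| <= `|y - x| & a i y - a i x = a i.+1 z * (y - x).
Proof.
move=> i4; have da z := chain.2 i z i4.
have cont u v : {within `[u, v], continuous (a i)}.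
  by apply: derivable_within_continuous => z _; apply: ex_derive.
have [xy|yx|->] := ltgtP x y; last by exists y; rewrite ?subrr ?mulr0.
- have [z zxy ->] := MVT xy (fun z _ => da z) (cont x y); exists z => //.
  move: zxy; rewrite in_itv/= => /andP[? ?].
  by rewrite !ger0_norm ?subr_ge0 ?ltW//; lra.
- have [z zxy E] := MVT yx (fun z _ => da z) (cont y x); exists z; last first.
    by rewrite -opprB E -mulrN opprB.
  move: zxy; rewrite in_itv/= => /andP[? ?].
  by rewrite !ler0_norm ?subr_le0 ?ltW//; lra.
Qed.

Lemma chain_lip i x y : (i <= 4)%N -> `|a i x - a i y| <= K * `|x - y|.
Proof.
move=> i4; have [z _ ->] := chain_mvt y x i4.
by rewrite normrM ler_wpM2r// chain.1.
Qed.

Lemma chain_taylor i x u : (i <= 3)%N ->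
  `|a i (x + u) - a i x - u * a i.+1 x| <= K * u ^+ 2.
Proof.
move=> i3; have [z zx ->] := chain_mvt x (x + u) (leqW i3).
rewrite addrAC subrr add0r in zx *.
have -> : a i.+1 z * u - u * a i.+1 x = u * (a i.+1 z - a i.+1 x) by ring.
rewrite normrM.
have K0 : 0 <= K by exact: le_trans (chain.1 0 0 isT).
have l := chain_lip z x (i3 : (i.+1 <= 4)%N).
rewrite -real_normK ?num_real// expr2 mulrCA ler_wpM2l//.
by apply: (le_trans l); rewrite ler_wpM2l.
Qed.

End DerivativeChain.

Section WeakEquation.
Context {R : realType} {d : measure_display} {T : measurableType d}.
Context (P : probability T R) (c : R) (lambda : R -> R).
Context (N : R -> T -> nat) (k0 : T -> 'Z_4) (turn : nat -> T -> bool).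
Context (X Y : R -> T -> R).
Hypothesis c_gt0 : 0 < c.
Hypothesis lambda_ge0 : forall t : R, 0 < t -> 0 <= lambda t.
Hypothesis lambda_cont : forall t : R, 0 < t -> {for t, continuous lambda}.
Hypothesis motion : driven_motion P c lambda N k0 turn X Y.
Local Notation mean := (mean P N k0 turn X Y).
Variables (a b : nat -> R -> R) (K : R).
Hypotheses (chain_a : derivative_chain a K) (chain_b : derivative_chain b K).

(** Separated test functions: differentiating them only shifts the indices. *)
Definition tensor (om : 'Z_4 -> R) (i j : nat) (x y : R) (k : 'Z_4) : R :=
  om k * (a i x * b j y).

Let K0 : 0 <= K. Proof. exact: le_trans (chain_a.1 0 0 isT). Qed.

Lemma lipb_tensor (om : 'Z_4 -> R) i j : (forall k, `|om k| <= 1) -> (i <= 4)%N -> (j <= 4)%N ->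
  lipb (K * K) (K * K) (tensor om i j).
Proof.
move=> om1 i4 j4; have K00 := K0.
have prod_le x y : `|x| <= K -> `|y| <= K -> `|x * y| <= K * K.
  by move=> ? ?; rewrite normrM ler_pM.
split=> [x y k|x y x' y' k]; rewrite /tensor.
  rewrite normrM -[leRHS]mul1r ler_pM//.
  by apply: prod_le; [apply: chain_a.1|apply: chain_b.1]; exact: leqW.
rewrite -mulrBr normrM -[leRHS]mul1r ler_pM//.
have -> : a i x * b j y - a i x' * b j y' =
  (a i x - a i x') * b j y + a i x' * (b j y - b j y') by ring.
apply: (le_trans (ler_normD _ _)); rewrite [leRHS]mulrDr !normrM; apply: lerD.
  rewrite mulrAC; apply: ler_pM => //; first exact: (chain_lip chain_a).
  by apply: chain_b.1; exact: leqW.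
rewrite -mulrA; apply: ler_pM => //; last exact: (chain_lip chain_b).
by apply: chain_a.1; exact: leqW.
Qed.

Lemma mean_lin (om1 om2 : 'Z_4 -> R) (r1 r2 : R) i j i' j' (t : R) : 0 <= t ->
  (forall k, `|om1 k| <= 1) -> (forall k, `|om2 k| <= 1) ->
  (i <= 4)%N -> (j <= 4)%N -> (i' <= 4)%N -> (j' <= 4)%N ->
  mean (fun x y k => r1 * tensor om1 i j x y k + r2 * tensor om2 i' j' x y k) t =
  r1 * mean (tensor om1 i j) t + r2 * mean (tensor om2 i' j') t.
Proof.
move=> t0 o1 o2 i4 j4 i'4 j'4.
have l1 := lipb_tensor o1 i4 j4; have l2 := lipb_tensor o2 i'4 j'4.
rewrite (meanD c_gt0 motion t0 (lipbZ r1 l1) (lipbZ r2 l2)).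
by rewrite (meanZ c_gt0 motion r1 t0 l1) (meanZ c_gt0 motion r2 t0 l2).
Qed.

Lemma tensor_derive (om : 'Z_4 -> R) i j (t : R) : (forall k, `|om k| <= 1) ->
  (i <= 3)%N -> (j <= 3)%N -> 0 < t ->
  is_derive t 1 (mean (tensor om i j))
    (c * mean (tensor (fun k => om k * dirx k) i.+1 j) t +
     c * mean (tensor (fun k => om k * diry k) i j.+1) t +
     lambda t * mean (tensor (fun k => (om (k + 1) + om (k + -1)) / 2) i j) t
     - lambda t * mean (tensor om i j) t).
Proof.
move=> om1 i3 j3 t0; have K00 := K0; have t00 := ltW t0; have c0 := ltW c_gt0.
have i4 := leqW i3; have j4 := leqW j3.
have ox k : `|om k * dirx k| <= 1.
  by rewrite normrM -[leRHS]mulr1 ler_pM// dirx_le1.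
have oy k : `|om k * diry k| <= 1.
  by rewrite normrM -[leRHS]mulr1 ler_pM// diry_le1.
have l0 := lipb_tensor om1 i4 j4.
have lx := lipb_tensor ox (i3 : (i.+1 <= 4)%N) j4.
have ly := lipb_tensor oy i4 (j3 : (j.+1 <= 4)%N).
pose g x y k := c * tensor (fun k => om k * dirx k) i.+1 j x y k +
  c * tensor (fun k => om k * diry k) i j.+1 x y k.
have lg := lipbD (lipbZ c lx) (lipbZ c ly).
have taylor h x y k : 0 <= h ->
    `|flow c h (tensor om i j) x y k - tensor om i j x y k - h * g x y k|
      <= 3 * K ^+ 2 * c ^+ 2 * h ^+ 2.
  move=> h0; rewrite /flow /g /tensor.
  set u := c * h * dirx k; set v := c * h * diry k.
  have -> : om k * (a i (x + u) * b j (y + v)) - om k * (a i x * b j y) -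
      h * (c * (om k * dirx k * (a i.+1 x * b j y)) +
           c * (om k * diry k * (a i x * b j.+1 y))) =
    om k * ((a i (x + u) - a i x - u * a i.+1 x) * b j (y + v)
      + u * a i.+1 x * (b j (y + v) - b j y)
      + a i x * (b j (y + v) - b j y - v * b j.+1 y)).
    by rewrite /u /v; ring.
  have ch : 0 <= c * h by rewrite mulr_ge0.
  have uc : `|u| <= c * h.
    by rewrite /u normrM (ger0_norm ch) ler_piMr// dirx_le1.
  have vc : `|v| <= c * h.
    by rewrite /v normrM (ger0_norm ch) ler_piMr// diry_le1.
  have sq w : `|w| <= c * h -> w ^+ 2 <= (c * h) ^+ 2.
    by move=> wc; rewrite -real_normK ?num_real// lerXn2r// nnegrE.
  have e1 : `|(a i (x + u) - a i x - u * a i.+1 x) * b j (y + v)| <=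
      K * (c * h) ^+ 2 * K.
    rewrite normrM ler_pM//; last by apply: chain_b.1; exact: leqW.
    apply: (le_trans (chain_taylor chain_a x u i3)).
    by rewrite ler_wpM2l// sq.
  have e2 : `|u * a i.+1 x * (b j (y + v) - b j y)| <= (c * h) * K * (K * (c * h)).
    have e2' : `|u * a i.+1 x| <= c * h * K.
      by rewrite normrM; apply: ler_pM => //; apply: chain_a.1; exact: leqW.
    rewrite [leLHS]normrM; apply: ler_pM => //.
    apply: (le_trans (chain_lip chain_b _ _ j4)).
    by rewrite addrAC subrr add0r ler_wpM2l.
  have e3 : `|a i x * (b j (y + v) - b j y - v * b j.+1 y)| <= K * (K * (c * h) ^+ 2).
    rewrite normrM ler_pM//; first by apply: chain_a.1; exact: leqW.
    apply: (le_trans (chain_taylor chain_b y v j3)).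
    by rewrite ler_wpM2l// sq.
  rewrite normrM -[leRHS]mul1r ler_pM//.
  move: e1 e2 e3; rewrite !ler_norml => /andP[? ?] /andP[? ?] /andP[? ?].
  by apply/andP; split; lra.
have der := mean_derive c_gt0 lambda_ge0 motion t0 (lambda_cont t0) l0 lg taylor.
apply: is_derive_eq der _.
rewrite (mean_lin _ _ t00 ox oy (i3 : (i.+1 <= 4)%N) j4 i4 (j3 : (j.+1 <= 4)%N)).
have -> : mean (turned 1 (tensor om i j)) t + mean (turned (-1) (tensor om i j)) t =
    2 * mean (tensor (fun k => (om (k + 1) + om (k + -1)) / 2) i j) t.
  have o1 k : `|om (k + 1)| <= 1 by exact: om1.
  have om' k : `|om (k + -1)| <= 1 by exact: om1.
  have := mean_lin (2^-1) (2^-1) t00 o1 om' i4 j4 i4 j4.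
  have <- : tensor (fun k => (om (k + 1) + om (k + -1)) / 2) i j =
    (fun x y k => 2^-1 * tensor (fun k => om (k + 1)) i j x y k +
      2^-1 * tensor (fun k => om (k + -1)) i j x y k).
    by apply/funext => x; apply/funext => y; apply/funext => k; rewrite /tensor; ring.
  by move=> ->; rewrite /turned /tensor; field.
by field.
Qed.

(** The weights [1], [dirx], [diry] and [dirx ^ 2 - diry ^ 2] span the functions
of the direction. Averaged over the two neighbours of a direction, they are
multiplied by [1], [0], [0] and [-1] respectively, so that the switches act
diagonally on the four weighted means. *)
Definition weightA (k : 'Z_4) : R := 1.
Definition weightE (k : 'Z_4) : R := dirx k ^+ 2 - diry k ^+ 2.

Let dirE (k : 'Z_4) (F : R -> R -> Prop) :
  F 1 0 -> F 0 1 -> F (-1) 0 -> F 0 (-1) -> F (dirx k) (diry k).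
Proof.
move=> F0 F1 F2 F3; have [x0 x1 x2 x3] := @dirx_values R.
have [y0 y1 y2 y3] := @diry_values R.
by elim/Z4_ind: k; rewrite ?(x0, x1, x2, x3) ?(y0, y1, y2, y3).
Qed.

Lemma dir_turn k : dirx (k + 1) + dirx (k + -1) = 0 :> R /\
  diry (k + 1) + diry (k + -1) = 0 :> R /\
  weightE (k + 1) + weightE (k + -1) = - 2 * weightE k.
Proof.
have [x0 x1 x2 x3] := @dirx_values R; have [y0 y1 y2 y3] := @diry_values R.
have s01 : (0 : 'Z_4) + 1 = 1 by apply/eqP; vm_compute.
have s0m : (0 : 'Z_4) + -1 = 3%:R by apply/eqP; vm_compute.
have s11 : (1 : 'Z_4) + 1 = 2%:R by apply/eqP; vm_compute.
have s1m : (1 : 'Z_4) + -1 = 0 by apply/eqP; vm_compute.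
have s21 : (2%:R : 'Z_4) + 1 = 3%:R by apply/eqP; vm_compute.
have s2m : (2%:R : 'Z_4) + -1 = 1 by apply/eqP; vm_compute.
have s31 : (3%:R : 'Z_4) + 1 = 0 by apply/eqP; vm_compute.
have s3m : (3%:R : 'Z_4) + -1 = 2%:R by apply/eqP; vm_compute.
by elim/Z4_ind: k; rewrite /weightE ?(s01, s11, s21, s31) ?(s0m, s1m, s2m, s3m)
  ?(x0, x1, x2, x3) ?(y0, y1, y2, y3); split; [|split| |split| |split| |split]; ring.
Qed.

Local Notation MA i j := (mean (tensor weightA i j)).
Local Notation ME i j := (mean (tensor weightE i j)).
Local Notation MH i j := (mean (tensor dirx i j)).
Local Notation MV i j := (mean (tensor diry i j)).

Let weightE_le1 k : `|weightE k| <= 1.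
Proof.
rewrite /weightE; apply: (@dirE _ (fun x y => `|x ^+ 2 - y ^+ 2| <= 1));
  by rewrite ?sqrrN ?expr1n ?expr0n/= ?subr0 ?sub0r ?normrN1 ?normr1.
Qed.

Let eq_mean (om om' : 'Z_4 -> R) i j t : om =1 om' ->
  mean (tensor om i j) t = mean (tensor om' i j) t.
Proof. by move=> /funext ->. Qed.

Let mean_comb (om om1 om2 : 'Z_4 -> R) r1 r2 i j t : 0 <= t ->
  (forall k, `|om1 k| <= 1) -> (forall k, `|om2 k| <= 1) ->
  (i <= 4)%N -> (j <= 4)%N -> (forall k, om k = r1 * om1 k + r2 * om2 k) ->
  mean (tensor om i j) t =
  r1 * mean (tensor om1 i j) t + r2 * mean (tensor om2 i j) t.
Proof.
move=> t0 o1 o2 i4 j4 omE; rewrite -mean_lin//; congr (mean _ t).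
apply/funext => x; apply/funext => y; apply/funext => k.
by rewrite /tensor omE; ring.
Qed.

Let weightA_le1 k : `|weightA k| <= 1. Proof. by rewrite /weightA normr1. Qed.

Lemma MA_derive i j (t : R) : (i <= 3)%N -> (j <= 3)%N -> 0 < t ->
  is_derive t 1 (MA i j) (c * (MH i.+1 j t + MV i j.+1 t)).
Proof.
move=> i3 j3 t0; apply: is_derive_eq (tensor_derive weightA_le1 i3 j3 t0) _.
rewrite (@eq_mean (fun k => weightA k * dirx k) dirx); last by move=> k; exact: mul1r.
rewrite (@eq_mean (fun k => weightA k * diry k) diry); last by move=> k; exact: mul1r.
rewrite (@eq_mean (fun k => (weightA (k + 1) + weightA (k + -1)) / 2) weightA); last first.
  by move=> k; rewrite /weightA; field.
by ring.
Qed.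

Lemma ME_derive i j (t : R) : (i <= 3)%N -> (j <= 3)%N -> 0 < t ->
  is_derive t 1 (ME i j) (c * (MH i.+1 j t - MV i j.+1 t) - 2 * lambda t * ME i j t).
Proof.
move=> i3 j3 t0; apply: is_derive_eq (tensor_derive weightE_le1 i3 j3 t0) _.
rewrite (@eq_mean (fun k => weightE k * dirx k) dirx); last first.
  by move=> k; rewrite /weightE; apply: (@dirE _ (fun x y => (x ^+ 2 - y ^+ 2) * x = x)); ring.
rewrite (@mean_comb (fun k => weightE k * diry k) diry diry (-1) 0) ?(ltW t0)//; last first.
- by move=> k; rewrite /weightE;
    apply: (@dirE _ (fun x y => (x ^+ 2 - y ^+ 2) * y = -1 * y + 0 * y)); ring.
- exact: leqW.
- exact: diry_le1.
- exact: diry_le1.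
rewrite (@mean_comb (fun k => _ / 2) weightE weightE (-1) 0) ?(ltW t0)//; last first.
- by move=> k; rewrite (dir_turn k).2.2; field.
- exact: leqW.
- exact: leqW.
by ring.
Qed.

Lemma MH_derive i j (t : R) : (i <= 3)%N -> (j <= 3)%N -> 0 < t ->
  is_derive t 1 (MH i j) (c / 2 * (MA i.+1 j t + ME i.+1 j t) - lambda t * MH i j t).
Proof.
move=> i3 j3 t0; apply: is_derive_eq (tensor_derive dirx_le1 i3 j3 t0) _.
rewrite (@mean_comb (fun k => dirx k * dirx k) weightA weightE (2^-1) (2^-1)) ?(ltW t0)//; last first.
- move=> k; rewrite /weightE /weightA;
    apply: (@dirE _ (fun x y => x * x = 2^-1 * 1 + 2^-1 * (x ^+ 2 - y ^+ 2))); by field.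
- exact: leqW.
rewrite (@mean_comb (fun k => dirx k * diry k) weightA weightA 0 0) ?(ltW t0)//; last first.
- move=> k; rewrite /weightA;
    apply: (@dirE _ (fun x y => x * y = 0 * 1 + 0 * 1)); by ring.
- exact: leqW.
rewrite (@mean_comb (fun k => _ / 2) weightA weightA 0 0) ?(ltW t0)//; last first.
- by move=> k; rewrite (dir_turn k).1; ring.
- exact: leqW.
- exact: leqW.
by ring.
Qed.

Lemma MV_derive i j (t : R) : (i <= 3)%N -> (j <= 3)%N -> 0 < t ->
  is_derive t 1 (MV i j) (c / 2 * (MA i j.+1 t - ME i j.+1 t) - lambda t * MV i j t).
Proof.
move=> i3 j3 t0; apply: is_derive_eq (tensor_derive diry_le1 i3 j3 t0) _.
rewrite (@mean_comb (fun k => diry k * diry k) weightA weightE (2^-1) (- 2^-1)) ?(ltW t0)//; last first.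
- move=> k; rewrite /weightE /weightA;
    apply: (@dirE _ (fun x y => y * y = 2^-1 * 1 + - 2^-1 * (x ^+ 2 - y ^+ 2))); by field.
- exact: leqW.
rewrite (@mean_comb (fun k => diry k * dirx k) weightA weightA 0 0) ?(ltW t0)//; last first.
- move=> k; rewrite /weightA;
    apply: (@dirE _ (fun x y => y * x = 0 * 1 + 0 * 1)); by ring.
- exact: leqW.
rewrite (@mean_comb (fun k => _ / 2) weightA weightA 0 0) ?(ltW t0)//; last first.
- by move=> k; rewrite (dir_turn k).2.1; ring.
- exact: leqW.
- exact: leqW.
by ring.
Qed.

End WeakEquation.

(** * Elimination of the directional means *)

Section DerivativeRules.
Context {R : realType} {V : normedModType R}.
Implicit Types (f g : V -> R) (t v : V) (df dg : R).

Lemma der_add f g t v df dg : is_derive t v f df -> is_derive t v g dg ->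
  is_derive t v (fun s => f s + g s) (df + dg).
Proof. by move=> ? ?; exact: is_deriveD. Qed.

Lemma der_sub f g t v df dg : is_derive t v f df -> is_derive t v g dg ->
  is_derive t v (fun s => f s - g s) (df - dg).
Proof. by move=> ? ?; exact: is_deriveB. Qed.

Lemma der_mul f g t v df dg : is_derive t v f df -> is_derive t v g dg ->
  is_derive t v (fun s => f s * g s) (f t * dg + g t * df).
Proof. by move=> ? ?; exact: is_deriveM. Qed.

Lemma der_scale f t v df (r : R) : is_derive t v f df ->
  is_derive t v (fun s => r * f s) (r * df).
Proof. by move=> ?; exact: is_deriveZ. Qed.

End DerivativeRules.

Lemma is_derive_local {R : realType} (u v : R) (f g : R -> R) (t df dg : R) :
  (forall s, u < s -> s < v -> f s = g s) -> u < t -> t < v ->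
  is_derive t 1 f df -> is_derive t 1 g dg -> df = dg.
Proof.
move=> fg ut tv [Df <-] [Dg <-]; apply: near_eq_derive.
have : t \in `]u, v[ by rewrite in_itv/= ut tv.
move=> /near_in_itvoo; apply: filterS => s; rewrite in_itv/= => /andP[us sv].
exact: fg.
Qed.

(** The means of the weighted test functions enter only through the linear system
that they satisfy. *)
Section WeakFourthOrder.
Context {R : realType} (c : R) (lambda : R -> R).
Variables A E H V : nat -> nat -> R -> R.
Hypothesis c_gt0 : 0 < c.
Hypothesis dA : forall i j (t : R), (i <= 3)%N -> (j <= 3)%N -> 0 < t ->
  is_derive t 1 (A i j) (c * (H i.+1 j t + V i j.+1 t)).
Hypothesis dE : forall i j (t : R), (i <= 3)%N -> (j <= 3)%N -> 0 < t ->
  is_derive t 1 (E i j) (c * (H i.+1 j t - V i j.+1 t) - 2 * lambda t * E i j t).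
Hypothesis dH : forall i j (t : R), (i <= 3)%N -> (j <= 3)%N -> 0 < t ->
  is_derive t 1 (H i j) (c / 2 * (A i.+1 j t + E i.+1 j t) - lambda t * H i j t).
Hypothesis dV : forall i j (t : R), (i <= 3)%N -> (j <= 3)%N -> 0 < t ->
  is_derive t 1 (V i j) (c / 2 * (A i j.+1 t - E i j.+1 t) - lambda t * V i j t).

(** Here [G] is the difference of the second derivatives of [E] along the two
axes. *)
Lemma weak_system : exists A1 G G1 S1 S2 : R -> R,
  forall t : R, 0 < t ->
  let S s := A 2 0 s + A 0 2 s in
  [/\ is_derive t 1 (A 0 0) (A1 t),
      is_derive t 1 A1 (c ^+ 2 / 2 * (S t + G t) - lambda t * A1 t),
      is_derive t 1 S (S1 t) /\ is_derive t 1 S1 (S2 t),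
      is_derive t 1 G (G1 t) &
      forall l1, is_derive t 1 lambda l1 ->
        is_derive t 1 G1 (S2 t + lambda t * S1 t - 2 * c ^+ 2 * A 2 2 t
          - 3 * lambda t * G1 t - (2 * l1 + 2 * lambda t ^+ 2) * G t)].
Proof.
pose S1 s := c * (H 3 0 s + V 2 1 s + (H 1 2 s + V 0 3 s)).
pose U s := H 3 0 s - V 2 1 s - (H 1 2 s - V 0 3 s).
pose G s := E 2 0 s - E 0 2 s.
pose G1 s := c * U s - 2 * (lambda s * G s).
exists (fun s => c * (H 1 0 s + V 0 1 s)), G, G1, S1,
  (fun s => c ^+ 2 / 2 * (A 4 0 s + 2 * A 2 2 s + A 0 4 s + E 4 0 s - E 0 4 s)
    - lambda s * S1 s) => t t0 /=.
have dG : is_derive t 1 G (G1 t).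
  apply: is_derive_eq (der_sub (dE (i:=2) (j:=0) isT isT t0) (dE (i:=0) (j:=2) isT isT t0)) _.
  by rewrite /G1 /U /G; ring.
split.
- exact: dA.
- apply: is_derive_eq (der_scale c
    (der_add (dH (i:=1) (j:=0) isT isT t0) (dV (i:=0) (j:=1) isT isT t0))) _.
  by rewrite /G; field.
- split.
    apply: is_derive_eq
      (der_add (dA (i:=2) (j:=0) isT isT t0) (dA (i:=0) (j:=2) isT isT t0)) _.
    by rewrite /S1; ring.
  apply: is_derive_eq (der_scale c (der_add
    (der_add (dH (i:=3) (j:=0) isT isT t0) (dV (i:=2) (j:=1) isT isT t0))
    (der_add (dH (i:=1) (j:=2) isT isT t0) (dV (i:=0) (j:=3) isT isT t0)))) _.
  by rewrite /S1; field.
- exact: dG.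
- move=> l1 dl.
  apply: is_derive_eq (der_sub (der_scale c (der_sub
    (der_sub (dH (i:=3) (j:=0) isT isT t0) (dV (i:=2) (j:=1) isT isT t0))
    (der_sub (dH (i:=1) (j:=2) isT isT t0) (dV (i:=0) (j:=3) isT isT t0))))
    (der_scale 2 (der_mul dl dG))) _.
  by rewrite /G1 /U /S1 /G; field.
Qed.

(** The integrated form of the fourth-order equation. Only the mean [A 0 0] and
its spatial derivatives of even order remain: [A 0 0]'' determines [G], the
derivative of [G] follows from it, and the equation for the second derivative of
[G] closes the system. *)
Lemma weak_fourth_order (u v t : R) (l1 : R -> R) (l2 : R)
    (J0 J1 J2 J3 S S1 S2 : R -> R) (J4 : R) :
  0 <= u -> u < t -> t < v ->
  (forall s, u < s -> s < v -> A 0 0 s = J0 s) ->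
  (forall s, u < s -> s < v -> A 2 0 s + A 0 2 s = S s) ->
  (forall s, u < s -> s < v -> [/\ is_derive s 1 J0 (J1 s),
    is_derive s 1 J1 (J2 s) & is_derive s 1 J2 (J3 s)]) ->
  is_derive t 1 J3 J4 ->
  (forall s, u < s -> s < v -> is_derive s 1 S (S1 s) /\ is_derive s 1 S1 (S2 s)) ->
  (forall s, u < s -> s < v -> is_derive s 1 lambda (l1 s)) ->
  is_derive t 1 l1 l2 ->
  J4 + l2 * J1 t + 2 * l1 t * J2 t + lambda t * J3 t - c ^+ 2 / 2 * S2 t
  + 3 * lambda t * (J3 t + l1 t * J1 t + lambda t * J2 t - c ^+ 2 / 2 * S1 t)
  + (2 * l1 t + 2 * lambda t ^+ 2) * (J2 t + lambda t * J1 t - c ^+ 2 / 2 * S t)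
  = c ^+ 2 / 2 * (S2 t + lambda t * S1 t) - c ^+ 4 * A 2 2 t.
Proof.
move=> u0 ut tv eJ eS dJ dJ3 dS dl dl1.
have [A1 [G [G1 [T1 [T2 W]]]]] := weak_system.
have c0 : c != 0 by rewrite gt_eqF.
have pos s : u < s -> 0 < s by exact: le_lt_trans.
have eA s : u < s -> s < v -> A1 s = J1 s.
  move=> us sv; have [dA1 _ _ _ _] := W s (pos s us); have [dJ0 _ _] := dJ s us sv.
  exact: (is_derive_local eJ us sv dA1 dJ0).
have eG s : u < s -> s < v ->
    G s = 2 / c ^+ 2 * (J2 s + lambda s * J1 s) - S s.
  move=> us sv; have [_ dA1 _ _ _] := W s (pos s us); have [_ dJ1 _] := dJ s us sv.
  have := is_derive_local eA us sv dA1 dJ1; rewrite eA// eS// => <-.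
  by field.
have eS1 s : u < s -> s < v -> T1 s = S1 s.
  move=> us sv; have [_ _ [dT _] _ _] := W s (pos s us).
  exact: (is_derive_local eS us sv dT (dS s us sv).1).
have eS2 s : u < s -> s < v -> T2 s = S2 s.
  move=> us sv; have [_ _ [_ dT] _ _] := W s (pos s us).
  exact: (is_derive_local eS1 us sv dT (dS s us sv).2).
have eG1 s : u < s -> s < v -> G1 s =
    2 / c ^+ 2 * (J3 s + (lambda s * J2 s + J1 s * l1 s)) - S1 s.
  move=> us sv; have [_ _ _ dG _] := W s (pos s us).
  have [_ dJ1 dJ2] := dJ s us sv.
  have dr := der_sub (der_scale (2 / c ^+ 2) (der_add dJ2 (der_mul (dl s us sv) dJ1)))
    (dS s us sv).1.
  exact: (is_derive_local eG us sv dG dr).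
have [_ _ _ _ dG1] := W t (pos t ut).
have [_ dJ1 dJ2] := dJ t ut tv.
have dr := der_sub (der_scale (2 / c ^+ 2) (der_add dJ3
  (der_add (der_mul (dl t ut tv) dJ2) (der_mul dJ1 dl1)))) (dS t ut tv).2.
have := is_derive_local eG1 ut tv (dG1 _ (dl t ut tv)) dr.
rewrite eG// eG1// eS1// eS2//; move: (A 2 2 t) (l1 t) (lambda t) => a22 m l.
move: (J1 t) (J2 t) (J3 t) (S t) (S1 t) (S2 t) => j1 j2 j3 s0 s1 s2 /eqP.
rewrite -subr_eq0 => /eqP D; apply/eqP; rewrite -subr_eq0; apply/eqP.
have <- : - (c ^+ 2 / 2) * 0 = 0 :> R by rewrite mulr0.
by rewrite -D; field.
Qed.

End WeakFourthOrder.

(** * Smooth functions on a box *)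

(** Directional derivatives in space-time become derivatives in one variable
along a line. *)
Lemma is_derive_along {R : realType} {V : normedModType R} (f : V -> R)
    (l : R -> V) (v : V) (x : R) :
  (forall s, l (s + x) = s *: v + l x) -> derivable f (l x) v ->
  is_derive x 1 (f \o l) ('D_v f (l x)).
Proof.
move=> lE df.
have E : (fun h : R => h^-1 *: ((f \o l) (h *: 1 + x) - (f \o l) x)) =
    (fun h : R => h^-1 *: (f (h *: v + l x) - f (l x))).
  by apply/funext => h; rewrite /= -lE [h *: 1]mulr1.
by split; rewrite /derivable /derive E.
Qed.

Section SmoothFunctions.
Context {R : realType} {V : normedModType R} (B : seq V) (O : set V).

Lemma Ck_continuous k f z : Ck B k O f -> O z -> {for z, continuous f}.
Proof. by case: k => [|k] /= [+ _]; apply. Qed.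

Lemma Ck_derivable k f v z : Ck B k.+1 O f -> v \in B -> O z -> derivable f z v.
Proof. by move=> /= [_ +] vB Oz => /(_ v vB)[+ _]; apply. Qed.

Lemma Ck_derive k f v : Ck B k.+1 O f -> v \in B -> Ck B k O ('D_v f).
Proof. by move=> /= [_ +] vB => /(_ v vB)[]. Qed.

Lemma CkW k f : Ck B k.+1 O f -> Ck B k O f.
Proof.
elim: k f => [|k IH] f; first by move=> /= [].
move=> Cf; split; first by move=> z; exact: Ck_continuous Cf.
move=> v vB; split; first by move=> z; exact: Ck_derivable Cf vB.
by apply: IH; exact: Ck_derive Cf vB.
Qed.

End SmoothFunctions.

Section ContinuousMeasurable.
Context {R : realType}.
Local Notation plane := (measurableTypeR R * measurableTypeR R)%type.

Let corner n (z : plane) : R * R :=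
  ((scale n z.1)%:~R / 2 ^+ n, (scale n z.2)%:~R / 2 ^+ n).

Let corner_dist n (x : R) : `|(scale n x)%:~R / 2 ^+ n - x| <= 2 ^- n.
Proof.
have n0 : 0 < 2 ^+ n :> R by rewrite exprn_gt0.
have /andP[h1 h2] := scale_bounds n x.
rewrite -(ler_pM2l n0) divff ?gt_eqF// -{1}(gtr0_norm n0) -normrM mulrBr mulrCA.
rewrite divff ?gt_eqF// mulr1 ler_norml; apply/andP; split; lra.
Qed.

(** A function continuous at the points of [A] is there the limit of its samples
at the corners of the dyadic cells. *)
Lemma continuous_measurable2 (A : set plane) (g : R * R -> R) :
  measurable A -> (forall z, A z -> {for (z : R * R), continuous g}) ->
  measurable_fun A (fun z : plane => g z).
Proof.
move=> mA cg.
apply: (measurable_fun_cvg (h := fun n z => g (corner n z))).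
  move=> n; apply: measurable_funTS => _ S mS; rewrite setTI.
  apply: (@saturated_measurable R n) => z z' zz' /=.
  by rewrite /corner; case: zz' => -> ->.
move=> z Az; apply: (cvg_comp (fun n => corner n z) g); last exact: (cg z Az).
have h x : (scale n x)%:~R / 2 ^+ n @[n --> \oo] --> (x : R).
  apply/cvgrPdist_le => eps eps0.
  have /cvgrPdist_le /(_ eps eps0) := @cvg_expr R (2^-1) (ltac:(rewrite ger0_norm; lra)).
  apply: filterS => n; rewrite sub0r normrN => nE; rewrite distrC.
  apply: (le_trans (corner_dist n x)); apply: le_trans nE.
  by rewrite exprVn ler_norm.
by case: z {Az} => x y; exact: (cvg_pair (h x) (h y)).
Qed.

End ContinuousMeasurable.

Section BoxCalculus.
Context {R : realType}.
Variables (x0 y0 t0 e : R) (Omega : set (R * R * R)).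
Local Notation plane := (measurableTypeR R * measurableTypeR R)%type.
Local Notation lebesgue2 := ((@lebesgue_measure R) \x (@lebesgue_measure R))%E.
Local Notation smooth k g := (Ck [:: ex; ey; et] k Omega g).
Local Notation Box := (box x0 y0 e).

Definition slab : set (R * R * R) :=
  [set z | [/\ `|z.1.1 - x0| <= e, `|z.1.2 - y0| <= e & `|z.2 - t0| <= e]].

Hypothesis e_gt0 : 0 < e.
Hypothesis slab_sub : slab `<=` Omega.

Lemma compact_slab : compact slab.
Proof.
rewrite (_ : slab = (`[x0 - e, x0 + e] `*` `[y0 - e, y0 + e]) `*` `[t0 - e, t0 + e]).
  by apply: compact_setX; [apply: compact_setX|]; exact: segment_compact.
apply/seteqP; split=> z; rewrite /slab /= !in_itv/= !ler_distl.
  by move=> [? ? ?].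
by move=> [[? ?] ?].
Qed.

Lemma slab_bounded k g : smooth k g -> exists M, forall z, slab z -> `|g z| <= M.
Proof.
move=> sg.
have : bounded_set (g @` slab).
  apply: compact_bounded; apply: continuous_compact; last exact: compact_slab.
  apply: continuous_in_subspaceT => z /set_mem sz.
  exact: (Ck_continuous sg (slab_sub sz)).
move=> [M [_ HM]]; exists (M + 1) => z sz.
by apply: (HM (M + 1)); [rewrite ltrDl|exists z].
Qed.

Lemma slab_box z t : Box z -> `|t - t0| <= e -> slab (z, t).
Proof. by move=> [hx hy] ht. Qed.

Lemma slice_continuous k g t z : smooth k g -> slab (z, t) ->
  {for z, continuous (fun z => g (z, t))}.
Proof.
move=> sg sz; apply: (continuous_comp (f := fun z => (z, t))); last first.
  exact: (Ck_continuous sg (slab_sub sz)).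
exact: (cvg_pair (cvg_id) (cvg_cst t)).
Qed.

Lemma measurable_slice k g t : smooth k g -> `|t - t0| <= e ->
  measurable_fun Box (fun z : plane => g (z, t)).
Proof.
move=> sg ht; apply: (continuous_measurable2 (g := fun z => g (z, t))).
  exact: measurable_box.
by move=> z bz; apply: slice_continuous sg _; exact: slab_box.
Qed.

Lemma lebesgue2_box : lebesgue2 Box = (2 * e * (2 * e))%:E.
Proof.
have len (a : R) : lebesgue_measure `[a - e, a + e]%classic = (2 * e)%:E.
  rewrite lebesgue_measure_itv/= lte_fin ifT; last by have := e_gt0; lra.
  by rewrite -EFinB; congr (_%:E); ring.
rewrite boxE product_measure1E; [|exact: measurable_itv..].
by rewrite EFinM; congr (_ * _)%E; exact: len.
Qed.

Lemma box_integrable (f : plane -> R) M : measurable_fun Box f ->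
  (forall z, Box z -> `|f z| <= M) -> lebesgue2.-integrable Box (EFin \o f).
Proof.
move=> mf fM; apply: measurable_bounded_integrable => //.
- exact: measurable_box.
- by rewrite [ltLHS]lebesgue2_box ltry.
- exists M; split; first exact: num_real.
  by move=> r Mr z bz; apply: le_trans (ltW Mr); exact: fM.
Qed.

End BoxCalculus.

(** * Testing smooth functions *)

Section TestedFunctions.
Context {R : realType}.
Variables (x0 y0 t0 e : R) (Omega : set (R * R * R)).
Local Notation plane := (measurableTypeR R * measurableTypeR R)%type.
Local Notation lebesgue2 := ((@lebesgue_measure R) \x (@lebesgue_measure R))%E.
Local Notation smooth k g := (Ck [:: ex; ey; et] k Omega g).
Local Notation Box := (box x0 y0 e).
Hypothesis e_gt0 : 0 < e.
Hypothesis slab_sub : slab x0 y0 t0 e `<=` Omega.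
Variables (a b : nat -> R -> R) (K : R).
Hypotheses (chain_a : derivative_chain a K) (chain_b : derivative_chain b K).
Hypothesis a_edge : forall i x, (i <= 5)%N -> e <= `|x - x0| -> a i x = 0.
Hypothesis b_edge : forall i y, (i <= 5)%N -> e <= `|y - y0| -> b i y = 0.

Definition tested i j (g : R * R * R -> R) (t : R) : R :=
  \int[lebesgue2]_(z in Box) (a i z.1 * b j z.2 * g (z, t)).

Lemma chain_continuous (f : nat -> R -> R) i : derivative_chain f K -> (i <= 4)%N ->
  continuous (f i).
Proof.
move=> chain i4 x; apply/differentiable_continuous; rewrite -derivable1_diffP.
by have [] := chain.2 i x i4.
Qed.

Lemma measurable_weight i j : (i <= 4)%N -> (j <= 4)%N ->
  measurable_fun setT (fun z : plane => a i z.1 * b j z.2).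
Proof.
move=> i4 j4; apply: measurable_funM.
  apply: (measurableT_comp (f := a i)) => //.
  exact: continuous_measurable_fun (chain_continuous chain_a i4).
apply: (measurableT_comp (f := b j)) => //.
exact: continuous_measurable_fun (chain_continuous chain_b j4).
Qed.

Lemma weight_le i j (z : plane) : (i <= 4)%N -> (j <= 4)%N ->
  `|a i z.1 * b j z.2| <= K * K.
Proof.
by move=> i4 j4; rewrite normrM ler_pM//; [apply: chain_a.1|apply: chain_b.1]; exact: leqW.
Qed.

Lemma tested_bounded i j k g : (i <= 4)%N -> (j <= 4)%N -> smooth k g ->
  exists M, forall z t, Box z -> `|t - t0| <= e ->
    `|a i z.1 * b j z.2 * g (z, t)| <= M.
Proof.
move=> i4 j4 sg; have [M HM] := slab_bounded slab_sub sg.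
exists (K * K * M) => z t bz ht; rewrite normrM ler_pM//; first exact: weight_le.
by apply: HM; exact: slab_box.
Qed.

Lemma measurable_tested i j k g t : (i <= 4)%N -> (j <= 4)%N -> smooth k g ->
  `|t - t0| <= e -> measurable_fun Box (fun z : plane => a i z.1 * b j z.2 * g (z, t)).
Proof.
move=> i4 j4 sg ht; apply: measurable_funM; last exact: (measurable_slice slab_sub sg ht).
by apply: measurable_funTS; exact: measurable_weight.
Qed.

Lemma integrable_tested i j k g t : (i <= 4)%N -> (j <= 4)%N -> smooth k g ->
  `|t - t0| <= e ->
  lebesgue2.-integrable Box (EFin \o (fun z : plane => a i z.1 * b j z.2 * g (z, t))).
Proof.
move=> i4 j4 sg ht; have [M HM] := tested_bounded i4 j4 sg.
apply: (box_integrable e_gt0 (M := M)); first exact: (measurable_tested i4 j4 sg ht).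
by move=> z bz; exact: HM.
Qed.

(** The time derivative is bounded on the compact box, so it can be taken under
the integral sign. *)
Lemma tested_derive i j k g t : (i <= 4)%N -> (j <= 4)%N -> smooth k.+1 g ->
  `|t - t0| < e -> is_derive t 1 (tested i j g) (tested i j (pt g) t).
Proof.
move=> i4 j4 sg ht.
have sdg : smooth k (pt g) by apply: Ck_derive sg _; rewrite !inE eqxx !orbT.
have tI : `]t0 - e, t0 + e[%classic t by rewrite /= in_itv/= -ltr_distl.
have wI s : `]t0 - e, t0 + e[%classic s -> `|s - t0| <= e.
  by rewrite /= in_itv/= -ltr_distl; exact: ltW.
pose f s (z : plane) : R := a i z.1 * b j z.2 * g (z, s).
have df s (z : plane) : `]t0 - e, t0 + e[%classic s -> Box z ->
    is_derive s 1 (f ^~ z) (a i z.1 * b j z.2 * pt g (z, s)).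
  move=> sI bz; apply: der_scale.
  apply: (is_derive_along (f := g) (l := fun s => (z, s)) (v := et)).
    move=> r; transitivity ((r * 0 + z.1, r * 0 + z.2), r * 1 + s); last by [].
    by rewrite mulr0 !add0r mulr1; case: (z).
  apply: (Ck_derivable sg); first by rewrite !inE eqxx !orbT.
  by apply: slab_sub; apply: slab_box => //; exact: wI.
have [M HM] := tested_bounded i4 j4 sdg.
have pE s z : `]t0 - e, t0 + e[%classic s -> Box z ->
    partial1of2 f s z = a i z.1 * b j z.2 * pt g (z, s).
  by move=> sI bz; rewrite partial1of2E; have [_ ->] := df s z sI bz.
have M0 : 0 <= M.
  apply: le_trans (HM (x0, y0) t0 _ _); rewrite ?normr_ge0//.
    by rewrite /box/= !subrr normr0; split; exact: ltW.
  by rewrite subrr normr0 ltW.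
have intf s : `]t0 - e, t0 + e[%classic s -> lebesgue2.-integrable Box (EFin \o f s).
  by move=> sI; exact: (integrable_tested i4 j4 sg (wI s sI)).
have derf s z : `]t0 - e, t0 + e[%classic s -> Box z -> derivable (f ^~ z) s 1.
  by move=> sI bz; have [] := df s z sI bz.
have intM : lebesgue2.-integrable Box (EFin \o (fun _ : plane => M)).
  apply: (box_integrable e_gt0 (M := M)) => // z _.
  by rewrite ger0_norm.
have ub s z : `]t0 - e, t0 + e[%classic s -> Box z -> `|partial1of2 f s z| <= M.
  by move=> sI bz; rewrite pE//; apply: HM => //; exact: wI.
have mb : measurable Box by exact: measurable_box.
split; first exact: (derivable_under_integral mb tI intf derf (fun=> M0) intM ub).
rewrite -derive1E [LHS](differentiation_under_integral mb tI intf derf (fun=> M0) intM ub).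
by apply: eq_Rintegral => z /set_mem bz; rewrite pE.
Qed.

Lemma box_integral0_x (h : plane -> R) :
  lebesgue2.-integrable Box (EFin \o h) ->
  (forall y, `|y - y0| <= e ->
    (\int[lebesgue_measure]_(x in `[(x0 - e)%R, (x0 + e)%R]) (h (x, y))%:E = 0)%E) ->
  \int[lebesgue2]_(z in Box) h z = 0.
Proof.
move=> ih h0; rewrite Rintegral_mkcond.
have mb : measurable Box by exact: measurable_box.
have ih' : lebesgue2.-integrable setT (EFin \o (h \_ Box)).
  by rewrite -restrict_EFin; apply/(integrable_mkcond _ mb).
rewrite /Rintegral -[X in fine X](integral21_prod_meas1 ih').
rewrite [X in fine X](_ : _ = 0%E)//; apply: integral0_eq => y _.
have [yb|yb] := boolP (`|y - y0| <= e); last first.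
  apply: integral0_eq => x _; rewrite /= patchE ifF//.
  by apply/negbTE; rewrite notin_setE /box /= => -[_]; exact/negP.
rewrite -[RHS](h0 y yb) [RHS]integral_mkcond; apply: eq_integral => x _.
rewrite /= !patchE [LHS](_ : _ = if (x, y) \in Box then (h (x, y))%:E else 0%E).
  by congr (if _ then _ else _); apply/idP/idP; rewrite !inE /box /= in_itv/= -ler_distl;
    [case|].
by case: ifP.
Qed.

Lemma box_integral0_y (h : plane -> R) :
  lebesgue2.-integrable Box (EFin \o h) ->
  (forall x, `|x - x0| <= e ->
    (\int[lebesgue_measure]_(y in `[(y0 - e)%R, (y0 + e)%R]) (h (x, y))%:E = 0)%E) ->
  \int[lebesgue2]_(z in Box) h z = 0.
Proof.
move=> ih h0; rewrite Rintegral_mkcond.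
have mb : measurable Box by exact: measurable_box.
have ih' : lebesgue2.-integrable setT (EFin \o (h \_ Box)).
  by rewrite -restrict_EFin; apply/(integrable_mkcond _ mb).
rewrite /Rintegral -[X in fine X](integral12_prod_meas1 ih').
rewrite [X in fine X](_ : _ = 0%E)//; apply: integral0_eq => x _.
have [xb|xb] := boolP (`|x - x0| <= e); last first.
  apply: integral0_eq => y _; rewrite /= patchE ifF//.
  by apply/negbTE; rewrite notin_setE /box /= => -[+ _]; exact/negP.
rewrite -[RHS](h0 x xb) [RHS]integral_mkcond; apply: eq_integral => y _.
rewrite /= !patchE [LHS](_ : _ = if (x, y) \in Box then (h (x, y))%:E else 0%E).
  by congr (if _ then _ else _); apply/idP/idP; rewrite !inE /box /= in_itv/= -ler_distl;
    [case|].
by case: ifP.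
Qed.

Lemma integral_derivative0 (w : R) (F f : R -> R) :
  (forall x, `|x - w| <= e -> {for x, continuous f} /\ is_derive x 1 F (f x)) ->
  F (w - e) = 0 -> F (w + e) = 0 ->
  (\int[lebesgue_measure]_(x in `[(w - e)%R, (w + e)%R]) (f x)%:E = 0)%E.
Proof.
move=> H F0 F1.
have cF x : `|x - w| <= e -> {for x, continuous F}.
  move=> /H[_ dF]; apply/differentiable_continuous; rewrite -derivable1_diffP.
  by have [] := dF.
have e0 := e_gt0.
have eI : `|w - e - w| <= e by rewrite addrAC subrr add0r normrN ger0_norm ?(ltW e_gt0).
have eI' : `|w + e - w| <= e by rewrite addrAC subrr add0r ger0_norm ?(ltW e_gt0).
rewrite (@continuous_FTC2 _ f F) ?F0 ?F1 ?subee//.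
- by rewrite ltrBlDr; lra.
- apply: continuous_in_subspaceT => x /set_mem; rewrite /= in_itv/= -ler_distl.
  by move=> /H[].
- split.
  + by move=> x; rewrite in_itv/= -ltr_distl => /ltW/H[_ []].
  + exact: cvg_at_right_filter (cF _ eI).
  + exact: cvg_at_left_filter (cF _ eI').
- by move=> x; rewrite in_itv/= -ltr_distl => /ltW/H[_ [_ <-]]; rewrite derive1E.
Qed.

(** Integration by parts: by Fubini's theorem it takes place on segments, at the
ends of which the weight vanishes. *)
Lemma tested_px i j k g t : (i <= 3)%N -> (j <= 4)%N -> smooth k.+1 g ->
  `|t - t0| <= e -> tested i.+1 j g t = - tested i j (px g) t.
Proof.
move=> i3 j4 sg ht; have i4 : (i.+1 <= 4)%N := i3; have i4' := leqW i3.
have eB : (ex : R * R * R) \in [:: ex; ey; et] by rewrite !inE eqxx.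
have sdg : smooth k (px g) by exact: Ck_derive sg eB.
have i1 := integrable_tested i4 j4 sg ht.
have i2 := integrable_tested i4' j4 sdg ht.
apply/eqP; rewrite -subr_eq0 opprK; apply/eqP; rewrite /tested -RintegralD//; last first.
  exact: measurable_box.
apply: box_integral0_x; first by exact: (integrableD (measurable_box _ _ _) i1 i2).
move=> y hy.
apply: (@integral_derivative0 x0 (fun x => b j y * (a i x * g ((x, y), t)))
  (fun x => a i.+1 x * b j y * g ((x, y), t) + a i x * b j y * px g ((x, y), t))).
- move=> x hx; have sz : slab x0 y0 t0 e ((x, y), t) by [].
  have cl : {for x, continuous (fun x => ((x, y), t) : R * R * R)}.
    exact: (cvg_pair (cvg_pair cvg_id (cvg_cst y)) (cvg_cst t)).
  have cc k' f : smooth k' f -> {for x, continuous (fun x => f ((x, y), t))}.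
    move=> sf; apply: (continuous_comp (f := fun x => ((x, y), t)) cl).
    exact: (Ck_continuous sf (slab_sub sz)).
  split.
    have ca m : (m <= 4)%N -> {for x, continuous (fun x => a m x * b j y)}.
      move=> m4; apply: cvgM; last exact: cvg_cst.
      exact: (chain_continuous chain_a m4).
    apply: cvgD; (apply: cvgM; first exact: ca); [exact: cc sg|exact: cc sdg].
  have dg : is_derive x 1 (fun x => g ((x, y), t)) (px g ((x, y), t)).
    apply: (is_derive_along (f := g) (l := fun x => ((x, y), t)) (v := ex)).
      move=> s; transitivity ((s * 1 + x, s * 0 + y), s * 0 + t); last by [].
      by rewrite mulr0 !add0r mulr1.
    exact: (Ck_derivable sg eB (slab_sub sz)).
  apply: is_derive_eq (der_scale (b j y) (der_mul (chain_a.2 i x i4') dg)) _.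
  by ring.
- by rewrite (a_edge (leqW (leqW i3)))/= ?mul0r ?mulr0// addrAC subrr add0r normrN ger0_norm ?(ltW e_gt0).
- by rewrite (a_edge (leqW (leqW i3)))/= ?mul0r ?mulr0// addrAC subrr add0r ger0_norm ?(ltW e_gt0).
Qed.

Lemma tested_py i j k g t : (i <= 4)%N -> (j <= 3)%N -> smooth k.+1 g ->
  `|t - t0| <= e -> tested i j.+1 g t = - tested i j (py g) t.
Proof.
move=> i4 j3 sg ht; have j4 : (j.+1 <= 4)%N := j3; have j4' := leqW j3.
have eB : (ey : R * R * R) \in [:: ex; ey; et] by rewrite !inE eqxx orbT.
have sdg : smooth k (py g) by exact: Ck_derive sg eB.
have i1 := integrable_tested i4 j4 sg ht.
have i2 := integrable_tested i4 j4' sdg ht.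
apply/eqP; rewrite -subr_eq0 opprK; apply/eqP; rewrite /tested -RintegralD//; last first.
  exact: measurable_box.
apply: box_integral0_y; first by exact: (integrableD (measurable_box _ _ _) i1 i2).
move=> x hx.
apply: (@integral_derivative0 y0 (fun y => a i x * (b j y * g ((x, y), t)))
  (fun y => a i x * b j.+1 y * g ((x, y), t) + a i x * b j y * py g ((x, y), t))).
- move=> y hy; have sz : slab x0 y0 t0 e ((x, y), t) by [].
  have cl : {for y, continuous (fun y => ((x, y), t) : R * R * R)}.
    exact: (cvg_pair (cvg_pair (cvg_cst x) cvg_id) (cvg_cst t)).
  have cc k' f : smooth k' f -> {for y, continuous (fun y => f ((x, y), t))}.
    move=> sf; apply: (continuous_comp (f := fun y => ((x, y), t)) cl).
    exact: (Ck_continuous sf (slab_sub sz)).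
  split.
    have cb m : (m <= 4)%N -> {for y, continuous (fun y => a i x * b m y)}.
      move=> m4; apply: cvgM; first exact: cvg_cst.
      exact: (chain_continuous chain_b m4).
    apply: cvgD; (apply: cvgM; first exact: cb); [exact: cc sg|exact: cc sdg].
  have dg : is_derive y 1 (fun y => g ((x, y), t)) (py g ((x, y), t)).
    apply: (is_derive_along (f := g) (l := fun y => ((x, y), t)) (v := ey)).
      move=> s; transitivity ((s * 0 + x, s * 1 + y), s * 0 + t); last by [].
      by rewrite mulr0 !add0r mulr1.
    exact: (Ck_derivable sg eB (slab_sub sz)).
  apply: is_derive_eq (der_scale (a i x) (der_mul (chain_b.2 j y j4') dg)) _.
  by ring.
- by rewrite (b_edge (leqW (leqW j3)))/= ?mul0r ?mulr0// addrAC subrr add0r normrN ger0_norm ?(ltW e_gt0).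
- by rewrite (b_edge (leqW (leqW j3)))/= ?mul0r ?mulr0// addrAC subrr add0r ger0_norm ?(ltW e_gt0).
Qed.

End TestedFunctions.

(** * A compactly supported bump *)

Section Bump.
Context {R : realType}.

Lemma is_derive_posX (n : nat) (s : R) :
  is_derive s 1 (fun s => Num.max 0 s ^+ n.+2) (n.+2%:R * Num.max 0 s ^+ n.+1).
Proof.
elim: n => [|n IH].
  rewrite expr1; apply: is_derive_increments => eps eps0; exists eps => // h h0 he.
  have hh : h ^+ 2 <= eps * h by rewrite expr2 ler_pM2r// ltW.
  split; apply: le_trans hh.
    by rewrite [h * _]mulrCA mulrA; exact: max0_sqr_taylor.
  have := max0_sqr_taylor s (- h); rewrite sqrrN -normrN; apply: le_trans.
  by rewrite le_eqVlt; apply/orP; left; apply/eqP; congr (`| _ |); ring.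
have posS m (u : R) : Num.max 0 u ^+ m.+2 = u * Num.max 0 u ^+ m.+1.
  by rewrite exprS; case: (leP 0 u) => // u0; rewrite expr0n/= !mulr0.
rewrite [X in is_derive _ _ X](_ : _ = fun s => s * Num.max 0 s ^+ n.+2); last first.
  by apply/funext => u; exact: posS.
apply: is_derive_eq (der_mul (is_derive_id s 1) IH) _.
by rewrite (posS n) -natr1; ring.
Qed.

Variables (x0 e : R).
Hypothesis e_gt0 : 0 < e.

Definition bump_base : {poly R} := (e ^+ 2)%:P - ('X - x0%:P) ^+ 2.

Fixpoint bump_factor (i : nat) : {poly R} :=
  if i is j.+1 then
    (bump_factor j)^`() * bump_base + (7 - j)%:R *: (bump_factor j * bump_base^`())
  else 1.

(** The derivatives of [max(0, e^2 - (x - x0)^2)^7]. After five derivations the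
exponent is still at least two, so that the formula matches at the edges. *)
Definition bump (i : nat) (x : R) : R :=
  (bump_factor i).[x] * Num.max 0 bump_base.[x] ^+ (7 - i).

Lemma bump_baseE x : bump_base.[x] = e ^+ 2 - (x - x0) ^+ 2.
Proof. by rewrite /bump_base !hornerE. Qed.

Lemma bump_derive i (x : R) : (i <= 4)%N -> is_derive x 1 (bump i) (bump i.+1 x).
Proof.
move=> i4; rewrite /bump.
have -> : (7 - i = (5 - i).+2)%N by lia.
have -> : (7 - i.+1 = (5 - i).+1)%N by lia.
have dpos : is_derive x 1 (fun y => Num.max 0 bump_base.[y] ^+ (5 - i).+2)
    ((5 - i).+2%:R * Num.max 0 bump_base.[x] ^+ (5 - i).+1 * bump_base^`().[x]).
  exact: (is_derive1_comp (f := fun s => Num.max 0 s ^+ (5 - i).+2)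
    (is_derive_posX (5 - i) _) (is_derive_poly bump_base x)).
apply: is_derive_eq (der_mul (is_derive_poly (bump_factor i) x) dpos) _.
have -> : Num.max 0 bump_base.[x] ^+ (5 - i).+2 =
    bump_base.[x] * Num.max 0 bump_base.[x] ^+ (5 - i).+1.
  by rewrite exprS; case: (leP 0 bump_base.[x]) => // u0; rewrite expr0n/= !mulr0.
have e7 : (7 - i = (5 - i).+2)%N by lia.
have -> : (bump_factor i.+1).[x] = (bump_factor i)^`().[x] * bump_base.[x] +
    (5 - i).+2%:R * ((bump_factor i).[x] * bump_base^`().[x]).
  by rewrite -e7 -!hornerM -hornerZ -hornerD.
by ring.
Qed.

Lemma bump_edge i x : (i <= 5)%N -> e <= `|x - x0| -> bump i x = 0.
Proof.
move=> i5 ex; rewrite /bump (max_idPl _) ?expr0n ?subn_eq0.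
  by rewrite leqNgt ltnS (leq_trans i5)//= mulr0.
rewrite bump_baseE subr_le0 -[leRHS]real_normK ?num_real//.
by rewrite lerXn2r// nnegrE ltW.
Qed.

Lemma bump_ge0 x : 0 <= bump 0 x.
Proof. by rewrite /bump /= -polyC1 hornerC mul1r exprn_ge0// le_max lexx. Qed.

Lemma bump_gt0 x : `|x - x0| < e -> 0 < bump 0 x.
Proof.
move=> xe; rewrite /bump /= -polyC1 hornerC mul1r exprn_gt0// lt_max bump_baseE subr_gt0.
by rewrite -real_normK ?num_real// ltrXn2r// ?orbT// nnegrE ltW.
Qed.

Lemma bump_chain : exists K, derivative_chain bump K.
Proof.
have cb i : continuous (bump i).
  move=> x; apply: cvgM; first exact: continuous_horner.
  apply: (continuous_comp (f := fun x => Num.max 0 bump_base.[x]) (g := fun u => u ^+ (7 - i)));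
    last exact: exprn_continuous.
  by apply: continuous_max; [exact: cvg_cst|exact: continuous_horner].
have bd i : (i <= 5)%N -> exists K, forall x, `|bump i x| <= K.
  move=> i5; have [c _ Hc] := @EVT_max R (fun x => `|bump i x|) (x0 - e) (x0 + e)
    (ltac:(have := e_gt0; lra)) (ltac:(apply: continuous_subspaceT => x;
      apply: continuous_comp; [exact: cb|exact: norm_continuous])).
  exists `|bump i c| => x; have [xe|xe] := lerP `|x - x0| e.
    by apply: Hc; rewrite in_itv/= -ler_distl.
  by rewrite bump_edge ?normr0 ?normr_ge0 ?ltW.
have /choice[f Hf] : forall i, exists K, (i <= 5)%N -> forall x, `|bump i x| <= K.
  move=> i; have [i5|i5] := boolP (i <= 5)%N; last by exists 0.
  by have [K HK] := bd i i5; exists K.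
exists (\sum_(i < 6) f i); split; last by move=> i x; exact: bump_derive.
move=> i x i5; apply: (le_trans (Hf i i5 x)).
rewrite (bigD1 (Ordinal (i5 : (i < 6)%N)))//= lerDl sumr_ge0// => j _.
by apply: le_trans (Hf j _ 0) => //; rewrite -ltnS.
Qed.

End Bump.

Lemma bump_chains {R : realType} (x y e : R) : 0 < e ->
  exists K, derivative_chain (bump x e) K /\ derivative_chain (bump y e) K.
Proof.
move=> e0; have [K1 [h1 d1]] := bump_chain x e0; have [K2 [h2 d2]] := bump_chain y e0.
exists (Num.max K1 K2); split; split=> // i s i5; rewrite le_max.
  by rewrite h1.
by rewrite h2 ?orbT.
Qed.

(** * Localization *)

Section Localization.
Context {R : realType}.
Variable Omega : set (R * R * R).
Local Notation plane := (measurableTypeR R * measurableTypeR R)%type.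
Local Notation lebesgue2 := ((@lebesgue_measure R) \x (@lebesgue_measure R))%E.
Local Notation smooth k g := (Ck [:: ex; ey; et] k Omega g).
Implicit Types g h : R * R * R -> R.

Definition lincomb (l : seq (R * (R * R * R -> R))) (z : R * R * R) : R :=
  foldr (fun q s => q.1 * q.2 z + s) 0 l.

Lemma smooth_lincomb l : foldr (fun q H => smooth 0 q.2 /\ H) True l ->
  smooth 0 (lincomb l).
Proof.
elim: l => [_|q l IH [[cq _] /IH[cl _]]]; split=> // z Oz; first exact: cvg_cst.
apply: (@continuousD _ _ _ (fun z => q.1 * q.2 z)); last exact: cl.
by apply: cvgM; [exact: cvg_cst|exact: cq].
Qed.

Section Tested.
Variables (x0 y0 t0 e : R).
Hypothesis e_gt0 : 0 < e.
Hypothesis slab_sub : slab x0 y0 t0 e `<=` Omega.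

Lemma tested_lincomb (a b : nat -> R -> R) (K : R) l (t : R) :
  derivative_chain a K -> derivative_chain b K -> `|t - t0| <= e ->
  foldr (fun q H => smooth 0 q.2 /\ H) True l ->
  tested x0 y0 e a b 0 0 (lincomb l) t =
  foldr (fun q s => q.1 * tested x0 y0 e a b 0 0 q.2 t + s) 0 l.
Proof.
move=> ca cb ht; elim: l => [_|q l IH [cq cl]].
  rewrite /tested; under eq_Rintegral do rewrite mulr0.
  by rewrite Rintegral_cst ?mul0r//; exact: measurable_box.
have i0 k g : smooth k g -> _ := fun sg =>
  integrable_tested e_gt0 slab_sub ca cb (isT : (0 <= 4)%N) (isT : (0 <= 4)%N) sg ht.
rewrite /= -IH// /tested -RintegralZl; [|exact: measurable_box|exact: i0 cq].
rewrite -RintegralD; first by apply: eq_Rintegral => z _; rewrite /lincomb/=; ring.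
- exact: measurable_box.
- exact: (integrableZl (measurable_box _ _ _) q.1 (i0 _ _ cq)).
- exact: i0 (smooth_lincomb cl).
Qed.

(** A nonnegative integrand with a vanishing integral vanishes almost everywhere,
whereas this one is positive on a smaller box of positive area. *)
Lemma tested_bump_neq0 h : smooth 0 h ->
  (forall z, slab x0 y0 t0 e z -> 0 < h z) ->
  tested x0 y0 e (bump x0 e) (bump y0 e) 0 0 h t0 != 0.
Proof.
move=> sh h0; apply/eqP => I0.
have tt : `|t0 - t0| <= e by rewrite subrr normr0 ltW.
have [K [cK cK']] := bump_chains x0 y0 e_gt0.
have mb : measurable (box x0 y0 e) by exact: measurable_box.
pose f (z : plane) := bump x0 e 0 z.1 * bump y0 e 0 z.2 * h (z, t0).
have ih : lebesgue2.-integrable (box x0 y0 e) (EFin \o f).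
  exact: (integrable_tested e_gt0 slab_sub cK cK' (isT : (0 <= 4)%N) (isT : (0 <= 4)%N) sh tt).
have f0 z : box x0 y0 e z -> 0 <= f z.
  move=> bz; apply: mulr_ge0; first by rewrite mulr_ge0 ?bump_ge0.
  by apply/ltW/h0/slab_box.
have mf : measurable_fun (box x0 y0 e) (EFin \o f) by exact: (measurable_int _ ih).
have fin : (\int[lebesgue2]_(z in box x0 y0 e) (EFin \o f) z \is a fin_num)%E.
  exact: integrable_fin_num.
have /(ae_eq_integral_abs _ mb mf) : (\int[lebesgue2]_(z in box x0 y0 e) `|(EFin \o f) z| = 0)%E.
  transitivity (\int[lebesgue2]_(z in box x0 y0 e) (EFin \o f) z)%E.
    by apply: eq_integral => z /set_mem bz; rewrite /= ger0_norm// f0.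
  by rewrite -(fineK fin) [fine _]I0.
rewrite /ae_eq => -[A [mA A0 HA]].
have sub : box x0 y0 (e / 2) `<=` A.
  move=> z [hx hy]; apply: HA => /= H.
  have e0 := e_gt0.
  have hx' : `|z.1 - x0| < e by lra.
  have hy' : `|z.2 - y0| < e by lra.
  have bz : box x0 y0 e z by split; exact: ltW.
  have := H bz => -[]; apply/eqP; rewrite gt_eqF//.
  by apply: mulr_gt0; [rewrite mulr_gt0 ?bump_gt0|apply: h0; exact: slab_box].
have := lebesgue2_box x0 y0 (ltac:(have := e_gt0; lra) : 0 < e / 2).
have -> : lebesgue2 (box x0 y0 (e / 2)) = 0%E.
  apply/eqP; rewrite eq_le measure_ge0 andbT -A0; apply: le_measure => //; rewrite inE//.
  exact: measurable_box.
by move=> /eqP; rewrite eq_sym eqe; have := e_gt0; nra.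
Qed.

End Tested.
End Localization.

(** * The expanded equation at a point *)

Section Slabs.
Context {R : realType}.

Lemma slab_mono (x y t e e' : R) : e <= e' -> slab x y t e `<=` slab x y t e'.
Proof. by move=> ee' z [h1 h2 h3]; split; exact: le_trans ee'. Qed.

Lemma slab_near (x y t : R) (A : set (R * R * R)) : nbhs ((x, y), t) A ->
  exists2 e : R, 0 < e & slab x y t e `<=` A.
Proof.
move=> /nbhs_ballP[r /= r0 rA]; exists (r / 2); first by rewrite divr_gt0.
move=> z [h1 h2 h3]; apply: rA.
by split; [split|]; rewrite /ball /= distrC; lra.
Qed.

End Slabs.

Section Equation.
Context {R : realType} (c : R) (lambda : R -> R).
Implicit Types p : R * R * R -> R.

Local Notation l1 := (derive1 lambda).
Local Notation l2 := (derive1n 2 lambda).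

(** The equation with the products of operators expanded, as a list of
coefficients and functions: for a fixed [t] the coefficients are constants, and the
terms can be tested one by one. *)
Definition expanded p (t : R) : seq (R * (R * R * R -> R)) :=
  let l := lambda t in
  [:: (1, pt (pt (pt (pt p)))); (4 * l, pt (pt (pt p)));
      (4 * l1 t + 5 * l ^+ 2, pt (pt p));
      (l2 t + 5 * (l * l1 t) + 2 * l ^+ 3, pt p);
      (- c ^+ 2, pt (pt (px (px p)))); (- c ^+ 2, pt (pt (py (py p))));
      (- (2 * l * c ^+ 2), pt (px (px p))); (- (2 * l * c ^+ 2), pt (py (py p)));
      (- (c ^+ 2 * (l1 t + l ^+ 2)), px (px p));
      (- (c ^+ 2 * (l1 t + l ^+ 2)), py (py p));
      (c ^+ 4, px (px (py (py p))))].

Definition expanded_equation p (z : R * R * R) : R := lincomb (expanded p z.2) z.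

End Equation.

Lemma expanded_sum {R : realType} (c l m1 m2 j1 j2 j3 j4 ax ay bx by_ dx dy w : R) :
  j4 + m2 * j1 + 2 * m1 * j2 + l * j3 - c ^+ 2 / 2 * (dx + dy) +
  3 * l * (j3 + m1 * j1 + l * j2 - c ^+ 2 / 2 * (bx + by_)) +
  (2 * m1 + 2 * l ^+ 2) * (j2 + l * j1 - c ^+ 2 / 2 * (ax + ay)) =
  c ^+ 2 / 2 * (dx + dy + l * (bx + by_)) - c ^+ 4 * w ->
  1 * j4 + (4 * l * j3 + ((4 * m1 + 5 * l ^+ 2) * j2 +
  ((m2 + 5 * (l * m1) + 2 * l ^+ 3) * j1 + (- c ^+ 2 * dx + (- c ^+ 2 * dy +
  (- (2 * l * c ^+ 2) * bx + (- (2 * l * c ^+ 2) * by_ +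
  (- (c ^+ 2 * (m1 + l ^+ 2)) * ax + (- (c ^+ 2 * (m1 + l ^+ 2)) * ay +
  (c ^+ 4 * w + 0)))))))))) = 0.
Proof.
move=> /eqP; rewrite -subr_eq0 => /eqP E; rewrite -[RHS]E; by field.
Qed.

Section Smooth.
Context {R : realType} (Omega : set (R * R * R)).
Local Notation smooth k g := (Ck [:: ex; ey; et] k Omega g).

Lemma smooth_px k g : smooth k.+1 g -> smooth k (px g).
Proof. by move=> sg; apply: (Ck_derive sg); rewrite !inE eqxx. Qed.

Lemma smooth_py k g : smooth k.+1 g -> smooth k (py g).
Proof. by move=> sg; apply: (Ck_derive sg); rewrite !inE eqxx orbT. Qed.

Lemma smooth_pt k g : smooth k.+1 g -> smooth k (pt g).
Proof. by move=> sg; apply: (Ck_derive sg); rewrite !inE eqxx !orbT. Qed.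

Lemma smooth0 k g : smooth k g -> smooth 0 g.
Proof. by elim: k g => // k IH g /CkW; exact: IH. Qed.

Lemma smooth_expanded c lambda p t : smooth 4 p ->
  foldr (fun q H => smooth 0 q.2 /\ H) True (expanded c lambda p t).
Proof.
move=> s4; have s2x := smooth_px (smooth_px s4); have s2y := smooth_py (smooth_py s4).
split; first exact: smooth_pt (smooth_pt (smooth_pt (smooth_pt s4))).
split; first exact: smooth0 (smooth_pt (smooth_pt (smooth_pt s4))).
split; first exact: smooth0 (smooth_pt (smooth_pt s4)).
split; first exact: smooth0 (smooth_pt s4).
split; first exact: smooth_pt (smooth_pt s2x).
split; first exact: smooth_pt (smooth_pt s2y).
split; first exact: smooth0 (smooth_pt s2x).
split; first exact: smooth0 (smooth_pt s2y).
split; first exact: smooth0 s2x.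
split; first exact: smooth0 s2y.
split; first exact: smooth_px (smooth_px s2y).
by [].
Qed.

End Smooth.

Section Pointwise.
Context {R : realType} {d : measure_display} {T : measurableType d}.
Context (P : probability T R) (c : R) (lambda : R -> R).
Context (N : R -> T -> nat) (k0 : T -> 'Z_4) (turn : nat -> T -> bool).
Context (X Y : R -> T -> R) (p : R * R * R -> R) (Omega : set (R * R * R)).
Hypothesis c_gt0 : 0 < c.
Hypothesis lambda_ge0 : forall t : R, 0 < t -> 0 <= lambda t.
Hypothesis lambda_C2 : Ck [:: 1 : R] 2 [set t : R | 0 < t] lambda.
Hypothesis motion : driven_motion P c lambda N k0 turn X Y.
Hypothesis density : forall t : R, 0 <= t ->
  ac_component_density (fun B => P [set w | B (X t w, Y t w)])
    (fun xy => p (xy, t)).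
Hypothesis Omega_open : open Omega.
Hypothesis p_C4 : Ck [:: ex; ey; et] 4 Omega p.
Local Notation smooth k g := (Ck [:: ex; ey; et] k Omega g).
Local Notation plane := (measurableTypeR R * measurableTypeR R)%type.
Local Notation lebesgue2 := ((@lebesgue_measure R) \x (@lebesgue_measure R))%E.

Let lambda_cont (t : R) : 0 < t -> {for t, continuous lambda}.
Proof. by move=> t0; exact: (Ck_continuous lambda_C2 t0). Qed.

Lemma rate_derive (t : R) : 0 < t ->
  is_derive t 1 lambda (derive1 lambda t) /\
  is_derive t 1 (derive1 lambda) (derive1n 2 lambda t).
Proof.
move=> t0; have m1 : (1 : R) \in [:: (1 : R)] by rewrite inE.
have E (f : R -> R) : derive1 f = 'D_1 f by apply/funext => s; rewrite derive1E.
split; first by rewrite E; apply: DeriveDef => //; exact: (Ck_derivable lambda_C2 m1 t0).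
rewrite [derive1n 2 lambda]E E; apply: DeriveDef => //.
exact: (Ck_derivable (Ck_derive lambda_C2 m1) m1 t0).
Qed.

Section TestedEquation.
Variables (x y t e : R).
Hypotheses (e_gt0 : 0 < e) (e_lt : e < t).
Hypothesis slab_sub : slab x y t e `<=` Omega.
Hypothesis law : forall t' : R, `|t' - t| <= e -> forall B, measurable B ->
  B `<=` box x y e ->
  P [set w | B (X t' w, Y t' w)] = (\int[lebesgue2]_(z in B) (p (z, t'))%:E)%E.

(** The weak equation on a small box, with all derivatives moved from the bump to
[p]. *)
Lemma tested_equation :
  tested x y e (bump x e) (bump y e) 0 0 (lincomb (expanded c lambda p t)) t = 0.
Proof.
have [K [ca cb]] := bump_chains x y e_gt0.
have ea := @bump_edge R x e e_gt0; have eb := @bump_edge R y e e_gt0.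
have tt : `|t - t| <= e by rewrite subrr normr0 ltW.
rewrite (tested_lincomb e_gt0 slab_sub ca cb tt (smooth_expanded c lambda t p_C4)).
pose M i j := mean P N k0 turn X Y (tensor (bump x e) (bump y e) weightA i j).
have [W WE] : exists W, W = tested x y e (bump x e) (bump y e) by eexists.
have near_t s : t - e < s -> s < t + e -> `|s - t| < e by move=> ? ?; rewrite ltr_distl; apply/andP.
have MW i j s : (i <= 4)%N -> (j <= 4)%N -> `|s - t| <= e -> M i j s = W i j p s.
  move=> i4 j4 hs; have s0 : 0 <= s.
    by move: hs (e_lt); rewrite ler_distl => /andP[? ?] ?; lra.
  rewrite WE /M [tensor _ _ _ _ _](_ : _ = fun u v _ => bump x e i u * bump y e j v); last first.
    apply/funext => u; apply/funext => v; apply/funext => k.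
    by rewrite /tensor /weightA mul1r.
  apply: (mean_local (K := K * K) (phi := fun u v => bump x e i u * bump y e j v)
    c_gt0 motion density s0 (law hs) (measurable_weight ca cb i4 j4) _ _).2.
  - by move=> u v; exact: (weight_le ca cb (u, v)).
  - move=> z zb; have [hx|hx] := lerP e `|z.1 - x|; first by rewrite ea ?mul0r// leqW.
    have [hy|hy] := lerP e `|z.2 - y|; first by rewrite [bump y e j _]eb ?mulr0// leqW.
    by exfalso; apply: zb; split; exact: ltW.
have s4 := p_C4.
have s3x := smooth_px s4; have s3y := smooth_py s4; have s3t := smooth_pt s4.
have s2x := smooth_px s3x; have s2y := smooth_py s3y; have s2t := smooth_pt s3t.
have s1t := smooth_pt s2t; have s0t := smooth_pt s1t.
have dW k g s : smooth k.+1 g -> t - e < s -> s < t + e ->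
    is_derive s 1 (W 0 0 g) (W 0 0 (pt g) s).
  move=> sg ? ?; rewrite WE.
  exact: (tested_derive e_gt0 slab_sub ca cb (isT : (0 <= 4)%N) (isT : (0 <= 4)%N) sg (near_t s _ _)).
have wx i j k g s : (i <= 3)%N -> (j <= 4)%N -> smooth k.+1 g -> `|s - t| <= e ->
    W i.+1 j g s = - W i j (px g) s.
  by rewrite WE; exact: (tested_px e_gt0 slab_sub ca cb ea).
have wy i j k g s : (i <= 4)%N -> (j <= 3)%N -> smooth k.+1 g -> `|s - t| <= e ->
    W i j.+1 g s = - W i j (py g) s.
  by rewrite WE; exact: (tested_py e_gt0 slab_sub ca cb eb).
have W2x j k g s : (j <= 4)%N -> smooth k.+2 g -> `|s - t| <= e ->
    W 2 j g s = W 0 j (px (px g)) s.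
  move=> j4 sg hs; apply: etrans (wx 1 j _ _ _ isT j4 sg hs) _.
  exact: etrans (congr1 -%R (wx 0 j _ _ _ isT j4 (smooth_px sg) hs)) (opprK _).
have W2y i k g s : (i <= 4)%N -> smooth k.+2 g -> `|s - t| <= e ->
    W i 2 g s = W i 0 (py (py g)) s.
  move=> i4 sg hs; apply: etrans (wy i 1 _ _ _ i4 isT sg hs) _.
  exact: etrans (congr1 -%R (wy i 0 _ _ _ i4 isT (smooth_py sg) hs)) (opprK _).
have WS s : `|s - t| <= e -> W 2 0 p s + W 0 2 p s =
    W 0 0 (px (px p)) s + W 0 0 (py (py p)) s.
  by move=> hs; rewrite (W2x 0%N _ _ _ isT s4 hs) (W2y 0%N _ _ _ isT s4 hs).
have W22 : W 2 2 p t = W 0 0 (px (px (py (py p)))) t.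
  by rewrite (W2y 2%N _ p t isT s4 tt) (W2x 0%N _ _ t isT s2y tt).
have u0 : 0 <= t - e by rewrite subr_ge0 ltW.
have ut : t - e < t by rewrite ltrBlDr ltrDl.
have tv : t < t + e by rewrite ltrDl.
have pos s : t - e < s -> 0 < s by exact: le_lt_trans.
have dJ s : t - e < s -> s < t + e -> [/\ is_derive s 1 (W 0 0 p) (W 0 0 (pt p) s),
    is_derive s 1 (W 0 0 (pt p)) (W 0 0 (pt (pt p)) s) &
    is_derive s 1 (W 0 0 (pt (pt p))) (W 0 0 (pt (pt (pt p))) s)].
  by move=> us sv; split; [exact: dW s4 us sv|exact: dW s3t us sv|exact: dW s2t us sv].
have eS s : t - e < s -> s < t + e ->
    M 2 0 s + M 0 2 s = W 0 0 (px (px p)) s + W 0 0 (py (py p)) s.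
  by move=> us sv; have hs := ltW (near_t s us sv); rewrite !MW// WS.
have dS s : t - e < s -> s < t + e ->
    is_derive s 1 (fun s => W 0 0 (px (px p)) s + W 0 0 (py (py p)) s)
      (W 0 0 (pt (px (px p))) s + W 0 0 (pt (py (py p))) s) /\
    is_derive s 1 (fun s => W 0 0 (pt (px (px p))) s + W 0 0 (pt (py (py p))) s)
      (W 0 0 (pt (pt (px (px p)))) s + W 0 0 (pt (pt (py (py p)))) s).
  move=> us sv; split; first exact: der_add (dW _ _ _ s2x us sv) (dW _ _ _ s2y us sv).
  exact: der_add (dW _ _ _ (smooth_pt s2x) us sv) (dW _ _ _ (smooth_pt s2y) us sv).
have E := @weak_fourth_order R c lambda M
  (fun i j => mean P N k0 turn X Y (tensor (bump x e) (bump y e) weightE i j))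
  (fun i j => mean P N k0 turn X Y (tensor (bump x e) (bump y e) dirx i j))
  (fun i j => mean P N k0 turn X Y (tensor (bump x e) (bump y e) diry i j))
  c_gt0
  (MA_derive c_gt0 lambda_ge0 lambda_cont motion ca cb)
  (ME_derive c_gt0 lambda_ge0 lambda_cont motion ca cb)
  (MH_derive c_gt0 lambda_ge0 lambda_cont motion ca cb)
  (MV_derive c_gt0 lambda_ge0 lambda_cont motion ca cb)
  (t - e) (t + e) t (derive1 lambda) (derive1n 2 lambda t)
  (W 0 0 p) (W 0 0 (pt p)) (W 0 0 (pt (pt p))) (W 0 0 (pt (pt (pt p))))
  (fun s => W 0 0 (px (px p)) s + W 0 0 (py (py p)) s)
  (fun s => W 0 0 (pt (px (px p))) s + W 0 0 (pt (py (py p))) s)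
  (fun s => W 0 0 (pt (pt (px (px p)))) s + W 0 0 (pt (pt (py (py p)))) s)
  (W 0 0 (pt (pt (pt (pt p)))) t)
  u0 ut tv
  (fun s us sv => MW 0 0 s isT isT (ltW (near_t s us sv)))
  eS
  dJ (dW _ _ _ s1t ut tv) dS
  (fun s us _ => (rate_derive (pos s us)).1) (rate_derive (pos t ut)).2.
rewrite MW// W22 in E; rewrite -WE /=.
exact: expanded_sum E.
Qed.

End TestedEquation.
(** If the left-hand side had a nonzero value there, its product with that value
would be positive on a small box, which contradicts the weak equation. *)
Lemma equation_off_boundary (x y t : R) : 0 < t -> Omega ((x, y), t) ->
  Num.max `|x + y| `|x - y| != c * t -> expanded_equation c lambda p ((x, y), t) = 0.
Proof.
move=> t0 Ot bt; apply/eqP/negP => /negP v0.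
set v := expanded_equation _ _ _ _ in v0.
have sE := smooth_expanded c lambda t p_C4.
pose F := lincomb [:: (v, lincomb (expanded c lambda p t))].
have sF : smooth 0 F by apply: smooth_lincomb; split=> //; exact: smooth_lincomb sE.
have F0 : 0 < F ((x, y), t).
  by rewrite /F /lincomb/= addr0 -expr2 exprn_even_gt0.
have OF : \forall z \near ((x, y), t), Omega z /\ 0 < F z.
  apply: filterI; first exact: open_nbhs_nbhs.
  exact: (cvgr_gt _ (sF.1 _ Ot) _ F0).
have [e1 [e10 e1t law]] := law_near c_gt0 lambda_ge0 lambda_cont motion density t0 bt.
have [e2 e20 sub2] := slab_near OF.
pose e := Num.min e1 e2.
have e0 : 0 < e by rewrite lt_min e10.
have ee1 : e <= e1 by rewrite ge_min lexx.
have ee2 : e <= e2 by rewrite ge_min lexx orbT.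
have sub : slab x y t e `<=` Omega.
  by move=> z /(slab_mono ee2)/sub2[].
have law' (t' : R) : `|t' - t| <= e -> forall B, measurable B -> B `<=` box x y e ->
    P [set w | B (X t' w, Y t' w)] = (\int[lebesgue2]_(z in B) (p (z, t'))%:E)%E.
  move=> ht B mB Be; apply: law => //; first exact: le_trans ee1.
  by move=> z /Be[h1 h2]; split; exact: le_trans ee1.
have E0 := tested_equation e0 (le_lt_trans ee1 e1t) sub law'.
have := tested_bump_neq0 e0 sub sF (fun z sz => (sub2 z (slab_mono ee2 sz)).2).
have [K [ca cb]] := bump_chains x y e0.
have tt : `|t - t| <= e by rewrite subrr normr0 ltW.
rewrite (tested_lincomb e0 sub ca cb tt) /=; last by split=> //; exact: smooth_lincomb sE.
by rewrite E0 mulr0 addr0 eqxx.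
Qed.

Lemma equation_continuous (x y t : R) : 0 < t -> Omega ((x, y), t) ->
  {for t, continuous (fun s => expanded_equation c lambda p ((x, y), s))}.
Proof.
move=> t0 Ot; have m1 : (1 : R) \in [:: (1 : R)] by rewrite inE.
have E (f : R -> R) : derive1 f = 'D_1 f by apply/funext => s; rewrite derive1E.
have C1 := Ck_derive lambda_C2 m1; have C2 := Ck_derive C1 m1.
have cl := lambda_cont t0.
have cl1 : {for t, continuous (derive1 lambda)} by rewrite E; exact: (Ck_continuous C1 t0).
have cl2 : {for t, continuous (derive1n 2 lambda)}.
  by rewrite [derive1n 2 lambda]E E; exact: (Ck_continuous C2 t0).
have cg g : smooth 0 g -> {for t, continuous (fun s => g ((x, y), s))}.
  move=> [sg _]; apply: (continuous_comp (f := fun s => ((x, y), s))); last exact: sg.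
  exact: (cvg_pair (cvg_cst (x, y)) cvg_id).
have cD (f g : R -> R) : {for t, continuous f} -> {for t, continuous g} ->
  {for t, continuous (fun s => f s + g s)} by move=> hf hg; exact: cvgD hf hg.
have cM (f g : R -> R) : {for t, continuous f} -> {for t, continuous g} ->
  {for t, continuous (fun s => f s * g s)} by move=> hf hg; exact: cvgM hf hg.
have cN (f : R -> R) : {for t, continuous f} ->
  {for t, continuous (fun s => - f s)} by move=> hf; exact: cvgN hf.
have cc (r : R) : {for t, continuous (fun=> r)} by exact: cvg_cst.
have cX n : {for t, continuous (fun s => lambda s ^+ n)}.
  elim: n => [|n IH]; first exact: cc.
  suff -> : (fun s => lambda s ^+ n.+1) = (fun s => lambda s * lambda s ^+ n) by exact: cM cl IH.
  by apply/funext => s; rewrite exprS.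
have [s1 [s2 [s3 [s4 [s5 [s6 [s7 [s8 [s9 [s10 [s11 _]]]]]]]]]]] :=
  smooth_expanded c lambda t p_C4.
rewrite /expanded_equation /lincomb /=.
apply: (cD _ _ (cM _ _ (cc _) (cg _ s1))).
apply: (cD _ _ (cM _ _ (cM _ _ (cc _) cl) (cg _ s2))).
apply: (cD _ _ (cM _ _ (cD _ _ (cM _ _ (cc _) cl1) (cM _ _ (cc _) (cX _))) (cg _ s3))).
apply: (cD _ _ (cM _ _ (cD _ _ (cD _ _ cl2 (cM _ _ (cc _) (cM _ _ cl cl1)))
  (cM _ _ (cc _) (cX _))) (cg _ s4))).
apply: (cD _ _ (cM _ _ (cc _) (cg _ s5))).
apply: (cD _ _ (cM _ _ (cc _) (cg _ s6))).
have cl' : {for t, continuous (fun s => - (2 * lambda s * c ^+ 2))}.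
  exact: cN (cM _ _ (cM _ _ (cc _) cl) (cc _)).
have cl'' : {for t, continuous (fun s => - (c ^+ 2 * (derive1 lambda s + lambda s ^+ 2)))}.
  exact: cN (cM _ _ (cc _) (cD _ _ cl1 (cX _))).
apply: (cD _ _ (cM _ _ cl' (cg _ s7))).
apply: (cD _ _ (cM _ _ cl' (cg _ s8))).
apply: (cD _ _ (cM _ _ cl'' (cg _ s9))).
apply: (cD _ _ (cM _ _ cl'' (cg _ s10))).
exact: (cD _ _ (cM _ _ (cc _) (cg _ s11)) (cc _)).
Qed.

(** A point on the boundary of the square at time [t] is off the boundary at all
other times, and the left-hand side is continuous in time. *)
Lemma equation_holds (x y t : R) : 0 < t -> Omega ((x, y), t) ->
  expanded_equation c lambda p ((x, y), t) = 0.
Proof.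
move=> t0 Ot.
have [bt|bt] := eqVneq (Num.max `|x + y| `|x - y|) (c * t); last first.
  exact: equation_off_boundary.
apply/eqP/negP => /negP v0.
have /nbhs_ballP[r /= r0 rV] :
    nbhs t [set s | expanded_equation c lambda p ((x, y), s) != 0].
  exact: (cvgr_neq0 _ (equation_continuous t0 Ot) v0).
have /slab_near[e e0 sub] := open_nbhs_nbhs (conj Omega_open Ot).
pose h := Num.min r e / 2.
have h0 : 0 < h by rewrite divr_gt0// lt_min r0.
have hr : h < r by have : Num.min r e <= r; [rewrite ge_min lexx|rewrite /h; lra].
have he : h <= e by have : Num.min r e <= e; [rewrite ge_min lexx orbT|rewrite /h; lra].
have Oh : Omega ((x, y), t + h).
  by apply: sub; split=> /=; [rewrite subrr normr0 ltW|rewrite subrr normr0 ltW|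
    rewrite addrAC subrr add0r gtr0_norm].
have : expanded_equation c lambda p ((x, y), t + h) != 0.
  by apply: rV; rewrite /ball /= opprD addNKr normrN gtr0_norm.
rewrite equation_off_boundary ?eqxx ?addr_gt0//.
by rewrite bt mulrDr eq_sym -subr_eq0 addrAC subrr add0r mulf_neq0// gt_eqF.
Qed.

End Pointwise.

(** * Composition of the operators *)

Lemma operators_sum {R : realType} (c l m1 m2 p1 p2 p3 p4 ax ay bx by_ dx dy w : R) :
  p4 + 2 * (l * p3 + p2 * m1 + (p1 * m2 + m1 * p2)) - c ^+ 2 * (dx + dy) +
  2 * l * (p3 + 2 * (l * p2 + p1 * m1) - c ^+ 2 * (bx + by_)) +
  (l ^+ 2 + m1) * (p2 + 2 * (l * p1) - c ^+ 2 * (ax + ay)) + c ^+ 4 * w -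
  (m1 * p2 + (m2 + l * m1) * p1) =
  1 * p4 + (4 * l * p3 + ((4 * m1 + 5 * l ^+ 2) * p2 +
  ((m2 + 5 * (l * m1) + 2 * l ^+ 3) * p1 + (- c ^+ 2 * dx + (- c ^+ 2 * dy +
  (- (2 * l * c ^+ 2) * bx + (- (2 * l * c ^+ 2) * by_ +
  (- (c ^+ 2 * (m1 + l ^+ 2)) * ax + (- (c ^+ 2 * (m1 + l ^+ 2)) * ay +
  (c ^+ 4 * w + 0)))))))))).
Proof. by ring. Qed.

Section Expansion.
Context {R : realType} (c : R) (lambda : R -> R) (p : R * R * R -> R).
Variable Omega : set (R * R * R).
Hypothesis Omega_open : open Omega.
Hypothesis Omega_pos : Omega `<=` [set z | 0 < z.2].
Hypothesis lambda_C2 : Ck [:: 1 : R] 2 [set t : R | 0 < t] lambda.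
Hypothesis p_C4 : Ck [:: ex; ey; et] 4 Omega p.
Local Notation smooth k g := (Ck [:: ex; ey; et] k Omega g).

Lemma is_derive_time (f : R -> R) (df : R) (z : R * R * R) :
  is_derive z.2 1 f df -> is_derive z et (fun z => f z.2) df.
Proof.
have E : (fun h : R => h^-1 *: (f (h *: et + z).2 - f z.2)) =
    (fun h : R => h^-1 *: (f (h *: 1 + z.2) - f z.2)) by [].
by move=> [D <-]; split; [rewrite /derivable E|rewrite /derive E].
Qed.

Let dpt k (g : R * R * R -> R) (z : R * R * R) : smooth k.+1 g -> Omega z ->
  is_derive z et g (pt g z).
Proof.
move=> sg Oz; apply: DeriveDef => //.
by apply: (Ck_derivable sg) => //; rewrite !inE eqxx !orbT.
Qed.

Let pt_near (f g : R * R * R -> R) (z : R * R * R) (dg : R) : Omega z ->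
  (forall y, Omega y -> f y = g y) -> is_derive z et g dg -> pt f z = dg.
Proof.
move=> Oz fg [_ <-]; apply: near_eq_derive.
by apply: filterS (open_nbhs_nbhs (conj Omega_open Oz)).
Qed.

Lemma operators_expanded (z : R * R * R) : Omega z ->
  expanded_equation c lambda p z = 0 ->
  outer_operator lambda (inner_operator c lambda p) z
    + c ^+ 4 * px (px (py (py p))) z
  = derive1 lambda z.2 * pt (pt p) z
    + (derive1n 2 lambda z.2 + lambda z.2 * derive1 lambda z.2) * pt p z.
Proof.
move=> Oz E0; have s4 := p_C4.
have s3 := smooth_pt s4; have s2 := smooth_pt s3; have s1 := smooth_pt s2.
have sx := smooth_px (smooth_px s4); have sy := smooth_py (smooth_py s4).
have sx1 := smooth_pt sx; have sy1 := smooth_pt sy.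
have dl y : Omega y -> is_derive y et (fun z => lambda z.2) (derive1 lambda y.2).
  by move=> /Omega_pos y0; exact: (is_derive_time (rate_derive lambda_C2 y0).1).
have dl1 y : Omega y ->
    is_derive y et (fun z => derive1 lambda z.2) (derive1n 2 lambda y.2).
  by move=> /Omega_pos y0; exact: (is_derive_time (rate_derive lambda_C2 y0).2).
pose I := inner_operator c lambda p.
pose I1 y := pt (pt (pt p)) y
  + 2 * (lambda y.2 * pt (pt p) y + pt p y * derive1 lambda y.2)
  - c ^+ 2 * (pt (px (px p)) y + pt (py (py p)) y).
pose I2 y := pt (pt (pt (pt p))) y
  + 2 * (lambda y.2 * pt (pt (pt p)) y + pt (pt p) y * derive1 lambda y.2
    + (pt p y * derive1n 2 lambda y.2 + derive1 lambda y.2 * pt (pt p) y))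
  - c ^+ 2 * (pt (pt (px (px p))) y + pt (pt (py (py p))) y).
have IE y : I y = pt (pt p) y + 2 * (lambda y.2 * pt p y)
    - c ^+ 2 * (px (px p) y + py (py p) y) by rewrite /I /inner_operator mulrA.
have dI y : Omega y -> pt I y = I1 y.
  move=> Oy; apply: (pt_near Oy (fun y _ => IE y)).
  exact: der_sub (der_add (dpt s2 Oy) (der_scale 2 (der_mul (dl y Oy) (dpt s3 Oy))))
    (der_scale (c ^+ 2) (der_add (dpt sx Oy) (dpt sy Oy))).
have d2I : pt (pt I) z = I2 z.
  apply: (pt_near Oz dI).
  exact: der_sub (der_add (dpt s1 Oz) (der_scale 2 (der_add
      (der_mul (dl z Oz) (dpt s2 Oz)) (der_mul (dpt s3 Oz) (dl1 z Oz)))))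
    (der_scale (c ^+ 2) (der_add (dpt sx1 Oz) (dpt sy1 Oz))).
rewrite /outer_operator -/I d2I (dI z Oz) IE /I2 /I1.
apply/eqP; rewrite -subr_eq0; apply/eqP; rewrite -[RHS]E0.
rewrite /expanded_equation /lincomb /=.
exact: operators_sum.
Qed.

End Expansion.

Theorem theorem2p1 (R : realType) (d : measure_display) (T : measurableType d)
  (P : probability T R) (c : R) (lambda : R -> R) (X Y : R -> T -> R)
  (p : R * R * R -> R) (Omega : set (R * R * R)) :
  0 < c ->
  (forall t, 0 < t -> 0 <= lambda t) ->
  Ck [:: 1 : R] 2 [set t : R | 0 < t] lambda ->
  standard_orthogonal_motion P c lambda X Y ->
  (forall t, 0 <= t ->
     ac_component_density (fun B => P [set w | B (X t w, Y t w)])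
       (fun xy => p (xy, t))) ->
  open Omega ->
  Omega `<=` [set z | 0 < z.2] ->
  Ck [:: ex; ey; et] 4 Omega p ->
  forall z, Omega z ->
    outer_operator lambda (inner_operator c lambda p) z
      + c ^+ 4 * px (px (py (py p))) z
    = derive1 lambda z.2 * pt (pt p) z
      + (derive1n 2 lambda z.2 + lambda z.2 * derive1 lambda z.2) * pt p z.
Proof.
move=> c0 lambda0 Cl [N [k0 [turn motion]]] dens oO Opos Cp z Oz.
apply: (operators_expanded oO Opos Cl Cp Oz).
case: z Oz => [[x y] t] Oz.
exact: (equation_holds c0 lambda0 Cl motion dens oO Cp (Opos _ Oz) Oz).
Qed.
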